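(* Let $d\ge 2$ and consider Bernoulli bond percolation on $\mathbb{Z}^d$ with one-arm exponent $\eta_1$ as defined in the context. Then \[ \eta_1 \le \begin{cases} 1/3 & d=2,\\ d/3 & d\ge 3.\end{cases}\]
   Context: Let $\mathbb{Z}^d=(\mathcal V,\mathcal E)$ be the hypercubic lattice with nearest-neighbour edges. For $p\in[0,1]$, $\mathbb{P}_p$ denotes the law of Bernoulli bond percolation: each edge is open independently with probability $p$. For $A,B\subseteq\mathcal V$, $\{A\longleftrightarrow B\}$ is the event that there is a path of open edges intersecting both $A$ and $B$ (the empty path is allowed, so the event occurs if $A\cap B\neq\emptyset$). Let $\Lambda_R=[-R,R]^d\cap\mathbb{Z}^d$ with boundary $\partial\Lambda_R$ (vertices of $\Lambda_R$ of sup-norm $R$). Let $\theta(p)=\lim_{R\to\infty}\mathbb{P}_p[0\longleftrightarrow\partial\Lambda_R]$ and let $p_c\in(0,1)$ be the critical parameter, so that $\theta(p)=0$ for $p<p_c$ and $\theta(p)>0$ for $p>p_c$. The one-arm exponent is \[\eta_1:=\liminf_{R\to\infty}\frac{-\log\mathbb{P}_{p_c}[0\longleftrightarrow\partial\Lambda_R]}{\log R}.\] *)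

(* Defs.v *)
From HB Require Import structures.
From mathcomp Require Import all_boot all_order all_algebra.
From mathcomp Require Import all_classical all_reals all_analysis.
Set Implicit Arguments. Unset Strict Implicit. Unset Printing Implicit Defensive.
Import Order.TTheory GRing.Theory Num.Theory.
Import numFieldNormedType.Exports.
Local Open Scope ring_scope.

(* Bernoulli bond percolation on Z^d, seen through the box Lambda_n.
   A vertex x of Lambda_n = [-n,n]^d is encoded by x : 'I_d -> 'I_(2n+1),
   the actual coordinate i being (x i) - n. *)
Section Percolation.
Variable d : nat.

Definition box (n : nat) := {ffun 'I_d -> 'I_(n.*2.+1)}.

(* x + e_i (only meaningful when x i < 2n) *)
Definition step n (x : box n) (i : 'I_d) : box n :=
  [ffun j => if j == i then inord (x j).+1 else x j].

(* Nearest-neighbour edges of Lambda_n: each edge {x, x + e_i} is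
   encoded once, by its lower endpoint x and its direction i. *)
Definition bedge n := {e : box n * 'I_d | (e.1 e.2 < n.*2)%N}.

Definition edge_between n (e : bedge n) (x y : box n) : bool :=
  ((sval e).1 == x) && (step (sval e).1 (sval e).2 == y).

Definition open_rel n (w : {ffun bedge n -> bool}) : rel (box n) :=
  fun x y => [exists e, w e && (edge_between e x y || edge_between e y x)].

Definition origin n : box n := [ffun _ => inord n].

Definition on_boundary n (x : box n) : bool :=
  [exists i, ((x i : nat) == 0%N) || ((x i : nat) == n.*2)].

Definition arm_event n (w : {ffun bedge n -> bool}) : bool :=
  [exists y, on_boundary y && connect (open_rel w) (origin n) y].

(* P_p[0 <-> boundary Lambda_n]; this event only depends on the edges of
   Lambda_n, so it is computed under the product Bernoulli(p) law on them. *)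
Definition one_arm_prob (R : realType) (p : R) (n : nat) : R :=
  \sum_(w : {ffun bedge n -> bool} | arm_event w)
     \prod_(e : bedge n) (if w e then p else 1 - p).

Definition theta (R : realType) (p : R) : R :=
  limn (fun n => one_arm_prob p n).

Definition p_c (R : realType) : R :=
  sup [set p : R | 0 <= p <= 1 /\ theta p = 0].

Definition eta1 (R : realType) : \bar R :=
  limn_einf (fun n : nat =>
    ((- ln (one_arm_prob (p_c R) n)) / ln (n%:R : R))%:E).

End Percolation.

(* Main.v *)
Require Import Defs.
From HB Require Import structures.
From mathcomp Require Import all_boot all_order all_algebra.
From mathcomp Require Import all_classical all_reals all_analysis.
From mathcomp Require Import ring lra zify.
Set Implicit Arguments. Unset Strict Implicit. Unset Printing Implicit Defensive.
Import Order.TTheory GRing.Theory Num.Theory.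
Import numFieldNormedType.Exports.
Local Open Scope ring_scope.

(* d >= 3.  Suppose theta_n(p_c) <= n^(-a) with a > d/3.  Above p_c the Duminil-Copin--Tassion
   argument gives the mean-field bound theta_n(p) >= (p - p_c)/2.  Exploring the cluster C of 0
   in the box of radius n costs E|C| <= sum_x theta_{|x|/2}^2 <= n^(d-2a), so by a relative
   entropy bound along this exploration, moving from p_c to p_c + eps changes theta_n by at
   most eps^2 n^(d-2a) up to constants.  With eps of order n^(-a) both bounds together give
   n^(d-3a) >= const, a contradiction.
   d = 2.  The Russo--Seymour--Welsh estimate (Bollobas--Riordan version) at p = 1/2 gives
   theta(1/2) = 0, so p_c >= 1/2.  At p = 1/2 a square is crossed with probability at least 1/2,
   and the lowest crossing passes the middle column at an edge with two disjoint open arms and a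
   closed dual arm; by the BK and Harris inequalities 1/2 <= theta_m^2 sum_(j <= 2m) theta_j,
   which is incompatible with theta_n <= n^(-a), a > 1/3. *)

(** * Bernoulli expectations *)

(** Every event used depends on finitely many edges, and its probability is a finite sum over the
    states of any list of edges containing them, so all estimates take place in finite products.
    Several arguments reveal some edges and need the others to stay fresh; this is encoded once, as
    resampling outside a stopping set, and serves for independence, for both Duminil-Copin--Tassion
    inequalities, for the entropy bound and for the lowest crossing. The entropy bound is quadratic
    in eps where the mean-field bound is linear, and this gap is what yields d/3. The sum of
    theta_{|x|/2}^2 over the box is controlled by n^(d-2a) for a < d/2, so the exponent a is chosen
    between d/3 and d/2 (between 1/3 and 1 in the plane). The entropy cost carries 1/(p'(1-p')),
    hence p_c must differ from 0 and 1; this is read off from the assumed decay. Planar topology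
    enters only through parity counts of edges along columns, in place of the Jordan curve
    theorem. *)

Section FinBernoulli.
Variable R : realType.
Implicit Types (p : R) (E : finType).

Definition bw p (b : bool) : R := if b then p else 1 - p.

Definition fin_weight E p (v : {ffun E -> bool}) : R := \prod_e bw p (v e).

Definition fin_Ex E p (g : {ffun E -> bool} -> R) : R :=
  \sum_v fin_weight p v * g v.

Lemma bw_sum p : \sum_b bw p b = 1.
Proof. by rewrite big_bool /= /bw; ring. Qed.

Lemma fin_Ex_prod E p (a : E -> bool -> R) :
  fin_Ex p (fun v => \prod_e a e (v e)) = \prod_e (\sum_b bw p b * a e b).
Proof.
rewrite bigA_distr_bigA; apply: eq_bigr => v _.
by rewrite /fin_weight -big_split.
Qed.

Lemma fin_weight_sum E p : \sum_(v : {ffun E -> bool}) fin_weight p v = 1.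
Proof.
have := fin_Ex_prod p (fun (_ : E) _ => 1); rewrite /fin_Ex.
rewrite [RHS]big1 => [<-|e _]; last by under eq_bigr do rewrite mulr1; exact: bw_sum.
by apply: eq_bigr => v _; rewrite big1 // mulr1.
Qed.

Lemma fin_Ex_marginal E1 E2 p (phi : E1 -> E2) (g : {ffun E1 -> bool} -> R) :
  injective phi -> fin_Ex p (fun w => g [ffun e => w (phi e)]) = fin_Ex p g.
Proof.
move=> phiI; rewrite /fin_Ex.
rewrite (partition_big (fun w : {ffun E2 -> bool} => [ffun e => w (phi e)]) xpredT) //=.
apply: eq_bigr => v _.
under eq_bigr => w /eqP -> do rewrite mulrC.
rewrite -mulr_sumr mulrC; congr (_ * _).
(* [Q e] is the set of states allowed at [e], so the fibre over [v] is a product family and its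
   weight factorizes; edges outside the image of [phi] contribute factors 1. *)
pose Q (e : E2) := [pred b | [forall e', (phi e' == e) ==> (v e' == b)]].
have -> : \sum_(w : {ffun E2 -> bool} | [ffun e => w (phi e)] == v) fin_weight p w =
  \sum_(w in family Q) \prod_e bw p (w e).
  apply: eq_bigl => w; apply/eqP/familyP => [/ffunP H e|H].
    by rewrite inE; apply/forallP => e'; apply/implyP => /eqP <-; rewrite -H ffunE.
  apply/ffunP => e; rewrite ffunE; have := H (phi e); rewrite inE.
  by move=> /forallP /(_ e) /implyP /(_ (eqxx _)) /eqP ->.
rewrite -(bigA_distr_big_dep _ (fun _ b => bw p b)) (bigID (mem (codom phi))) /=.
rewrite [X in _ * X]big1 ?mulr1; last first.
  move=> e /negP ne; rewrite -[RHS](bw_sum p); apply: eq_bigl => b.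
  apply/forallP => e'; apply/implyP => /eqP ee; case: ne; rewrite -ee; exact: codom_f.
have -> : \prod_(e in codom phi) (\sum_(j | Q e j) bw p j) =
  \prod_(e <- codom phi) (\sum_(j | Q e j) bw p j).
  rewrite big_uniq //=; exact/injectiveP.
rewrite big_map big_enum /=; apply: eq_bigr => e _.
rewrite (eq_bigl (pred1 (v e))) => [|b /=]; first by rewrite big_pred1_eq.
apply/forallP/eqP => [/(_ e)|-> e']; first by rewrite eqxx => /eqP.
by apply/implyP => /eqP /phiI ->.
Qed.

End FinBernoulli.

Lemma big_seq_sub (L : choiceType) (T : Type) (idx : T) (op : Monoid.com_law idx)
    (s : seq L) (F : L -> T) : uniq s ->
  \big[op/idx]_(e <- s) F e = \big[op/idx]_(e : seq_sub s) F (val e).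
Proof.
move=> us; transitivity (\big[op/idx]_(e <- map val (seq_sub_enum s)) F e).
  by rewrite val_seq_sub_enum.
rewrite big_map /=; apply: perm_big; apply: uniq_perm; rewrite ?index_enum_uniq //.
  by rewrite -(map_inj_uniq val_inj) val_seq_sub_enum.
by move=> e; rewrite mem_index_enum mem_seq_sub_enum.
Qed.

Section Expectation.
Variable R : realType.
Implicit Types p : R.

(** Edges outside [s] are closed. This default is what lets [Ex_eq] and [Ex_le] assume that the
    configuration vanishes off the list. *)
Definition ext (L : choiceType) (s : seq L) (v : {ffun seq_sub s -> bool}) (e : L) : bool :=
  if insub e is Some e' then v e' else false.

Definition Ex (L : choiceType) p (s : seq L) (f : (L -> bool) -> R) : R :=
  fin_Ex p (fun v : {ffun seq_sub s -> bool} => f (ext v)).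

Definition dep (L : Type) (T : Type) (A : set L) (f : (L -> bool) -> T) :=
  forall w w', (forall e, A e -> w e = w' e) -> f w = f w'.

Definition mix (L : Type) (A w w' : L -> bool) (e : L) := if A e then w e else w' e.

Definition upd (L : eqType) (w : L -> bool) (e : L) (b : bool) (e' : L) :=
  if e' == e then b else w e'.

Lemma ext_val (L : choiceType) (s : seq L) (v : {ffun seq_sub s -> bool}) e : ext v (val e) = v e.
Proof. by rewrite /ext valK. Qed.

Lemma ext_out (L : choiceType) (s : seq L) (v : {ffun seq_sub s -> bool}) e :
  e \notin s -> ext v e = false.
Proof. by move=> es; rewrite /ext insubN. Qed.

Lemma eq_ext (L : choiceType) (s : seq L) (v : {ffun seq_sub s -> bool}) w :
  (forall e, w (val e) = v e) -> (forall e, e \notin s -> w e = false) -> w = ext v.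
Proof.
move=> h1 h2; apply/funext => e; have [es|es] := boolP (e \in s).
  by rewrite -[e]/(val (SeqSub es)) h1 ext_val.
by rewrite h2 // ext_out.
Qed.

(** The marginal of a product law along an injection is a product law. With [tau] the identity this
    enlarges the list of edges; with a lattice symmetry it gives invariance. *)
Lemma Ex_transfer (L1 L2 : choiceType) p (tau : L1 -> L2) s1 s2 (g : (L1 -> bool) -> R) :
  {in s1 &, injective tau} -> (forall e, e \in s1 -> tau e \in s2) ->
  dep [set` s1] g -> Ex p s2 (fun w => g (w \o tau)) = Ex p s1 g.
Proof.
move=> tauI tauS gs.
pose phi (e : seq_sub s1) : seq_sub s2 := SeqSub (tauS _ (valP e)).
have phiI : injective phi.
  move=> e1 e2 [] /(tauI _ _ (valP e1) (valP e2)) e12; exact: val_inj.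
rewrite /Ex -(fin_Ex_marginal p _ phiI); apply: eq_bigr => v _; congr (_ * _).
apply: gs => e /= es.
rewrite -[e]/(val (SeqSub es)) ext_val ffunE -ext_val //.
Qed.

Section FixedEdgeType.
Variable L : choiceType.
Implicit Types (s t : seq L) (f g : (L -> bool) -> R) (w : L -> bool).

Lemma Ex_dep p s s' f : {subset s' <= s} -> dep [set` s'] f -> Ex p s f = Ex p s' f.
Proof. by move=> ss fs; rewrite -(@Ex_transfer _ _ p id s' s). Qed.

Lemma Ex_eq p s f g : (forall w, (forall e, e \notin s -> w e = false) -> f w = g w) ->
  Ex p s f = Ex p s g.
Proof. by move=> fg; apply: eq_bigr => v _; rewrite fg // => e; exact: ext_out. Qed.

Lemma ExD p s f g : Ex p s (fun w => f w + g w) = Ex p s f + Ex p s g.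
Proof. by rewrite /Ex /fin_Ex -big_split; apply: eq_bigr => v _; rewrite mulrDr. Qed.

Lemma ExZ p s (c : R) f : Ex p s (fun w => c * f w) = c * Ex p s f.
Proof. by rewrite /Ex /fin_Ex mulr_sumr; apply: eq_bigr => v _; rewrite mulrCA. Qed.

Lemma ExN p s f : Ex p s (fun w => - f w) = - Ex p s f.
Proof. by rewrite -mulN1r -ExZ; apply: Ex_eq => w _; rewrite mulN1r. Qed.

Lemma ExB p s f g : Ex p s (fun w => f w - g w) = Ex p s f - Ex p s g.
Proof. by rewrite ExD ExN. Qed.

Lemma Ex_cst p s (c : R) : Ex p s (fun=> c) = c.
Proof. by rewrite /Ex /fin_Ex -mulr_suml fin_weight_sum mul1r. Qed.

Lemma Ex_sum p s (I : Type) (r : seq I) (P : pred I) (F : I -> (L -> bool) -> R) :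
  Ex p s (fun w => \sum_(i <- r | P i) F i w) = \sum_(i <- r | P i) Ex p s (F i).
Proof.
by rewrite /Ex /fin_Ex exchange_big; apply: eq_bigr => v _; rewrite mulr_sumr.
Qed.

Lemma Ex_le p s f g : 0 <= p <= 1 ->
  (forall w, (forall e, e \notin s -> w e = false) -> f w <= g w) -> Ex p s f <= Ex p s g.
Proof.
move=> p01 fg; apply: ler_sum => v _; apply: ler_wpM2l.
  by apply: prodr_ge0 => e _; rewrite /bw; case: ifP => _; lra.
by apply: fg => e; exact: ext_out.
Qed.

Lemma Ex_ge0 p s f : 0 <= p <= 1 -> (forall w, 0 <= f w) -> 0 <= Ex p s f.
Proof. by move=> p01 f0; rewrite -(Ex_cst p s 0); apply: Ex_le. Qed.

Lemma Ex_prod p s (a : L -> bool -> R) : uniq s ->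
  Ex p s (fun w => \prod_(e <- s) a e (w e)) = \prod_(e <- s) (\sum_b bw p b * a e b).
Proof.
move=> us.
rewrite big_seq_sub // -fin_Ex_prod; apply: eq_bigr => v _; congr (_ * _).
by rewrite big_seq_sub //; apply: eq_bigr => e _; rewrite ext_val.
Qed.

(* Resampling the configuration outside a stopping set [W] preserves the law:
   [(w, w') |-> (mix (W w) w w', mix (W w) w' w)] is a measure-preserving involution. *)
Lemma Ex_markov p s (W : (L -> bool) -> L -> bool) f :
  (forall w w', (forall e, W w e -> w e = w' e) -> W w' = W w) ->
  Ex p s f = Ex p s (fun w => Ex p s (fun w' => f (mix (W w) w w'))).
Proof.
move=> WS; pose T := {ffun seq_sub s -> bool}.
pose m (u v v' : T) : T := [ffun e => if W (ext u) (val e) then v e else v' e].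
pose Phi (q : T * T) := (m q.1 q.1 q.2, m q.1 q.2 q.1).
have extm u v v' : ext (m u v v') = mix (W (ext u)) (ext v) (ext v').
  symmetry; apply: eq_ext => e; first by rewrite ffunE /mix !ext_val.
  by move=> es; rewrite /mix !ext_out ?if_same.
have WP u v' : W (ext (m u u v')) = W (ext u).
  by apply: WS => e We; rewrite extm /mix We.
have PhiK : involutive Phi.
  case=> u v; rewrite /Phi /=; congr (_, _); apply/ffunP => e; rewrite !ffunE WP;
    by case: (W _ _).
have wPhi q : fin_weight p (Phi q).1 * fin_weight p (Phi q).2 =
    fin_weight p q.1 * fin_weight p q.2.
  rewrite /fin_weight -!big_split; apply: eq_bigr => e _ /=.
  by rewrite !ffunE; case: (W _ _) => //; rewrite mulrC.
have -> : Ex p s f = \sum_(q : T * T) fin_weight p q.1 * fin_weight p q.2 * f (ext q.1).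
  rewrite -(pair_bigA _ (fun v v' => fin_weight p v * fin_weight p v' * f (ext v))) /=.
  apply: eq_bigr => v _; under eq_bigr do rewrite mulrAC.
  by rewrite -mulr_sumr fin_weight_sum mulr1.
rewrite (reindex_inj (inv_inj PhiK)) /=.
transitivity (\sum_(q : T * T) fin_weight p q.1 * fin_weight p q.2 *
    f (mix (W (ext q.1)) (ext q.1) (ext q.2))).
  by apply: eq_bigr => q _; rewrite (wPhi q) extm.
rewrite -(pair_bigA _ (fun v v' => fin_weight p v * fin_weight p v' *
  f (mix (W (ext v)) (ext v) (ext v')))) /=.
apply: eq_bigr => v _; rewrite /fin_Ex mulr_sumr.
by apply: eq_bigr => v' _; rewrite mulrA.
Qed.

(** This is [Ex_markov] for the deterministic set [A]: after resampling, [f] reads only the first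
    configuration and [g] only the second. *)
Lemma Ex_indep p s (A : set L) f g : dep A f -> dep (~` A) g ->
  Ex p s (fun w => f w * g w) = Ex p s f * Ex p s g.
Proof.
move=> fA gA; rewrite (@Ex_markov _ _ (fun _ e => `[< A e >])) //.
under [LHS]Ex_eq => w _.
  under Ex_eq => w' _.
    rewrite (fA _ w) => [|e Ae]; last by rewrite /mix asboolT.
    rewrite (gA _ w') => [|e nAe]; last by rewrite /mix asboolF.
    over.
  rewrite ExZ mulrC; over.
by rewrite ExZ mulrC.
Qed.

Lemma Ex_edge p s e (h : bool -> R) : e \in s -> Ex p s (fun w => h (w e)) = p * h true + (1 - p) * h false.
Proof.
move=> es; rewrite (@Ex_dep _ _ [:: e]) ?sub1seq //; last 2 first.
- by move=> e'; rewrite inE => /eqP ->.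
- by move=> w w' H; rewrite H //= mem_head.
have := @Ex_prod p [:: e] (fun _ => h) isT.
rewrite big_seq1 big_bool /= => <-.
by apply: Ex_eq => w _; rewrite big_seq1.
Qed.

Lemma Ex_split p s e f : e \in s ->
  Ex p s f = Ex p s (fun w => p * f (upd w e true) + (1 - p) * f (upd w e false)).
Proof.
move=> es; rewrite (@Ex_markov _ _ (fun _ e' => e' != e)) //; apply: Ex_eq => w _.
rewrite -(Ex_edge p (fun b => f (upd w e b)) es); apply: Ex_eq => w' _; congr f.
by apply/funext => e'; rewrite /mix /upd; case: eqVneq => [->|].
Qed.

(** The four terms are the joint law of the state of [e] in two independent copies. *)
Definition Ex2_split_body p e (G : (L -> bool) -> (L -> bool) -> R) w w' : R :=
  p * (p * G (upd w e true) (upd w' e true) + (1 - p) * G (upd w e true) (upd w' e false)) +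
  (1 - p) * (p * G (upd w e false) (upd w' e true) +
             (1 - p) * G (upd w e false) (upd w' e false)).

Lemma Ex2_split p s e G : e \in s ->
  Ex p s (fun w => Ex p s (fun w' => G w w')) =
  Ex p s (fun w => Ex p s (fun w' => Ex2_split_body p e G w w')).
Proof.
move=> es; rewrite (Ex_split p (fun w => Ex p s (fun w' => G w w')) es).
apply: Ex_eq => w _; rewrite -!ExZ -ExD (Ex_split p _ es).
by apply: Ex_eq => w' _; rewrite /Ex2_split_body; ring.
Qed.

(* Interpolation between one copy ([t = [::]]) and two independent copies ([t = s]) of the
   configuration, one coordinate at a time. *)
Lemma Ex2_interpolate p s (H : seq L -> (L -> bool) -> (L -> bool) -> R) : 0 <= p <= 1 ->
  (forall e t w w', e \notin t ->
     Ex2_split_body p e (H t) w w' <= Ex2_split_body p e (H (e :: t)) w w') ->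
  exists2 t, t =i s & Ex p s (fun w => Ex p s (fun w' => H [::] w w')) <=
                      Ex p s (fun w => Ex p s (fun w' => H t w w')).
Proof.
move=> p01 step; exists (undup s); first exact: mem_undup.
have : {subset undup s <= s} by move=> e; rewrite mem_undup.
have := undup_uniq s; elim: (undup s) => [|e t IH] //= /andP[et ut] ts.
apply: le_trans (IH ut _) _; first by move=> x xt; apply: ts; rewrite inE xt orbT.
have es : e \in s by apply: ts; rewrite mem_head.
rewrite (Ex2_split _ _ es) [leRHS](Ex2_split _ _ es).
by apply: Ex_le => // w _; apply: Ex_le => // w' _; exact: step.
Qed.

Definition increasing f := forall w w', (forall e, w e -> w' e) -> f w <= f w'.

Lemma upd_increasing f w e : increasing f -> f (upd w e false) <= f (upd w e true).
Proof. by apply=> e'; rewrite /upd; case: eqP. Qed.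

(** Let [g] read the second copy on [t]: this is one copy for [t = [::]] and two independent copies
    for [t = s]. Moving one edge into [t] loses p(1-p)(f1-f0)(g1-g0) >= 0. The sign in [H] fits the
    direction of [Ex2_interpolate]. *)
Lemma Ex_harris p s f g : 0 <= p <= 1 -> increasing f -> increasing g ->
  Ex p s f * Ex p s g <= Ex p s (fun w => f w * g w).
Proof.
move=> p01 incf incg.
pose H t w w' := - (f w * g (fun e => if e \in t then w' e else w e)).
have [e t w w' et|t ts tle] := @Ex2_interpolate p s H p01.
  have upd_in a b : (fun x => if x \in e :: t then upd w' e b x else upd w e a x) =
      upd (fun x => if x \in t then w' x else w x) e b.
    apply/funext => x; rewrite /upd inE; case: eqVneq => [->|] //=.
  have upd_out a b : (fun x => if x \in t then upd w' e b x else upd w e a x) =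
      upd (fun x => if x \in t then w' x else w x) e a.
    apply/funext => x; rewrite /upd; case: eqVneq => [->|] //=; by rewrite (negbTE et).
  rewrite /Ex2_split_body /H !upd_in !upd_out.
  have := upd_increasing w e incf.
  have := upd_increasing (fun x => if x \in t then w' x else w x) e incg.
  set u := (fun x => _).
  move: (g (upd u e true)) (g (upd u e false)) (f (upd w e true)) (f (upd w e false)).
  move=> g1 g0 f1 f0 hg hf.
  have : 0 <= (p * (1 - p)) * ((f1 - f0) * (g1 - g0)) by do 2 ?apply: mulr_ge0; lra.
  lra.
have -> : Ex p s (fun w => f w * g w) = - Ex p s (fun w => Ex p s (fun w' => H [::] w w')).
  by rewrite -ExN; apply: Ex_eq => w _; rewrite /H /= Ex_cst opprK.
move: tle.
have -> : Ex p s (fun w => Ex p s (fun w' => H t w w')) = - (Ex p s f * Ex p s g).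
  transitivity (Ex p s (fun w => - Ex p s g * f w)); last by rewrite ExZ; ring.
  apply: Ex_eq => w ws; transitivity (Ex p s (fun w' => - f w * g w')); last by rewrite ExZ; ring.
  apply: Ex_eq => w' ws'; rewrite /H mulNr.
  suff -> : (fun e => if e \in t then w' e else w e) = w' by [].
  by apply/funext => e; rewrite ts; case: ifPn => // es; rewrite ws // ws'.
by rewrite lerNr.
Qed.

Definition ind (P : (L -> bool) -> Prop) w : R := `[< P w >]%:R.

Lemma ind_ge0 P w : 0 <= ind P w. Proof. exact: ler0n. Qed.
Lemma ind_le1 P w : ind P w <= 1. Proof. by rewrite /ind; case: asboolP. Qed.

Lemma ind_le (P Q : (L -> bool) -> Prop) w w' : (P w -> Q w') -> ind P w <= ind Q w'.
Proof.
by move=> PQ; rewrite /ind; case: asboolP => [/PQ/asboolT ->|] //; rewrite ler0n.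
Qed.

Definition increasing_event (P : (L -> bool) -> Prop) :=
  forall w w' : L -> bool, (forall e, w e -> w' e) -> P w -> P w'.

Lemma increasing_ind P : increasing_event P -> increasing (ind P).
Proof.
move=> incP w w' ww'; rewrite /ind; case: (asboolP (P w)) => [Pw|]; last by rewrite ler0n.
by rewrite asboolT //; apply: incP Pw.
Qed.

Definition disjoint_occurrence (P Q : (L -> bool) -> Prop) w : Prop :=
  exists S : L -> bool, P (fun e => w e && S e) /\ Q (fun e => w e && ~~ S e).

(** In [D t] the two events compete for the open edges outside [t], while on [t] the event [P] has
    the first copy and [Q] the second for itself. Giving them separate copies of one more edge can
    only help. *)
Lemma Ex_bk p s (P Q : (L -> bool) -> Prop) : 0 <= p <= 1 ->
  increasing_event P -> increasing_event Q ->
  Ex p s (ind (disjoint_occurrence P Q)) <= Ex p s (ind P) * Ex p s (ind Q).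
Proof.
move=> p01 incP incQ.
pose D t w w' := exists S : L -> bool, P (fun e => w e && ((e \in t) || S e)) /\
    Q (fun e => if e \in t then w' e else w e && ~~ S e).
pose H t w w' : R := `[< D t w w' >]%:R.
have [e t w w' et|t ts tle] := @Ex2_interpolate p s H p01.
  have mono (a b a' b' : bool) : (a -> a') -> (b -> b') ->
      D (e :: t) (upd w e a) (upd w' e b) -> D (e :: t) (upd w e a') (upd w' e b').
    move=> aa' bb' [S [PS QS]]; exists S; split.
      by apply: incP PS => x; rewrite /upd; case: eqP => // _ /andP[/aa' -> ->].
    by apply: incQ QS => x; rewrite /upd inE; case: eqP.
  (* An open edge [e] is awarded by [S] to only one of the two events; the other one does without
     it, so [e] may be closed in its copy. *)
  have split1 b : D t (upd w e true) (upd w' e b) ->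
      D (e :: t) (upd w e true) (upd w' e false) \/ D (e :: t) (upd w e false) (upd w' e true).
    move=> [S [PS QS]]; case Se : (S e); [left|right]; exists S; split.
    - by apply: incP PS => x; rewrite /upd inE; case: eqP => [->|].
    - apply: incQ QS => x; rewrite /upd inE; case: eqP => [->|] //=.
      by rewrite (negbTE et) Se.
    - apply: incP PS => x; rewrite /upd inE; case: eqP => [->|] //=.
      by rewrite (negbTE et) Se.
    - by apply: incQ QS => x; rewrite /upd inE; case: eqP => [->|].
  have split0 b : D t (upd w e false) (upd w' e b) ->
      D (e :: t) (upd w e false) (upd w' e false).
    move=> [S [PS QS]]; exists S; split.
      by apply: incP PS => x; rewrite /upd inE; case: eqP.
    apply: incQ QS => x; rewrite /upd inE; case: eqP => [->|] //=.
    by rewrite (negbTE et).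
  have m01 := mono false false false true id (fun=> isT).
  have m10 := mono false false true false (fun=> isT) id.
  have m1 := mono true false true true id (fun=> isT).
  have m2 := mono false true true true (fun=> isT) id.
  have cvx (x y c : R) : x <= c -> y <= c -> p * x + (1 - p) * y <= c by nra.
  have le1 b : H t (upd w e true) (upd w' e b) <=
      (`[< D (e :: t) (upd w e true) (upd w' e false) >] ||
       `[< D (e :: t) (upd w e false) (upd w' e true) >])%:R.
    rewrite /H; case: asboolP => [/split1|_]; last by rewrite ler0n.
    by case=> /asboolT ->; rewrite ?orbT.
  have le0 b : H t (upd w e false) (upd w' e b) <=
      H (e :: t) (upd w e false) (upd w' e false).
    by rewrite /H; case: asboolP => [/split0/asboolT ->|_] //; rewrite ler0n.
  have q0 : 0 <= p * (1 - p) by rewrite mulr_ge0; lra.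
  apply: (@le_trans _ _ (p * _ + (1 - p) * _)).
    by apply: lerD; apply: ler_wpM2l; [lra|exact: cvx (le1 _) (le1 _)|lra|exact: cvx (le0 _) (le0 _)].
  rewrite /Ex2_split_body /H.
  (* If the event fails with both copies of [e] closed and exactly one mixed case holds, both sides
     equal p; if both mixed cases hold, the right side gains p(1-p). *)
  move: m01 m10 m1 m2; do 4 (case: asboolP => ? /=); move=> m01 m10 m1 m2; try tauto; nra.
have -> : Ex p s (ind (disjoint_occurrence P Q)) = Ex p s (fun w => Ex p s (fun w' => H [::] w w')).
  apply: Ex_eq => w _; rewrite -(Ex_cst p s (ind _ w)); apply: Ex_eq => w' _.
  by rewrite /H /ind /D /disjoint_occurrence.
apply: le_trans tle _; rewrite mulrC -ExZ; apply: Ex_le => // w ws.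
rewrite mulrC -ExZ; apply: Ex_le => // w' ws'.
rewrite /H /ind; case: asboolP => [[S [PS QS]]|_]; last by rewrite -natrM ler0n.
rewrite !asboolT ?mulr1 //.
  by apply: incQ QS => e; rewrite ts; case: ifPn => // es; rewrite ws.
by apply: incP PS => e /andP[].
Qed.

Lemma Ex_cons p e s f : e \notin s ->
  Ex p (e :: s) f = p * Ex p s (fun w => f (upd w e true)) +
                    (1 - p) * Ex p s (fun w => f (upd w e false)).
Proof.
move=> es; rewrite (@Ex_split p _ e) ?mem_head // ExD !ExZ.
suff H b : Ex p (e :: s) (fun w => f (upd w e b)) = Ex p s (fun w => f (upd w e b)) by rewrite !H.
pose g w := f (upd (fun x => (x \in s) && w x) e b).
have gE w t : e \notin t -> t =i s -> (forall x, x \notin e :: t -> w x = false) -> f (upd w e b) = g w.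
  move=> et ts ws; congr f; apply/funext => x; rewrite /upd; case: eqVneq => // xe.
  case: (boolP (x \in s)) => //= xs; apply: ws; by rewrite inE negb_or xe ts.
rewrite (@Ex_eq p _ _ g); last by move=> w ws; apply: (gE w s).
rewrite [RHS](@Ex_eq p _ _ g); last first.
  move=> w ws; apply: (gE w s) => // x; rewrite inE negb_or => /andP[_]; exact: ws.
apply: Ex_dep; first by move=> x xs; rewrite inE xs orbT.
move=> w w' ww'; congr f; apply/funext => x; rewrite /upd; case: eqP => // _.
by case: (boolP (x \in s)) => //= xs; apply: ww'.
Qed.

Lemma upd_comm (w : L -> bool) e e' b b' : e != e' -> upd (upd w e b) e' b' = upd (upd w e' b') e b.
Proof.
move=> ee'; apply/funext => x; rewrite /upd.
by case: (eqVneq x e') => [->|//]; rewrite eq_sym (negbTE ee').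
Qed.

(** The expectation is a polynomial in [p], so Russo's formula is stated for the formal derivative.
    In the induction the factors [p] and [1 - p] of the head edge produce its own term, and the
    product rule the others. *)
Lemma Ex_russo s f : uniq s -> exists q : {poly R}, (forall p, Ex p s f = q.[p]) /\
  (forall p, q^`().[p] = \sum_(e <- s) Ex p s (fun w => f (upd w e true) - f (upd w e false))).
Proof.
elim: s f => [|e s IH] f /=.
  move=> _; exists (f (fun=> false))%:P; split => p; last by rewrite derivC horner0 big_nil.
  rewrite hornerC -(Ex_cst p [::] (f _)); apply: Ex_eq => w ws; congr f.
  by apply/funext => x; rewrite ws.
move=> /andP[es us].
have [q1 [q1E q1D]] := IH (fun w => f (upd w e true)) us.
have [q0 [q0E q0D]] := IH (fun w => f (upd w e false)) us.
exists ('X * q1 + (1 - 'X) * q0); split => p.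
  by rewrite Ex_cons // q1E q0E !hornerE.
rewrite big_cons Ex_cons //.
have same b : Ex p s (fun w => f (upd (upd w e b) e true) - f (upd (upd w e b) e false)) =
    q1.[p] - q0.[p].
  rewrite -q1E -q0E -ExB; apply: Ex_eq => w _.
  by congr (f _ - f _); apply/funext => x; rewrite /upd; case: eqP.
have -> : \sum_(e' <- s) Ex p (e :: s) (fun w => f (upd w e' true) - f (upd w e' false)) = p * (\sum_(e' <- s) Ex p s (fun w =>
    f (upd (upd w e' true) e true) - f (upd (upd w e' false) e true))) +
  (1 - p) * (\sum_(e' <- s) Ex p s (fun w =>
    f (upd (upd w e' true) e false) - f (upd (upd w e' false) e false))).
  rewrite !mulr_sumr -big_split; apply: eq_big_seq => e' e's /=.
  have ee' : e' != e by apply: contraNneq es => <-.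
  rewrite Ex_cons //; congr (_ * _ + _ * _); apply: Ex_eq => w _; by rewrite !(upd_comm _ _ _ ee').
rewrite !same derivD !derivM derivB derivX -(polyC1 R) derivC.
rewrite !(hornerD, hornerM, hornerX, hornerN, hornerC) q1D q0D.
ring.
Qed.

(** From exp x >= 1 + x and ln a >= 1 - 1/a. It turns a product of likelihood ratios into a sum that
    can be averaged edge by edge. *)
Lemma prod_ge_sumV (I : Type) (r : seq I) (a : I -> R) : (forall i, 0 < a i) ->
  1 + \sum_(i <- r) (1 - (a i)^-1) <= \prod_(i <- r) a i.
Proof.
move=> a0; have -> : \prod_(i <- r) a i = expR (\sum_(i <- r) ln (a i)).
  by rewrite expR_sum; apply: eq_bigr => i _; rewrite lnK // posrE.
apply: le_trans (expR_ge1Dx _); rewrite lerD2l; apply: ler_sum => i _.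
have V0 : 0 < (a i)^-1 by rewrite invr_gt0.
have := @le_ln1Dx R ((a i)^-1 - 1); rewrite [1 + _]addrC subrK lnV ?posrE //.
by move=> /(_ ltac:(lra)); lra.
Qed.

(* Relative entropy bound: only the edges of the stopping set [W] count, because
   [E_p [1_{e in W} (1 - 1/r(w e))]] factorizes ([W w e] does not depend on [w e]). *)
Lemma Ex_entropy p p' s (W : (L -> bool) -> L -> bool) (P : (L -> bool) -> Prop) :
  uniq s -> 0 < p < 1 -> 0 < p' < 1 ->
  (forall w w', (forall e, W w e -> w e = w' e) -> W w' = W w) ->
  (forall w w', (forall e, W w e -> w e = w' e) -> P w' = P w) ->
  Ex p' s (ind P) <= 2 * (Ex p s (ind P) +
    (p' - p) ^+ 2 / (p' * (1 - p')) * \sum_(e <- s) Ex p s (fun w => (W w e)%:R)).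
Proof.
move=> us p01 p01' WS PS.
pose r b := bw p' b / bw p b.
have bw0 b : 0 < bw p b by rewrite /bw; case: b; lra.
have bw0' b : 0 < bw p' b by rewrite /bw; case: b; lra.
have r0 b : 0 < r b by rewrite divr_gt0.
have change f : Ex p' s f = Ex p s (fun w => \prod_(e <- s) r (w e) * f w).
  apply: eq_bigr => v _; rewrite mulrA; congr (_ * _).
  rewrite big_seq_sub // /fin_weight -big_split; apply: eq_bigr => e _.
  by rewrite ext_val /r /= mulrC divfK // gt_eqF.
(* The value 1/2 on [P] makes 1 - 1/f equal to minus the indicator of [P]; it is also the origin of
   the factor 2 in the statement. *)
pose f w : R := 1 - ind P w / 2.
have f0 w : 0 < f w by rewrite /f; have := ind_le1 P w; lra.
(* Resample outside [W]: the likelihood ratios of unexplored edges average to 1 and disappear. *)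
have step1 : Ex p' s f = Ex p s (fun w => \prod_(e <- s) (if W w e then r (w e) else 1) * f w).
  rewrite change (@Ex_markov _ _ W) //; apply: Ex_eq => w _.
  transitivity (Ex p s (fun w' => f w * \prod_(e <- s) (if W w e then r (w e) else r (w' e)))).
    apply: Ex_eq => w' _; rewrite mulrC; congr (_ * _).
      by rewrite /f /ind (PS w) // => e We; rewrite /mix We.
    by apply: eq_bigr => e _; rewrite /mix; case: ifP.
  rewrite ExZ mulrC; congr (_ * _).
  rewrite (Ex_prod p (fun e b => if W w e then r (w e) else r b)) //.
  apply: eq_bigr => e _; case: ifP => _; first by rewrite -mulr_suml bw_sum mul1r.
  by rewrite -(bw_sum p'); apply: eq_bigr => b _; rewrite /r mulrC divfK // gt_eqF.
have lower : Ex p s (fun w => 1 - ind P w + \sum_(e <- s) (W w e)%:R * (1 - (r (w e))^-1)) <= Ex p' s f.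
  rewrite step1; apply: Ex_le; first lra.
  (* The index [None] carries the factor [f w], so that the event and the explored edges are treated
     as a single product. *)
  move=> w _; pose a (o : option L) := if o is Some e then if W w e then r (w e) else 1 else f w.
  have a0 o : 0 < a o by rewrite /a; case: o => // e; case: ifP.
  have := prod_ge_sumV (None :: map Some s) a0; rewrite !big_cons !big_map /= mulrC.
  apply: le_trans; rewrite addrA; apply: lerD.
    rewrite /f /ind; case: asboolP => _ /=; last by rewrite mul0r subr0 invr1; lra.
    have -> : (1 - 1 / 2 : R)^-1 = 2 by field.
    lra.
  by apply: ler_sum => e _; case: (W w e); rewrite ?mul1r // mul0r invr1 subrr.
(* The one-edge identity is 1 - p^2/p' - (1-p)^2/(1-p') = -(p'-p)^2/(p'(1-p')), a chi-square
   divergence. *)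
have term e : e \in s -> Ex p s (fun w => (W w e)%:R * (1 - (r (w e))^-1)) =
   - ((p' - p) ^+ 2 / (p' * (1 - p'))) * Ex p s (fun w => (W w e)%:R).
  move=> es; rewrite -ExZ (Ex_split _ _ es) [RHS](Ex_split _ _ es); apply: Ex_eq => w _.
  have sameW b : W (upd w e b) e = W w e.
    case We : (W w e); last first.
      by rewrite (WS w) // => x; rewrite /upd; case: eqP => // ->; rewrite We.
    case We' : (W (upd w e b) e) => //.
    rewrite -We (WS (upd w e b) w) ?We' // => x; rewrite /upd; case: eqP => // ->.
    by rewrite We'.
  by rewrite !sameW /upd eqxx /r /bw /=; field; lra.
move: lower; rewrite ExD ExB Ex_cst Ex_sum.
rewrite (eq_big_seq _ term) -mulr_sumr /f ExB Ex_cst.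
have -> : Ex p' s (fun w => ind P w / 2) = Ex p' s (ind P) / 2.
  by rewrite mulrC -ExZ; apply: Ex_eq => w _; rewrite mulrC.
set X := (_ / _) * _ ; rewrite mulNr -/X; lra.
Qed.

End FixedEdgeType.
End Expectation.

(** * Connectivity and local events *)

Section Graph.
Variables (V L : Type) (ends : L -> V * V).
Implicit Types (w : L -> bool) (B D : set V).

Definition joins e x y := ends e = (x, y) \/ ends e = (y, x).

Inductive conn w B x : V -> Prop :=
| conn_refl : B x -> conn w B x x
| conn_step y z e : conn w B x y -> w e -> joins e y z -> B z -> conn w B x z.

Definition inside B e := B (ends e).1 /\ B (ends e).2.

Lemma joins_sym e x y : joins e x y -> joins e y x.
Proof. by case; [right|left]. Qed.

Lemma joins_ends e : joins e (ends e).1 (ends e).2.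
Proof. by left; case: (ends e). Qed.

Lemma joins_inside B e x y : joins e x y -> B x -> B y -> inside B e.
Proof. by rewrite /inside => -[] ->. Qed.

Lemma conn_src w B x y : conn w B x y -> B x.
Proof. by elim. Qed.

Lemma conn_tgt w B x y : conn w B x y -> B y.
Proof. by case. Qed.

Lemma conn_trans w B x y z : conn w B x y -> conn w B y z -> conn w B x z.
Proof. by move=> xy; elim => // u v e _ xu we uv Bv; exact: conn_step uv Bv. Qed.

Lemma conn_edge w B x y e : w e -> joins e x y -> B x -> B y -> conn w B x y.
Proof. by move=> we xy Bx By; exact: conn_step (conn_refl _ Bx) we xy By. Qed.

Lemma conn_sym w B x y : conn w B x y -> conn w B y x.
Proof.
elim => [|u v e xu ux we uv Bv]; first exact: conn_refl.
exact: conn_trans (conn_edge we (joins_sym uv) Bv (conn_tgt xu)) ux.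
Qed.

Lemma conn_exit w B D x y : conn w B x y -> D x -> ~ D y ->
  exists u v e, [/\ conn w (B `&` D)%classic x u, w e, joins e u v, B v & ~ D v].
Proof.
move=> + Dx; elim => // u v e xu IH we uv Bv nDv.
have [Du|/IH //] := pselect (D u).
have [xDu|nxu] := pselect (conn w (B `&` D)%classic x u); first by exists u, v, e.
suff : conn w (B `&` D)%classic x u \/
    exists u v e, [/\ conn w (B `&` D)%classic x u, w e, joins e u v, B v & ~ D v] by case.
elim: xu {IH uv nxu Du} => [Bx|a b f xa [xDa|] wf ab Bb]; last by right.
  by left; apply: conn_refl.
have [Db|nDb] := pselect (D b); first by left; apply: conn_step xDa wf ab _.
by right; exists a, b, f.
Qed.

(** First exit from the complement of [D] along the reversed path. *)
Lemma conn_last_exit w B D x y : conn w B x y -> D x -> ~ D y ->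
  exists u v e, [/\ D u, w e, joins e u v, B u & conn w (B `\` D)%classic v y].
Proof.
move=> /conn_sym xy Dx nDy.
have [|u [v [e [yu we uv Bv nDv]]]] := conn_exit (D := (~` D)%classic) xy nDy; first exact.
exists v, u, e; split => //; [exact: contrapT|exact: joins_sym|exact: conn_sym].
Qed.

End Graph.

(** Common tool for monotonicity, translations, reflections and embeddings: each open edge need only
    be replaced by some path between the images of its ends. *)
Lemma conn_sim (V L V' L' : Type) (ends : L -> V * V) (ends' : L' -> V' * V')
    (sigma : V -> V') w w' (B : set V) (B' : set V') x y :
  conn ends w B x y -> B' (sigma x) ->
  (forall e u v, B u -> B v -> w e -> joins ends e u v -> B' (sigma u) ->
     conn ends' w' B' (sigma u) (sigma v)) ->
  conn ends' w' B' (sigma x) (sigma y).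
Proof.
move=> xy Bx H; elim: xy => [_|u v e xu IH we uv Bv]; first exact: conn_refl.
exact: conn_trans IH (H _ _ _ (conn_tgt xu) Bv we uv (conn_tgt IH)).
Qed.

Section GraphMore.
Variables (V L : Type) (ends : L -> V * V).
Implicit Types (w : L -> bool) (B D : set V).

Lemma conn_mono w w' B B' x y : (B `<=` B')%classic ->
  (forall e, inside ends B e -> w e -> w' e) -> conn ends w B x y -> conn ends w' B' x y.
Proof.
move=> BB ww xy; apply: (conn_sim (sigma := id) xy); first exact/BB/(conn_src xy).
move=> e u v Bu Bv we uv _; apply: conn_edge (uv) (BB _ Bu) (BB _ Bv).
exact: ww (joins_inside uv Bu Bv) we.
Qed.

Lemma conn_dep B x y : dep (inside ends B) (fun w => conn ends w B x y).
Proof.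
move=> w w' ww'; apply/propext; split; apply: conn_mono => // e eB.
  by rewrite ww'.
by rewrite ww'.
Qed.

End GraphMore.

Lemma conn_subset (V L : Type) (ends : L -> V * V) w (B B' : set V) x y :
  (B `<=` B')%classic -> conn ends w B x y -> conn ends w B' x y.
Proof. by move=> BB; apply: conn_mono. Qed.

Lemma dep_sub (L T : Type) (A A' : set L) (f : (L -> bool) -> T) :
  (A `<=` A')%classic -> dep A f -> dep A' f.
Proof. by move=> AA fA w w' ww'; apply: fA => e /AA; exact: ww'. Qed.

Lemma dep_ind (R : realType) (L : choiceType) (A : set L) (P : (L -> bool) -> Prop) :
  dep A P -> dep A (ind R P).
Proof. by move=> PA w w' /PA ww'; rewrite /ind ww'. Qed.

Lemma dep_op2 L T1 T2 T3 (op : T1 -> T2 -> T3) (A : set L) P Q :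
  dep A P -> dep A Q -> dep A (fun w => op (P w) (Q w)).
Proof. by move=> AP AQ w w' ww'; rewrite (AP _ _ ww') (AQ _ _ ww'). Qed.

Section LocalEvents.
Variables (R : realType) (L : choiceType).
Implicit Types (p : R) (P Q : (L -> bool) -> Prop) (s : seq L).

Definition local P := exists s, dep [set` s]%classic P.

(** The list of edges is an arbitrary choice, harmless by [PrE]; an event that is not local gets the
    value 0. *)
Definition Pr p P : R :=
  if pselect (local P) is left h then Ex p (sval (cid h)) (ind R P) else 0.

Lemma PrE p P s : dep [set` s]%classic P -> Pr p P = Ex p s (ind R P).
Proof.
move=> Ps; rewrite /Pr; case: pselect => [h|[]]; last by exists s.
have /(@dep_ind R) D := svalP (cid h); move: (sval (cid h)) D => t D.
have ts : {subset t <= s ++ t} by move=> e; rewrite mem_cat orbC => ->.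
have ss : {subset s <= s ++ t} by move=> e; rewrite mem_cat => ->.
by rewrite -(Ex_dep p ts D) (Ex_dep p ss (dep_ind R Ps)).
Qed.

Lemma local2 P Q : local P -> local Q ->
  exists s, [/\ uniq s, dep [set` s]%classic P & dep [set` s]%classic Q].
Proof.
move=> [s Ps] [t Qt]; exists (undup (s ++ t)); split; first exact: undup_uniq.
  by apply: dep_sub Ps => e /= es; rewrite mem_undup mem_cat es.
by apply: dep_sub Qt => e /= es; rewrite mem_undup mem_cat es orbT.
Qed.

Lemma Pr_ge0 p P : 0 <= p <= 1 -> 0 <= Pr p P.
Proof.
by move=> p01; rewrite /Pr; case: pselect => // h; apply: Ex_ge0 => // w; exact: ind_ge0.
Qed.

Lemma Pr_le1 p P : 0 <= p <= 1 -> Pr p P <= 1.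
Proof.
move=> p01; rewrite /Pr; case: pselect => // h; rewrite -[leRHS](Ex_cst p (sval (cid h))).
by apply: Ex_le => // w _; exact: ind_le1.
Qed.

Lemma Pr_le p P Q : 0 <= p <= 1 -> local P -> local Q -> (forall w, P w -> Q w) ->
  Pr p P <= Pr p Q.
Proof.
move=> p01 lP lQ PQ; have [s [_ sP sQ]] := local2 lP lQ.
by rewrite !(PrE _ (s := s)) //; apply: Ex_le => // w _; exact: ind_le (PQ w).
Qed.

End LocalEvents.

Section LocalEventCalculus.
Variables (R : realType) (L : choiceType).
Implicit Types (p : R) (P Q : (L -> bool) -> Prop) (s : seq L).

Definition decreasing_event P := forall w w' : L -> bool, (forall e, w e -> w' e) -> P w' -> P w.

Lemma decreasing_not P : decreasing_event P -> increasing_event (fun w => ~ P w).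
Proof. by move=> dP w w' ww' nP /(dP _ _ ww'). Qed.

Lemma local_not P : local P -> local (fun w => ~ P w).
Proof. by case=> s sP; exists s => w w' /sP ->. Qed.

Lemma local_and P Q : local P -> local Q -> local (fun w => P w /\ Q w).
Proof. by move=> lP lQ; have [s [_ sP sQ]] := local2 lP lQ; exists s; exact: dep_op2. Qed.

Lemma local_or P Q : local P -> local Q -> local (fun w => P w \/ Q w).
Proof. by move=> lP lQ; have [s [_ sP sQ]] := local2 lP lQ; exists s; exact: dep_op2. Qed.

Lemma ind_not P (w : L -> bool) : ind R (fun w => ~ P w) w = 1 - ind R P w.
Proof.
rewrite /ind; case: (asboolP (P w)) => h; last by rewrite asboolT // subr0.
by rewrite asboolF ?subrr //; apply.
Qed.

Lemma ind_and P Q (w : L -> bool) : ind R (fun w => P w /\ Q w) w = ind R P w * ind R Q w.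
Proof. by rewrite /ind asbool_and -natrM mulnb. Qed.

Lemma Pr_not p P : local P -> Pr p (fun w => ~ P w) = 1 - Pr p P.
Proof.
move=> [s sP]; rewrite (PrE p sP) (@PrE _ _ _ _ s); last by move=> w w' /sP ->.
by rewrite -(Ex_cst p s 1) -ExB; apply: Ex_eq => w _; exact: ind_not.
Qed.

Lemma Pr_or p P Q : 0 <= p <= 1 -> local P -> local Q ->
  Pr p (fun w => P w \/ Q w) <= Pr p P + Pr p Q.
Proof.
move=> p01 lP lQ; have [s [_ sP sQ]] := local2 lP lQ.
rewrite (PrE p sP) (PrE p sQ) (@PrE _ _ _ _ s); last exact: dep_op2.
rewrite -ExD; apply: Ex_le => // w _; rewrite /ind asbool_or.
by do 2 (case: asboolP => _ /=); rewrite ?(addr0, add0r) // lerDl.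
Qed.

Lemma local_False : local (fun _ : L -> bool => False).
Proof. by exists [::]. Qed.

Lemma Pr_False p : Pr p (fun _ : L -> bool => False) = 0.
Proof.
rewrite (@PrE _ _ _ _ [::]) // -(Ex_cst p ([::] : seq L) 0); apply: Ex_eq => w _.
by rewrite /ind asboolF.
Qed.

Lemma local_exists_seq (I : eqType) (r : seq I) (P : I -> (L -> bool) -> Prop) :
  (forall i, i \in r -> local (P i)) -> local (fun w => exists2 i, i \in r & P i w).
Proof.
elim: r => [|i r IH] lP.
  by exists [::] => w w' _; apply/propext; split => -[].
have -> : (fun w => exists2 j, j \in i :: r & P j w) =
    (fun w => P i w \/ exists2 j, j \in r & P j w).
  apply/funext => w; apply/propext; split => [[j]|[Pi|[j jr Pj]]].
  - by rewrite inE => /orP[/eqP ->|jr Pj]; [left|right; exists j].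
  - by exists i; rewrite ?mem_head.
  - by exists j => //; rewrite inE jr orbT.
by apply: local_or; [apply: lP; rewrite mem_head|apply: IH => j jr; apply: lP; rewrite inE jr orbT].
Qed.

Lemma Pr_exists_seq p (I : eqType) (r : seq I) (P : I -> (L -> bool) -> Prop) : 0 <= p <= 1 ->
  (forall i, i \in r -> local (P i)) ->
  Pr p (fun w => exists2 i, i \in r & P i w) <= \sum_(i <- r) Pr p (P i).
Proof.
move=> p01; elim: r => [|i r IH] lP.
  rewrite big_nil -(Pr_False p); apply: Pr_le => // [||w [] //].
    exact: local_exists_seq.
  exact: local_False.
have lr j : j \in r -> local (P j) by move=> jr; apply: lP; rewrite inE jr orbT.
have li : local (P i) by apply: lP; rewrite mem_head.
rewrite big_cons; apply: le_trans (lerD (lexx _) (IH lr)).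
apply: le_trans (Pr_or p01 li (local_exists_seq lr)).
apply: Pr_le => // [||w [j]]; first exact: local_exists_seq.
  by apply: local_or => //; exact: local_exists_seq.
by rewrite inE => /orP[/eqP ->|jr Pj]; [left|right; exists j].
Qed.

Lemma Pr_indep p (A : set L) P Q : local P -> local Q -> dep A P -> dep (~` A)%classic Q ->
  Pr p (fun w => P w /\ Q w) = Pr p P * Pr p Q.
Proof.
move=> lP lQ AP AQ; have [s [_ sP sQ]] := local2 lP lQ.
rewrite (PrE p sP) (PrE p sQ) (@PrE _ _ _ _ s); last exact: dep_op2.
rewrite -(Ex_indep p s (dep_ind R AP) (dep_ind R AQ)).
by apply: Ex_eq => w _; exact: ind_and.
Qed.

Lemma Pr_harris p P Q : 0 <= p <= 1 -> local P -> local Q ->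
  increasing_event P -> increasing_event Q ->
  Pr p P * Pr p Q <= Pr p (fun w => P w /\ Q w).
Proof.
move=> p01 lP lQ iP iQ; have [s [_ sP sQ]] := local2 lP lQ.
rewrite (PrE p sP) (PrE p sQ) (@PrE _ _ _ _ s); last exact: dep_op2.
apply: le_trans (Ex_harris s p01 (increasing_ind R iP) (increasing_ind R iQ)) _.
by apply: Ex_le => // w _; rewrite ind_and.
Qed.

(** Harris for [P] and the complement of [Q]. *)
Lemma Pr_harris_mixed p P Q : 0 <= p <= 1 -> local P -> local Q ->
  increasing_event P -> decreasing_event Q ->
  Pr p (fun w => P w /\ Q w) <= Pr p P * Pr p Q.
Proof.
move=> p01 lP lQ iP dQ; have [s [_ sP sQ]] := local2 lP lQ.
have snQ : dep [set` s]%classic (fun w => ~ Q w) by move=> w w' /sQ ->.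
have := Pr_harris p01 lP (local_not lQ) iP (decreasing_not dQ).
rewrite (Pr_not p lQ) (@PrE _ _ _ (fun w => P w /\ ~ Q w) s); last exact: dep_op2.
have -> : Ex p s (ind R (fun w => P w /\ ~ Q w)) = Pr p P - Pr p (fun w => P w /\ Q w).
  rewrite (PrE p sP) (@PrE _ _ _ _ s); last exact: dep_op2.
  by rewrite -ExB; apply: Ex_eq => w _; rewrite !ind_and ind_not; ring.
by move=> h; lra.
Qed.

Lemma Pr_harris_decreasing p P Q : 0 <= p <= 1 -> local P -> local Q ->
  decreasing_event P -> decreasing_event Q ->
  Pr p P * Pr p Q <= Pr p (fun w => P w /\ Q w).
Proof.
move=> p01 lP lQ dP dQ.
have := Pr_harris_mixed p01 (local_not lP) lQ (decreasing_not dP) dQ.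
have [s [_ sP sQ]] := local2 lP lQ.
rewrite (Pr_not p lP) (@PrE _ _ _ (fun w => ~ P w /\ Q w) s); last first.
  by apply: dep_op2 => // w w' /sP ->.
have -> : Ex p s (ind R (fun w => ~ P w /\ Q w)) = Pr p Q - Pr p (fun w => P w /\ Q w).
  rewrite (PrE p sQ) (@PrE _ _ _ _ s); last exact: dep_op2.
  by rewrite -ExB; apply: Ex_eq => w _; rewrite !ind_and ind_not; ring.
by move=> h; lra.
Qed.

Lemma dep_disjoint_occurrence (A : set L) P Q : dep A P -> dep A Q ->
  dep A (disjoint_occurrence P Q).
Proof.
move=> AP AQ w w' ww'; apply/propext; split => -[S [PS QS]]; exists S.
  by rewrite -(AP (fun e => w e && S e)) ?(AQ (fun e => w' e && ~~ S e) (fun e => w e && ~~ S e)) //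
    => e Ae; rewrite ww'.
by rewrite (AP _ (fun e => w' e && S e)) ?(AQ _ (fun e => w' e && ~~ S e)) //
    => e Ae; rewrite ww'.
Qed.

Lemma Pr_bk p P Q : 0 <= p <= 1 -> local P -> local Q ->
  increasing_event P -> increasing_event Q ->
  Pr p (disjoint_occurrence P Q) <= Pr p P * Pr p Q.
Proof.
move=> p01 lP lQ iP iQ; have [s [_ sP sQ]] := local2 lP lQ.
rewrite (PrE p sP) (PrE p sQ) (@PrE _ _ _ _ s); last exact: dep_disjoint_occurrence.
exact: Ex_bk.
Qed.

Lemma increasing_disjoint_occurrence P Q : increasing_event P -> increasing_event Q ->
  increasing_event (disjoint_occurrence P Q).
Proof.
move=> iP iQ w w' ww' [S [PS QS]]; exists S; split.
  by apply: iP PS => e /andP[/ww' -> ->].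
by apply: iQ QS => e /andP[/ww' -> ->].
Qed.

Lemma Pr_flip p P : local P -> Pr (1 - p) P = Pr p (fun w => P (fun e => ~~ w e)).
Proof.
move=> [s sP]; rewrite (PrE _ sP) (@PrE _ _ _ _ s); last first.
  by move=> w w' ww'; apply: sP => e es; rewrite ww'.
rewrite /Ex /fin_Ex (reindex_inj (h := fun v : {ffun seq_sub s -> bool} => [ffun e => ~~ v e])) /=.
  apply: eq_bigr => v _; congr (_ * _).
    by apply: eq_bigr => e _; rewrite ffunE /bw; case: (v e) => /=; ring.
  apply: (dep_ind R sP) => e es; rewrite -[e]/(val (SeqSub es)).
  by rewrite !ext_val ffunE.
by move=> v v' /ffunP vv'; apply/ffunP => e; have := vv' e; rewrite !ffunE => /negb_inj.
Qed.

(** In Russo's formula every term is nonnegative for increasing [f]; the mean value theorem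
    concludes. *)
Lemma Ex_increasing_p p p' s (f : (L -> bool) -> R) : uniq s -> increasing f ->
  0 <= p -> p <= p' -> p' <= 1 -> Ex p s f <= Ex p' s f.
Proof.
move=> us incf p0 pp' p1; have [q [qE qD]] := Ex_russo f us.
have [c] : exists2 c, c \in `[p, p'] & q.[p'] - q.[p] = q^`().[c] * (p' - p).
  apply: (@MVT_segment R (horner q) (horner q^`())) => //.
  by apply: continuous_subspaceT; exact: continuous_horner.
rewrite in_itv /= => /andP[pc cp']; rewrite !qE qD -subr_ge0 => ->.
rewrite mulr_ge0 ?subr_ge0 //; apply: sumr_ge0 => e _.
by apply: Ex_ge0 => [|w]; [lra|rewrite subr_ge0; exact: upd_increasing].
Qed.

Lemma Pr_increasing_p p p' P : local P -> increasing_event P ->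
  0 <= p -> p <= p' -> p' <= 1 -> Pr p P <= Pr p' P.
Proof.
move=> lP iP; have [s [us sP _]] := local2 lP lP.
by rewrite !(PrE _ sP); apply: Ex_increasing_p => //; exact: increasing_ind.
Qed.

End LocalEventCalculus.

Section Transfer.
Variables (R : realType) (L1 L2 : choiceType) (tau : L1 -> L2).

Lemma local_transfer (P : (L1 -> bool) -> Prop) : local P -> local (fun w => P (w \o tau)).
Proof.
move=> [s sP]; exists (map tau s) => w w' ww'; apply: sP => e es /=.
by apply: ww'; exact: map_f.
Qed.

Lemma Pr_transfer (p : R) (P : (L1 -> bool) -> Prop) : injective tau -> local P ->
  Pr p (fun w => P (w \o tau)) = Pr p P.
Proof.
move=> tauI [s sP]; rewrite (PrE _ sP) (@PrE _ _ _ _ (map tau s)); last first.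
  by move=> w w' ww'; apply: sP => e es /=; apply: ww'; exact: map_f.
apply: (@Ex_transfer _ _ _ p tau _ _ (ind R P)) => [e e' _ _ /tauI //|e es|].
  exact: map_f.
exact: dep_ind.
Qed.

End Transfer.

(** * The lattice and its one-arm events *)

(* [lia] does not identify the convertible forms of [u i] for [u : {ffun 'I_d -> int}]. *)
Ltac coord_lia := repeat match goal with
  | |- context [fun_of_fin ?u ?j] => let a := fresh in move: (fun_of_fin u j) => a end; lia.

Lemma dep_exists (L I : Type) (A : set L) (Q : I -> Prop) (P : I -> (L -> bool) -> Prop) :
  (forall i, dep A (P i)) -> dep A (fun w => exists i, Q i /\ P i w).
Proof.
by move=> AP w w' ww'; apply/propext; split => -[i [Qi Pi]]; exists i;
  split => //; rewrite ?(AP i _ _ ww') // -(AP i _ _ ww').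
Qed.

Lemma increasing_conn (V : Type) (L : choiceType) (ends : L -> V * V) (B : set V) x y :
  increasing_event (fun w => conn ends w B x y).
Proof. by move=> w w' ww'; apply: conn_mono => // e _; exact: ww'. Qed.

Lemma increasing_exists (L : choiceType) (I : Type) (Q : I -> Prop) (P : I -> (L -> bool) -> Prop) :
  (forall i, increasing_event (P i)) -> increasing_event (fun w => exists i, Q i /\ P i w).
Proof. by move=> iP w w' ww' [i [Qi Pi]]; exists i; split => //; exact: iP Pi. Qed.

Section Lattice.
Variable d : nat.

Definition vtx := {ffun 'I_d -> int}.
Definition ledge := (vtx * 'I_d)%type.
Definition unitv (i : 'I_d) : vtx := [ffun j => (j == i)%:R].
Definition lends (e : ledge) : vtx * vtx := (e.1, e.1 + unitv e.2).

Definition Box (z : vtx) (n : nat) : set vtx := [set u | forall i, `|u i - z i| <= n%:Z]%classic.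
Definition Sphere (z : vtx) (n : nat) : set vtx :=
  [set u | Box z n u /\ exists i, `|u i - z i| = n%:Z]%classic.
Definition arm (z : vtx) (n : nat) (w : ledge -> bool) : Prop :=
  exists y, Sphere z n y /\ conn lends w (Box z n) z y.

Definition embv (z : vtx) n (x : box d n) : vtx := [ffun j => z j + (x j)%:Z - n%:Z].
Definition embe (z : vtx) n (e : bedge d n) : ledge := (embv z (val e).1, (val e).2).
Definition box_edges (z : vtx) n : seq ledge := [seq embe z e | e : bedge d n].

Definition unembv (z : vtx) n (u : vtx) : box d n := [ffun j => inord (absz (u j - z j + n%:Z))].

Lemma unembvK (z : vtx) n u : Box z n u -> embv z (unembv z n u) = u.
Proof.
move=> Bu; apply/ffunP => j; rewrite !ffunE; rewrite inordK; have := Bu j; coord_lia.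
Qed.

Lemma embvK (z : vtx) n : cancel (@embv z n) (@unembv z n).
Proof.
move=> x; apply/ffunP => j; apply/val_inj; rewrite !ffunE /=.
by rewrite inordK; have := ltn_ord (x j); coord_lia.
Qed.

Lemma embv_Box (z : vtx) n (x : box d n) : Box z n (embv z x).
Proof. by move=> j; rewrite !ffunE; have := ltn_ord (x j); coord_lia. Qed.

Lemma embv_step (z : vtx) n (e : bedge d n) :
  embv z (step (val e).1 (val e).2) = embv z (val e).1 + unitv (val e).2.
Proof.
case: e => -[x i] /= xi; apply/ffunP => j; rewrite !ffunE.
case: eqVneq => [->|_] /=; last by rewrite addr0.
by rewrite inordK; move: xi; coord_lia.
Qed.

Lemma lends_embe (z : vtx) n (e : bedge d n) :
  lends (embe z e) = (embv z (val e).1, embv z (step (val e).1 (val e).2)).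
Proof. by rewrite /lends /= embv_step. Qed.

Lemma embe_inj (z : vtx) n : injective (@embe z n).
Proof.
by move=> [[x i] xi] [[y j] yj] [] /(can_inj (@embvK z n)) /= xy ij; apply/val_inj; rewrite /= xy ij.
Qed.

Lemma inside_embe (z : vtx) n f : inside lends (Box z n) f -> exists e : bedge d n, embe z e = f.
Proof.
case: f => u i [/= Bu Bui].
have lt : (unembv z n u i < n.*2)%N.
  by rewrite ffunE inordK; have := Bu i; have := Bui i; rewrite !ffunE eqxx; coord_lia.
by exists (Sub (unembv z n u, i) lt); rewrite /embe /= unembvK.
Qed.

Lemma inside_box_edges (z : vtx) n : (inside lends (Box z n) `<=` [set` box_edges z n])%classic.
Proof. by move=> f /inside_embe[e <-] /=; apply/mapP; exists e; rewrite ?mem_enum. Qed.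

Lemma dep_conn_Box (z : vtx) n x y :
  dep [set` box_edges z n]%classic (fun w => conn lends w (Box z n) x y).
Proof. apply: dep_sub (@inside_box_edges z n) _; exact: conn_dep. Qed.

Lemma dep_arm_inside (z : vtx) n : dep (inside lends (Box z n)) (arm z n).
Proof. by apply: dep_exists => y; exact: conn_dep. Qed.

Lemma local_arm (z : vtx) n : local (arm z n).
Proof. exists (box_edges z n); apply: dep_sub (@inside_box_edges z n) _; exact: dep_arm_inside. Qed.

Lemma increasing_arm (z : vtx) n : increasing_event (arm z n).
Proof. by apply: increasing_exists => y; exact: increasing_conn. Qed.

Definition shift_edge (z : vtx) (e : ledge) : ledge := (e.1 + z, e.2).

Lemma Box_shift (z z' : vtx) n u : Box (z + z') n (u + z') <-> Box z n u.
Proof.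
by split => Bu i; have := Bu i; rewrite !ffunE /=; coord_lia.
Qed.

Lemma conn_shift (z : vtx) w (B : set vtx) x y :
  conn lends (w \o shift_edge z) B x y <-> conn lends w [set u | B (u - z)]%classic (x + z) (y + z).
Proof.
split => xy.
  apply: (conn_sim (sigma := fun u => u + z) xy) => /=; first by rewrite addrK; exact: conn_src xy.
  move=> e u v Bu Bv we uv _; apply: (conn_edge (e := shift_edge z e)) => //=; rewrite ?addrK //.
  by case: uv => -[<- <-]; [left|right]; rewrite /lends /= addrAC.
have := conn_sim (sigma := fun u => u - z) (B' := B) (w' := w \o shift_edge z) (ends' := lends) xy.
rewrite !addrK; apply; first by move: (conn_src xy); rewrite /= addrK.
move=> e u v Bu Bv we uv _; apply: (conn_edge (e := shift_edge (- z) e)) => //=.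
  by rewrite /shift_edge /= subrK; case: e we {uv}.
by case: uv => -[<- <-]; [left|right]; rewrite /lends /= addrAC.
Qed.

Lemma arm_shift (z : vtx) n w : arm 0 n (w \o shift_edge z) <-> arm z n w.
Proof.
have BE : [set u | Box 0 n (u - z)]%classic = Box z n.
  by apply/funext => u /=; apply/propext; rewrite -(Box_shift 0 z n (u - z)) subrK add0r.
split => -[y [[By [i yi]] cy]].
  move/conn_shift: cy; rewrite BE add0r => cy; exists (y + z); split => //; split.
    by rewrite -[z]add0r in cy *; move: (conn_tgt cy); rewrite add0r.
  by exists i; move: yi; rewrite !ffunE; coord_lia.
exists (y - z); split; last by apply/conn_shift; rewrite BE add0r subrK.
split; first by move: By; rewrite -BE.
by exists i; move: yi; rewrite !ffunE; coord_lia.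
Qed.

Lemma shift_edge_inj z : injective (shift_edge z).
Proof. by move=> [u i] [v j] [/addIr -> ->]. Qed.

Lemma Pr_arm_shift (R : realType) (p : R) (z : vtx) n : Pr p (arm z n) = Pr p (arm 0 n).
Proof.
rewrite -(Pr_transfer p (@shift_edge_inj z) (local_arm 0 n)); congr Pr.
by apply/funext => w; apply/propext; rewrite arm_shift.
Qed.

Lemma conn_arm_event n (w : {ffun bedge d n -> bool}) (w' : ledge -> bool) :
  (forall e, w' (embe 0 e) = w e) -> arm_event w <-> arm 0 n w'.
Proof.
move=> ww'.
have embO : embv 0 (origin d n) = 0.
  by apply/ffunP => j; rewrite !ffunE inordK; [rewrite add0r subrr|lia].
have edgeP (e : bedge d n) x y : edge_between e x y || edge_between e y x <->
    joins lends (embe 0 e) (embv 0 x) (embv 0 y).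
  rewrite /joins lends_embe /edge_between; split.
    by move=> /orP[]/andP[/eqP <- /eqP <-]; [left|right].
  by case=> -[/(can_inj (@embvK 0 n)) -> /(can_inj (@embvK 0 n)) ->]; rewrite !eqxx ?orbT.
have bdP (x : box d n) : on_boundary x <-> Sphere 0 n (embv 0 x).
  split.
    move=> /existsP[i xi]; split; first exact: embv_Box.
    by exists i; rewrite !ffunE; have := ltn_ord (x i); move: xi; coord_lia.
  case=> _ [i xi]; apply/existsP; exists i; move: xi; rewrite !ffunE.
  by have := ltn_ord (x i); coord_lia.
split.
  move=> /existsP[y /andP[/bdP By /connectP[s ps sy]]]; move: By; rewrite {y}sy => By.
  exists (embv 0 (last (origin d n) s)); split => //.
  suff : conn lends w' (Box 0 n) (embv 0 (origin d n)) (embv 0 (last (origin d n) s)).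
    by rewrite embO.
  move: ps {By}; elim: s (origin d n) => [|x s IH] o /=; first by move=> _; apply: conn_refl; exact: embv_Box.
  move=> /andP[/existsP[e /andP[we /edgeP ox]] ps]; apply: conn_trans (IH _ ps).
  by apply: conn_edge ox _ _; [rewrite ww'|exact: embv_Box|exact: embv_Box].
move=> [y [Sy cy]]; apply/existsP; exists (unembv 0 n y); apply/andP; split.
  by apply/bdP; rewrite unembvK //; case: Sy.
elim: cy {Sy} => [_|u v e cu IH we uv Bv].
  by rewrite -[origin d n](embvK 0) embO connect0.
apply: connect_trans IH _; apply: connect1; apply/existsP.
have [f fe] := inside_embe (joins_inside uv (conn_tgt cu) Bv).
exists f; rewrite -ww' fe we /=; apply/edgeP.
by rewrite !unembvK ?fe //; exact: conn_tgt cu.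
Qed.

(** Bridge from the statement, a sum over configurations of box edges, to events on the whole
    lattice: the edge embedding is injective, so only a marginal is taken. *)
Lemma one_arm_prob_Pr (R : realType) (p : R) n : one_arm_prob d p n = Pr p (arm 0 n).
Proof.
have depA : dep [set` box_edges 0 n]%classic (arm 0 n).
  apply: dep_sub (@inside_box_edges 0 n) _; exact: dep_arm_inside.
rewrite (PrE p depA) /Ex.
have inS (e : bedge d n) : embe 0 e \in box_edges 0 n by apply/mapP; exists e; rewrite ?mem_enum.
pose phi e : seq_sub (box_edges 0 n) := SeqSub (inS e).
have phiI : injective phi by move=> e e' /(congr1 val) /embe_inj.
pose g (w : {ffun bedge d n -> bool}) : R := (arm_event w)%:R.
transitivity (fin_Ex p g).
  rewrite /one_arm_prob big_mkcond; apply: eq_bigr => w _; rewrite /g /fin_weight.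
  by case: ifP => _; rewrite ?mulr1 ?mulr0.
rewrite -(fin_Ex_marginal p g phiI); apply: eq_bigr => v _; congr (_ * _).
rewrite /g /ind; congr ((nat_of_bool _)%:R); apply/idP/asboolP.
  by move/conn_arm_event; apply => e; rewrite ffunE -ext_val.
by move/(conn_arm_event (w := [ffun e => v (phi e)])); apply => e; rewrite ffunE -ext_val.
Qed.

End Lattice.

(** * Clusters and the Duminil-Copin--Tassion inequalities *)

Section Cluster.
Variables (V : Type) (L : choiceType) (ends : L -> V * V).
Implicit Types (w : L -> bool) (B X : set V).

Definition cluster B X w : set V := [set u | exists y, X y /\ conn ends w B y u]%classic.

(** The edges examined when the cluster of [X] is explored inside [B], closed boundary edges
    included. *)
Definition touched B X w (e : L) : bool :=
  `[< inside ends B e /\ (cluster B X w (ends e).1 \/ cluster B X w (ends e).2) >].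

Lemma cluster_sub B X w u : cluster B X w u -> B u.
Proof. by case=> y [_ yu]; exact: conn_tgt yu. Qed.

Lemma joins_touched B X w e u v : joins ends e u v -> B v -> cluster B X w u -> touched B X w e.
Proof.
move=> uv Bv Cu; apply/asboolP; have Bu := cluster_sub Cu.
split; first exact: joins_inside uv Bu Bv.
by case: uv => ->; [left|right].
Qed.

(** Any edge by which a path in either configuration could leave a vertex of the cluster is touched,
    so agreement on touched edges lets each path be followed in the other configuration. *)
Lemma cluster_stopping B X w w' : (forall e, touched B X w e -> w e = w' e) ->
  cluster B X w' = cluster B X w.
Proof.
move=> ww'; apply/seteqP; split => u [y [Xy yu]]; last first.
  exists y; split => //; elim: yu => [By|a b e ya IH we ab Bb]; first exact: conn_refl.
  apply: (conn_step IH _ ab Bb); rewrite -ww' //.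
  by apply: (joins_touched ab) => //; exists y.
elim: yu => [By|a b e ya [z [Xz za]] we ab Bb]; first by exists y; split => //; exact: conn_refl.
exists z; split => //; apply: (conn_step za _ ab Bb); rewrite ww' //.
by apply: (joins_touched ab) => //; exists z.
Qed.

Lemma touched_stopping B X w w' : (forall e, touched B X w e -> w e = w' e) ->
  touched B X w' = touched B X w.
Proof. by move=> /cluster_stopping E; apply/funext => e; rewrite /touched E. Qed.

End Cluster.

Section Exit.
Variable d : nat.
Implicit Types (z u v x y : vtx d) (w : ledge d -> bool).

Lemma joins_dist e u v : joins (@lends d) e u v -> forall i, `|u i - v i| <= 1.
Proof.
by case: e => a j [] [<- <-] i; rewrite !ffunE; case: eqP => _ /=; coord_lia.
Qed.

(** A nearest-neighbour step changes each coordinate by at most 1, so a path cannot jump over the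
    sphere: the first vertex outside one box lies on the boundary of the next. *)
Lemma conn_exit_sphere w B z m y : conn (@lends d) w B z y -> (exists i, m%:Z <= `|y i - z i|) ->
  exists x, Sphere z m x /\ conn (@lends d) w (B `&` Box z m)%classic z x.
Proof.
case: m => [|m] zy [i yi].
  exists z; split.
    by split=> [j|]; [|exists i]; rewrite subrr normr0.
  by apply: conn_refl; split; [exact: conn_src zy|move=> j; rewrite subrr normr0].
have [||u [v [e [zu we uv Bv nv]]]] := conn_exit (D := Box z m) zy.
- by move=> j; rewrite subrr normr0.
- by move=> /(_ i); move: yi; coord_lia.
have Bzu := conn_tgt zu; exists v.
have Bzv : Box z m.+1 v.
  by move=> j; have := joins_dist uv j; have := Bzu.2 j; coord_lia.
split; last first.
  apply: (conn_step _ we uv) => //; apply: conn_subset zu => a [Ba Bza]; split => // j.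
  by have := Bza j; coord_lia.
split => //; apply: contrapT => /forallNP nS; apply: nv => j.
by have := nS j; have := Bzv j; coord_lia.
Qed.

Lemma Sphere_far z m y : Sphere z m y -> exists i, m%:Z <= `|y i - z i|.
Proof. by case=> _ [i yi]; exists i; rewrite yi. Qed.

End Exit.

Section Percolation.
Variables (R : realType) (d : nat).
Implicit Types (p : R) (w : ledge d -> bool) (S : set (vtx d)).
Let ends := @lends d.

Definition theta_ p n : R := Pr p (@arm d 0 n).

Lemma theta_Ex p n : theta_ p n = Ex p (box_edges 0 n) (ind R (@arm d 0 n)).
Proof.
rewrite /theta_ (@PrE _ _ _ _ (box_edges 0 n)) //.
by apply: dep_sub (@inside_box_edges d 0 n) _; exact: dep_arm_inside.
Qed.

Lemma theta_ge0 p n : 0 <= p <= 1 -> 0 <= theta_ p n.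
Proof. exact: Pr_ge0. Qed.

Lemma theta_le1 p n : 0 <= p <= 1 -> theta_ p n <= 1.
Proof. exact: Pr_le1. Qed.

Definition boundary_edge S (e : ledge d) : Prop :=
  (S (ends e).1 /\ ~ S (ends e).2) \/ (S (ends e).2 /\ ~ S (ends e).1).

Definition inner S (e : ledge d) : vtx d := if `[< S (ends e).1 >] then (ends e).1 else (ends e).2.
Definition outer S (e : ledge d) : vtx d := if `[< S (ends e).1 >] then (ends e).2 else (ends e).1.

(* [p * phi p n S] is the functional phi_p(S) of Duminil-Copin and Tassion, for S inside
   the interior of the box of radius [n]. *)
Definition phi p n S : R :=
  \sum_(e <- box_edges 0 n) (`[< boundary_edge S e >])%:R * Pr p (fun w => conn ends w S 0 (inner S e)).

Definition interior n : set (vtx d) := (Box 0 n `\` Sphere 0 n)%classic.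

Lemma interior_step n e u v : joins ends e u v -> interior n u -> Box 0 n v.
Proof.
move=> uv [Bu nSu] i; have := joins_dist uv i; have := Bu i.
have : `|u i - (0 : vtx d) i| <> n%:Z by move=> h; apply: nSu; split => //; exists i.
by rewrite !ffunE; coord_lia.
Qed.

Lemma inner_in S e : boundary_edge S e -> S (inner S e).
Proof. by rewrite /inner; case: asboolP => // nS [] []. Qed.

Lemma outer_out S e : boundary_edge S e -> ~ S (outer S e).
Proof. by rewrite /outer; case: asboolP => // S1 [] []. Qed.

Lemma joins_inner_outer S e : joins ends e (inner S e) (outer S e).
Proof.
by rewrite /inner /outer; case: asboolP => _; [|apply: joins_sym]; exact: joins_ends.
Qed.

Lemma boundary_edgeP S e u v : joins ends e u v -> S u -> ~ S v ->
  [/\ boundary_edge S e, inner S e = u & outer S e = v].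
Proof.
rewrite /boundary_edge /inner /outer => -[] -> /= Su nSv; first by rewrite asboolT //; split => //; left.
by rewrite asboolF //; split => //; right.
Qed.

Lemma uniq_box_edges (z : vtx d) n : uniq (box_edges z n).
Proof. by rewrite map_inj_uniq ?enum_uniq //; exact: embe_inj. Qed.

Lemma dep_conn_sub S n x y : (S `<=` Box 0 n)%classic ->
  dep [set` box_edges 0 n]%classic (fun w => conn ends w S x y).
Proof.
move=> Sn; apply: (@dep_sub _ _ (inside ends S)); last exact: conn_dep.
by move=> e [S1 S2]; apply: inside_box_edges; split; exact: Sn.
Qed.

(** The differential inequality of Duminil-Copin and Tassion. Explore the cluster of the sphere and
    let [S w] be its complement. When 0 lies in [S w], a boundary edge of [S w] whose inner end is
    joined to 0 within [S w] is pivotal, and given the exploration the expected number of such edges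
    is phi(S w) >= 1. *)
Lemma theta_russo p n : 0 <= p <= 1 ->
  (forall S, S 0 -> (S `<=` interior n)%classic -> 1 <= phi p n S) ->
  1 - theta_ p n <= \sum_(e <- box_edges 0 n) Ex p (box_edges 0 n)
    (fun w => ind R (arm 0 n) (upd w e true) - ind R (arm 0 n) (upd w e false)).
Proof.
move=> p01 phi1; set s := box_edges 0 n.
pose C w := cluster ends (Box 0 n) (Sphere 0 n) w.
pose S w : set (vtx d) := (Box 0 n `\` C w)%classic.
have SI w : (S w `<=` interior n)%classic.
  move=> u [Bu nCu]; split => // Su; apply: nCu; exists u; split => //; exact: conn_refl.
have SB w : (S w `<=` Box 0 n)%classic by move=> u [].
pose F e w := S w 0 /\ boundary_edge (S w) e /\ conn ends w (S w) 0 (inner (S w) e).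
have B00 : Box 0 n (0 : vtx d) by move=> i; rewrite !ffunE subrr normr0.
have narm w : ~ arm 0 n w <-> S w 0.
  split=> [na|[_ nC] [y [Sy cy]]]; last by apply: nC; exists y; split => //; exact: conn_sym.
  split => // -[y [Sy cy]]; apply: na; exists y; split => //; exact: conn_sym.
have step1 : \sum_(e <- s) Ex p s (ind R (F e)) <= \sum_(e <- s) Ex p s
    (fun w => ind R (arm 0 n) (upd w e true) - ind R (arm 0 n) (upd w e false)).
  apply: ler_sum => e _; apply: Ex_le => // w _.
  have [[S0 [be ce]]|nF] := pselect (F e w); last first.
    rewrite {1}/ind asboolF // subr_ge0; apply: upd_increasing.
    exact: increasing_ind (@increasing_arm d 0 n).
  have aT : arm 0 n (upd w e true).
    have [y [Sy cy]] : C w (outer (S w) e).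
      apply: contrapT => nC; apply: (outer_out be); split => //.
      exact: interior_step (joins_inner_outer _ _) (SI _ _ (inner_in be)).
    exists y; split => //; apply: (@conn_trans _ _ _ _ _ _ (outer (S w) e)).
      apply: (conn_step (y := inner (S w) e) (e := e)); last exact: conn_tgt cy.
      - apply: conn_mono ce => [|f _ wf]; first exact: SB.
        by rewrite /upd; case: eqP.
      - by rewrite /upd eqxx.
      - exact: joins_inner_outer.
    apply: conn_sym; apply: conn_mono cy => // f _ wf; by rewrite /upd; case: eqP.
  have aF : ~ arm 0 n (upd w e false).
    move=> /(increasing_arm (w' := w)) a; apply: (narm w).2 S0 (a _) => f.
    by rewrite /upd; case: eqP.
  by rewrite /ind (asboolT aT) (asboolF aF) subr0; case: asboolP.
apply: le_trans step1.
pose W := touched ends (Box 0 n) (Sphere 0 n).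
have Smix w w' : S (mix (W w) w w') = S w.
  by rewrite /S /C (@cluster_stopping _ _ _ _ _ w) // => e We; rewrite /mix /W We.
have ExF e : Ex p s (ind R (F e)) = Ex p s (fun w => ind R (fun w => S w 0) w *
    ((`[< boundary_edge (S w) e >])%:R * Pr p (fun w' => conn ends w' (S w) 0 (inner (S w) e)))).
  rewrite (@Ex_markov _ _ _ _ W); last by move=> w w'; exact: touched_stopping.
  apply: Ex_eq => w _; rewrite (PrE p (dep_conn_sub _ _ (SB w))) mulrA -ExZ.
  apply: Ex_eq => w' _; rewrite /F (ind_and R (fun w => S w 0)).
  rewrite (ind_and R (fun w => boundary_edge (S w) e)) /ind Smix mulrA.
  (* An edge inside [S w] has no end in the explored cluster, so it is unexplored and resampled. *)
  congr (_ * ((nat_of_bool `[< _ >])%:R)); apply: (@conn_dep _ _ ends (S w) 0 _) => f [[B1 n1] [B2 n2]].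
  by rewrite /mix /W /touched asboolF // => -[_ []].
rewrite (eq_bigr _ (fun e _ => ExF e)) -Ex_sum.
have <- : Ex p s (ind R (fun w => ~ arm 0 n w)) = 1 - theta_ p n.
  rewrite /theta_ -(Pr_not p (local_arm 0 n)) (@PrE _ _ _ _ s) // => w w' ww'; congr (~ _).
  by move: w w' ww'; apply: dep_sub (@inside_box_edges d 0 n) _; exact: dep_arm_inside.
apply: Ex_le => // w _; rewrite -mulr_sumr {1}/ind; case: asboolP => [/narm S0|_].
  by rewrite /ind asboolT // mul1r; exact: phi1.
apply: mulr_ge0; first exact: ind_ge0.
by apply: sumr_ge0 => e _; rewrite mulr_ge0 ?ler0n ?Pr_ge0.
Qed.

End Percolation.

Section Decay.
Variables (R : realType) (d : nat).
Implicit Types (p : R) (w : ledge d -> bool) (S : set (vtx d)).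
Let ends := @lends d.

Lemma box_edges_inside (z : vtx d) n e : e \in box_edges z n -> inside ends (Box z n) e.
Proof.
by move=> /mapP[f _ ->]; rewrite /inside /ends lends_embe; split; exact: embv_Box.
Qed.

(** Cut the long arm where it last leaves the cluster of 0 in [S]: a connection within [S], an open
    boundary edge and an arm of length [N - n] from the outer end. Exploring the cluster first makes
    the three independent. *)
Lemma theta_step p n N S : 0 <= p <= 1 -> (n <= N)%N -> S 0 -> (S `<=` interior n)%classic ->
  theta_ d p N <= p * phi p n S * theta_ d p (N - n).
Proof.
move=> p01 nN S0 SI; set s := box_edges (0 : vtx d) N; set s' := box_edges (0 : vtx d) n.
have SBn : (S `<=` Box 0 n)%classic by move=> u /SI[].
have BnN : (Box (0 : vtx d) n `<=` Box 0 N)%classic by move=> u Bu i; have := Bu i; coord_lia.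
have SBN : (S `<=` Box 0 N)%classic by move=> u /SBn/BnN.
pose C w := cluster ends S [set 0]%classic w.
have CE w u : C w u <-> conn ends w S 0 u.
  by split=> [[y [->]]|cu] //; exists 0.
pose D w : set (vtx d) := (~` C w)%classic.
(* With [A] the complement of the cluster, the arm reads neither explored edges nor [e], whose inner
   end is in the cluster. *)
pose Q e (A : set (vtx d)) w := exists y, Sphere (outer S e) (N - n) y /\
  conn ends w (A `&` Box (outer S e) (N - n))%classic (outer S e) y.
pose F e w := (conn ends w S 0 (inner S e) /\ boundary_edge S e) /\ (w e /\ Q e (D w) w).
have cover w : arm 0 N w -> exists2 e, e \in s' & F e w.
  move=> [y [Sy cy]].
  have nCy : ~ C w y.
    move=> Cy; have [By nSy] := SI _ (cluster_sub Cy); have [i] := Sphere_far Sy.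
    have := By i => Bi Ni; apply: nSy; split => //; exists i; move: Bi Ni; coord_lia.
  have C0 : C w 0 by apply/CE; exact: conn_refl.
  have [u [v [e [Cu we uv _ cv]]]] := conn_last_exit cy C0 nCy.
  have nSv : ~ S v.
    move=> Sv; apply: (conn_src cv).2; apply/CE; move/CE: Cu => Cu; exact: conn_step Cu we uv Sv.
  have Su := cluster_sub Cu.
  have [be iE oE] := boundary_edgeP uv Su nSv.
  have Bv : Box 0 n v := interior_step uv (SI _ Su).
  exists e; first by apply: inside_box_edges; exact: joins_inside uv (SBn _ Su) Bv.
  split; first by rewrite iE; split=> //; exact/CE.
  split => //.
  have [i yi] := Sphere_far Sy.
  have [|x [Sx cx]] := conn_exit_sphere (m := N - n) cv.
    by exists i; have := Bv i; move: yi; coord_lia.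
  exists x; rewrite oE; split => //; apply: conn_subset cx => a [[_ ?] ?]; split => //.
have Q_arm e A w : Q e A w -> arm (outer S e) (N - n) w.
  by move=> [y [Sy cy]]; exists y; split => //; apply: conn_subset cy => a [].
have depN (z : vtx d) m : Box 0 n z -> (m <= N - n)%N -> dep [set` s]%classic (arm z m).
  move=> Bz mN; apply: (@dep_sub _ _ (inside ends (Box z m))); last exact: dep_arm_inside.
  move=> e [B1 B2]; apply: inside_box_edges.
  by split => i; [have := B1 i|have := B2 i]; have := Bz i; coord_lia.
rewrite theta_Ex -/s.
apply: (@le_trans _ _ (Ex p s (fun w => \sum_(e <- s') ind R (F e) w))).
  apply: Ex_le => // w _; rewrite {1}/ind; case: asboolP => [/cover[e es Fe]|_]; last first.
    by apply: sumr_ge0 => e _; exact: ind_ge0.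
  rewrite (big_rem e es) /= {1}/ind asboolT // lerDl.
  by apply: sumr_ge0 => ? _; exact: ind_ge0.
rewrite Ex_sum /phi mulr_sumr mulr_suml !big_seq; apply: ler_sum => e es'.
have [be|nbe] := pselect (boundary_edge S e); last first.
  rewrite (asboolF nbe) mul0r mulr0 mul0r.
  by rewrite -[leRHS](Ex_cst p s); apply: Ex_le => // w _; rewrite /ind asboolF // => -[[]].
rewrite (asboolT be) mul1r.
pose W := touched ends S [set 0]%classic.
rewrite (@Ex_markov _ _ _ _ W); last by move=> w w'; exact: touched_stopping.
rewrite (PrE p (s := s)) //; last first.
  apply: (@dep_sub _ _ (inside ends S)); last exact: conn_dep.
  by move=> f [S1 S2]; apply: inside_box_edges; split; exact: SBN.
have es : e \in s.
  by apply: inside_box_edges; have [B1 B2] := box_edges_inside es'; split; exact: BnN.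
have bound w : Ex p s (fun w' => ind R (F e) (mix (W w) w w')) <=
    (p * theta_ d p (N - n)) * ind R (fun w => conn ends w S 0 (inner S e)) w.
  have Cmix w' : C (mix (W w) w w') = C w.
    by rewrite /C (@cluster_stopping _ _ _ _ _ w) // => f Wf; rewrite /mix /W Wf.
  have [ce|nce] := pselect (conn ends w S 0 (inner S e)); last first.
    rewrite {2}/ind (asboolF nce) mulr0 -[leRHS](Ex_cst p s).
    by apply: Ex_le => // w' _; rewrite /ind asboolF // => -[[/CE + _] _]; rewrite Cmix => /CE.
  rewrite {2}/ind (asboolT ce) mulr1.
  have nWe : W w e = false.
    apply/negbTE/negP => /asboolP[[S1 S2] _]; apply: (outer_out be).
    by rewrite /outer; case: asboolP.
  apply: (@le_trans _ _ (Ex p s (fun w' => ind R (fun w' => w' e) w' * ind R (Q e (D w)) w'))).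
    apply: Ex_le => // w' _; rewrite -ind_and; apply: ind_le => -[_ []].
    rewrite /D Cmix /mix nWe => w'e [y [Sy cy]]; split => //; exists y; split => //.
    apply: conn_mono cy => // f [[nC1 _] [nC2 _]].
    by rewrite /W /touched asboolF // => -[_ []].
  have depe : dep [set e]%classic (ind R (fun w' : ledge d -> bool => w' e)).
    by move=> w1 w2 w12; rewrite /ind w12.
  have depQ : dep (~` [set e])%classic (ind R (Q e (D w))).
    apply: dep_ind; apply: dep_exists => y.
    apply: (@dep_sub _ _ (inside ends (D w `&` Box (outer S e) (N - n))%classic));
      last exact: conn_dep.
    move=> f [[nC1 _] [nC2 _]] fe.
    by move: nC1 nC2; rewrite fe; move/CE: ce; rewrite /inner; case: asboolP.
  rewrite (Ex_indep p s depe depQ).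
  have -> : Ex p s (ind R (fun w' => w' e)) = p.
    transitivity (Ex p s (fun w' => (w' e)%:R)); last by rewrite (Ex_edge p (fun b : bool => b%:R) es) /=; ring.
    by apply: Ex_eq => w' _; rewrite /ind asboolb.
  apply: ler_wpM2l; first by lra.
  have Bo : Box 0 n (outer S e) := interior_step (joins_inner_outer S e) (SI _ (inner_in be)).
  rewrite /theta_ -(Pr_arm_shift p (outer S e)) (PrE p (depN _ _ Bo (leqnn _))).
  by apply: Ex_le => // w' _; apply: ind_le; exact: Q_arm.
rewrite mulrAC -ExZ; apply: Ex_le => // w _; exact: bound.
Qed.

(** Iterating [theta_step] gives a bound geometric in N/n. *)
Lemma theta_decay p n S : 0 <= p <= 1 -> S 0 -> (S `<=` interior n)%classic -> p * phi p n S < 1 ->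
  (theta_ d p n0 @[n0 --> \oo] --> (0 : R))%classic.
Proof.
move=> p01 S0 SI phi1; set c := p * phi p n S in phi1.
have c0 : 0 <= c.
  apply: mulr_ge0; first by lra.
  by apply: sumr_ge0 => e _; rewrite mulr_ge0 ?ler0n ?Pr_ge0.
have bound k N : (k * n <= N)%N -> theta_ d p N <= c ^+ k.
  elim: k N => [|k IH] N kN; first by rewrite expr0 theta_le1.
  apply: le_trans (theta_step p01 _ S0 SI) _; first by lia.
  by rewrite exprS; apply: ler_wpM2l => //; apply: IH; lia.
apply/cvgrPdist_lt => e e0.
have [K _ HK] : (\forall k \near \oo, `|0 - c ^+ k| < e)%classic.
  by move: e e0; apply/cvgrPdist_lt; apply: cvg_expr; rewrite ger0_norm.
exists (K * n)%N => // N /= KN; rewrite sub0r normrN ger0_norm ?theta_ge0 //.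
apply: le_lt_trans (bound K N KN) _.
by have := HK K (leqnn K); rewrite sub0r normrN ger0_norm // exprn_ge0.
Qed.

End Decay.

(** * Power sums *)

Section PowerBounds.
Variable R : realType.
Implicit Types (a b c x y : R).

(** Compare ln at [x] and [y] with its tangent at the weighted mean [z]; the slopes cancel in the
    weighted sum. *)
Lemma powR_amgm b x y : 0 < b < 1 -> 0 < x -> 0 < y ->
  x `^ (1 - b) * y `^ b <= (1 - b) * x + b * y.
Proof.
move=> b01 x0 y0; set z := (1 - b) * x + b * y.
have z0 : 0 < z by rewrite /z; nra.
rewrite /powR !gt_eqF // -expRD -[leRHS]lnK ?posrE // ler_expR.
have tangent t : 0 < t -> ln t <= ln z + (t - z) / z.
  move=> t0; rewrite -lerBlDl -ln_div ?posrE //.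
  have tz : 0 < t / z by rewrite divr_gt0.
  have := @le_ln1Dx R (t / z - 1); rewrite [1 + _]addrC subrK => /(_ ltac:(lra)) /le_trans; apply.
  by rewrite mulrBl divff ?gt_eqF.
have hx := tangent x x0; have hy := tangent y y0.
have e0 : (1 - b) * ((x - z) / z) + b * ((y - z) / z) = 0.
  by rewrite /z; field; rewrite -/z gt_eqF.
nra.
Qed.

(** Integral comparison by induction: multiplied by (n+2)^b, the inductive step is exactly
    [powR_amgm] at n+1 and n+2. *)
Lemma sum_powR_le b n : 0 < b < 1 ->
  \sum_(0 <= j < n.+1) (j.+1%:R : R) `^ (- b) <= (1 - b)^-1 * n.+1%:R `^ (1 - b).
Proof.
move=> b01; have b1 : 0 < 1 - b by lra.
elim: n => [|n IH].
  by rewrite big_nat1 !powR1 mulr1 invf_ge1 //; lra.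
rewrite big_nat_recr //=; apply: le_trans (lerD IH (lexx _)) _.
have m0 : 0 < n.+1%:R :> R by rewrite ltr0n.
have m1 : 0 < n.+2%:R :> R by rewrite ltr0n.
have eS : n.+2%:R = n.+1%:R + 1 :> R by rewrite -natr1.
have P0 : 0 < n.+2%:R `^ b :> R by rewrite powR_gt0.
have E1 : n.+2%:R `^ (1 - b) = n.+2%:R / n.+2%:R `^ b :> R.
  by rewrite powRB ?powRr1 ?ler0n // (gt_eqF m1) implybT.
have := powR_amgm b01 m0 m1; rewrite E1 powRN eS in P0 *.
move: (n.+1%:R `^ (1 - b)) ((n.+1%:R + 1) `^ b) P0 => X Y Y0 XY.
have b1n : 1 - b != 0 by rewrite gt_eqF.
have Yn : Y != 0 by rewrite gt_eqF.
rewrite -(ler_pM2l b1) mulrDr !mulVKf // -(ler_pM2r Y0) mulrDl divfK // mulfVK //; lra.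
Qed.

Lemma powR_small c e : 0 < c -> 0 < e -> exists N, forall n, (N <= n)%N -> n.+1%:R `^ (- c) < e.
Proof.
move=> c0 e0; have [N HN] : exists N : nat, (e^-1) `^ (c^-1) < N%:R.
  by exists (Num.bound ((e^-1) `^ (c^-1))); apply: archi_boundP; exact: powR_ge0.
exists N => n Nn; have nN : e^-1 `^ c^-1 < n.+1%:R.
  by apply: lt_le_trans HN _; rewrite ler_nat; lia.
have : (e^-1 `^ c^-1) `^ c < n.+1%:R `^ c.
  by apply: gt0_ltr_powR; rewrite ?nnegrE ?powR_ge0.
rewrite -powRrM mulVf ?gt_eqF // powRr1 ?invr_ge0 ?ltW // powRN => h.
by rewrite -(invrK e) ltf_pV2 // posrE ?invr_gt0 // powR_gt0 // ltr0n.
Qed.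

Lemma powR_antitone a x y : 0 < a -> 0 < x -> x <= y -> y `^ (- a) <= x `^ (- a).
Proof.
move=> a0 x0 xy; have y0 : 0 < y by lra.
rewrite !powRN lef_pV2 ?posrE ?powR_gt0 //; apply: ge0_ler_powR => //; rewrite ?nnegrE; lra.
Qed.

Lemma powR_eventual_bound a (u : nat -> R) n0 : 0 < a -> (forall n, u n <= 1) ->
  (forall n, (n0 <= n)%N -> u n <= n%:R `^ (- a)) ->
  exists2 K, 1 <= K & forall n, u n <= K * n.+1%:R `^ (- a).
Proof.
(* The first summand absorbs the indices up to [n0], where only u <= 1 is known; the second pays for
   replacing n by n+1 <= 2n. *)
move=> a0 u1 hu; exists ((n0 + 2)%:R `^ a + 2 `^ a).
  rewrite -[leLHS]addr0 lerD ?powR_ge0 // -[leLHS](powRr0 (n0 + 2)%:R); apply: ler_powR; last exact: ltW.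
  by rewrite ler1n; lia.
move=> n; have n0' : 0 < n.+1%:R :> R by rewrite ltr0n.
rewrite mulrDl; have [lt|ge] := ltnP n n0.+1.
  apply: le_trans (u1 n) _; rewrite -[leLHS]addr0 lerD ?mulr_ge0 ?powR_ge0 //.
  rewrite powRN -ler_pdivrMr ?divr1 ?invr_gt0 ?powR_gt0 // invrK mul1r.
  by apply: ge0_ler_powR; rewrite ?nnegrE ?ler0n ?(ltW a0) // ler_nat; lia.
apply: le_trans (hu n _) _; first by lia.
rewrite -[leLHS]add0r lerD ?mulr_ge0 ?powR_ge0 //.
have nn0 : 0 < n%:R :> R by rewrite ltr0n; lia.
rewrite [X in _ <= X * _](_ : 2 `^ a = 2^-1 `^ (- a)); last first.
  by rewrite powRN -(@powR_inv1 _ 2) // -powRrM mulN1r powRN invrK.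
rewrite -powRM ?ler0n ?invr_ge0 //; apply: powR_antitone => //.
rewrite ler_pdivrMl // -natrM ler_nat; lia.
Qed.

End PowerBounds.

(** * Mean-field bound, entropy bound and the high-dimensional argument *)

Section CriticalPoint.
Variables (R : realType) (d : nat).
Implicit Types (p : R) (w : ledge d -> bool) (S : set (vtx d)).
Let ends := @lends d.

Lemma theta_lim p (l : R) : (theta_ d p n @[n --> \oo] --> l)%classic -> theta d p = l.
Proof.
move=> cv; rewrite /theta (_ : (fun n => one_arm_prob d p n) = theta_ d p); first exact/cvg_lim.
by apply/funext => n; exact: one_arm_prob_Pr.
Qed.

Definition subcritical : set R := [set p : R | 0 <= p <= 1 /\ theta d p = 0]%classic.

Lemma le_p_c p : 0 <= p <= 1 -> theta d p = 0 -> p <= p_c d R.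
Proof.
move=> p01 t0; apply: ub_le_sup; last by split.
by exists 1 => q [/andP[]].
Qed.

Lemma p_c_01 : 0 <= p_c d R <= 1.
Proof.
(* The supremum of the empty set is 0 by convention. *)
rewrite /p_c -/subcritical; have [->|/set0P ne] := eqVneq subcritical set0.
  by rewrite sup0 lexx ler01.
apply/andP; split; last by apply: ge_sup => // q [/andP[]].
have [q [/andP[q0 q1] tq]] := ne; apply: (le_trans q0); apply: le_p_c => //.
by apply/andP.
Qed.

(** Otherwise p phi(S) < 1, and [theta_decay] would give theta(p) = 0 above the supremum defining
    p_c. *)
Lemma phi_ge1 p n S : p_c d R < p -> p <= 1 -> S 0 -> (S `<=` interior n)%classic -> 1 <= phi p n S.
Proof.
move=> pcp p1 S0 SI; have /andP[pc0 _] := p_c_01.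
have p01 : 0 <= p <= 1 by rewrite p1 andbT; lra.
rewrite leNgt; apply/negP => phi1; have : p * phi p n S < 1.
  have : 0 <= phi p n S by apply: sumr_ge0 => e _; rewrite mulr_ge0 ?ler0n ?Pr_ge0.
  by move=> phi0; nra.
by move/(theta_decay p01 S0 SI)/theta_lim/(le_p_c p01); rewrite leNgt pcp.
Qed.

Lemma theta_mean_field p n : p_c d R < p -> p <= 1 -> (p - p_c d R) / 2 <= theta_ d p n.
Proof.
move=> pcp p1; have /andP[pc0 _] := p_c_01.
have p01 : 0 <= p <= 1 by rewrite p1 andbT; lra.
(* If theta_n(p) >= 1/2 the claim is trivial because p - p_c <= 1; otherwise 1 - theta_n exceeds 1/2
   on the whole interval, and so does the derivative. *)
have [big|small] := lerP (1 / 2) (theta_ d p n); first lra.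
set s := box_edges (0 : vtx d) n.
have tE q : theta_ d q n = Ex q s (ind R (arm 0 n)) by exact: theta_Ex.
have [q [qE qD]] := Ex_russo (ind R (@arm d 0 n)) (uniq_box_edges 0 n).
have [x] : exists2 x, x \in `]p_c d R, p[ & q.[p] - q.[p_c d R] = q^`().[x] * (p - p_c d R).
  apply: (@MVT R (horner q) (horner q^`())) => //.
  by apply: continuous_subspaceT; exact: continuous_horner.
rewrite in_itv /= => /andP[pcx xp]; rewrite qD -!qE -!tE.
have x01 : 0 <= x <= 1 by apply/andP; split; lra.
have := @theta_russo R d x n x01.
move=> /(_ (fun S => @phi_ge1 x n S pcx (le_trans (ltW xp) p1))).
have : theta_ d x n <= theta_ d p n.
  apply: Pr_increasing_p => //; [exact: local_arm|exact: increasing_arm|lra|lra].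
have : 0 <= theta_ d (p_c d R) n by apply: theta_ge0; exact: p_c_01.
rewrite -/s; move: (\sum_(_ <- _) _) => D; nra.
Qed.

(** The exploration of the cluster of 0 decides the arm event, and each edge it touches has an end
    joined to 0; this turns the entropy cost into a sum of two-point functions. *)
Lemma theta_entropy p p' n : 0 < p < 1 -> 0 < p' < 1 ->
  theta_ d p' n <= 2 * (theta_ d p n + (p' - p) ^+ 2 / (p' * (1 - p')) *
    \sum_(e <- box_edges 0 n) (Pr p (fun w => conn ends w (Box 0 n) 0 (ends e).1) +
                               Pr p (fun w => conn ends w (Box 0 n) 0 (ends e).2))).
Proof.
move=> p01 p01'; set s := box_edges (0 : vtx d) n.
have tE q : theta_ d q n = Ex q s (ind R (arm 0 n)) by exact: theta_Ex.
pose W := touched ends (Box 0 n) [set 0]%classic.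
have CE w u : cluster ends (Box 0 n) [set 0]%classic w u <-> conn ends w (Box 0 n) 0 u.
  by split=> [[y [->]]|cu] //; exists 0.
rewrite !tE; apply: le_trans (Ex_entropy (W := W) (uniq_box_edges 0 n) p01 p01' _ _) _.
- by move=> w w'; exact: touched_stopping.
- move=> w w' /cluster_stopping E; apply/propext; split => -[y [Sy cy]]; exists y; split => //.
    by apply/CE; rewrite -E; apply/CE.
  by apply/CE; rewrite E; apply/CE.
rewrite ler_pM2l // lerD2l; apply: ler_wpM2l.
  by rewrite mulr_ge0 ?sqr_ge0 // invr_ge0 mulr_ge0 //; lra.
apply: ler_sum => e _.
have depc x : dep [set` s]%classic (fun w => conn ends w (Box 0 n) 0 x) by exact: dep_conn_Box.
rewrite !(PrE p (depc _)) -ExD; apply: Ex_le; first lra.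
move=> w _; rewrite /W /touched; case: asboolP => [[_ C]|_]; last by rewrite addr_ge0 ?ind_ge0.
have i0 x := ind_ge0 R (fun w => conn ends w (Box 0 n) 0 x) w.
case: C => /CE c; [rewrite {1}/ind|rewrite {2}/ind]; rewrite (asboolT c).
  by rewrite lerDl.
by rewrite lerDr.
Qed.

(** The boxes of radius [m] around 0 and [x] share no vertex, so the two arms contained in the
    connection are independent. *)
Lemma two_point p n (x : vtx d) m : 0 <= p <= 1 -> (exists i, (2 * m + 1)%N%:Z <= `|x i|) ->
  Pr p (fun w => conn ends w (Box 0 n) 0 x) <= theta_ d p m ^+ 2.
Proof.
move=> p01 [i xi]; rewrite expr2 {2}/theta_ -(Pr_arm_shift p x).
have disj : (inside ends (Box x m) `<=` ~` inside ends (Box 0 m))%classic.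
  move=> e [Bx _] [B0 _]; have := Bx i; have := B0 i.
  by rewrite !ffunE; move: xi; coord_lia.
rewrite -(@Pr_indep _ _ p (inside ends (Box 0 m))); first last.
- exact: dep_sub disj (@dep_arm_inside d x m).
- exact: dep_arm_inside.
- exact: local_arm.
- exact: local_arm.
apply: Pr_le => //; first by exists (box_edges 0 n); exact: dep_conn_Box.
  by apply: local_and; exact: local_arm.
move=> w cx; split.
  have [|y [Sy cy]] := conn_exit_sphere (m := m) cx.
    by exists i; rewrite !ffunE; move: xi; coord_lia.
  by exists y; split => //; apply: conn_subset cy => u [].
have [|y [Sy cy]] := conn_exit_sphere (m := m) (conn_sym cx).
  by exists i; rewrite !ffunE; move: xi; coord_lia.
by exists y; split => //; apply: conn_subset cy => u [].
Qed.

End CriticalPoint.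

(** * Summing the two-point bound over a box, and the contradiction for a > d/3 *)

Section BoxSums.
Variables (R : realType) (d : nat).
Let ends := @lends d.

(* The product weight [prod_i (1 + |x_i|)^(-b)] dominates [(1 + |x|_sup)^(-b d)] and its sum
   over a box factorizes. *)
Definition prod_weight (b : R) (x : vtx d) : R := \prod_i (absz (x i)).+1%:R `^ (- b).

Lemma prod_weight_ge0 b x : 0 <= prod_weight b x.
Proof. by apply: prodr_ge0 => i _; exact: powR_ge0. Qed.

Lemma prod_weight_step b u i : 0 < b ->
  prod_weight b (u + unitv i) <= (2 `^ b) ^+ d * prod_weight b u.
Proof.
move=> b0; rewrite /prod_weight -[X in _ ^+ X](card_ord d) -prodr_const -big_split.
apply: ler_prod => j _; rewrite powR_ge0 /=.
have -> : 2 `^ b = 2^-1 `^ (- b) :> R.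
  by rewrite powRN -(@powR_inv1 _ 2) // -powRrM mulN1r powRN invrK.
rewrite -powRM ?invr_ge0 ?ler0n //; apply: powR_antitone => //.
(* It remains that 1 + |t| is at most 2 (1 + |t + 1|) for every integer t. *)
rewrite ler_pdivrMl // -natrM ler_nat !ffunE.
by case: (j == i) => /=; coord_lia.
Qed.

Lemma sum_reflect b n : 0 < b < 1 ->
  \sum_(j < n.*2.+1) (absz (j%:Z - n%:Z)).+1%:R `^ (- b) <=
    2 * ((1 - b)^-1 * n.+1%:R `^ (1 - b)) :> R.
Proof.
move=> b01; rewrite -(big_mkord xpredT (fun j => (absz (j%:Z - n%:Z)).+1%:R `^ (- b))).
have S0 := sum_powR_le n b01.
rewrite (@big_cat_nat _ _ _ n) //=; last by lia.
rewrite mulrDl mul1r; apply: lerD.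
  rewrite big_nat_rev /= add0n; apply: le_trans S0.
  rewrite [leRHS]big_nat_recl //= -[leLHS]add0r; apply: lerD; first exact: powR_ge0.
  rewrite le_eqVlt; apply/orP; left; apply/eqP/eq_big_nat => j jn; congr (_%:R `^ _); lia.
apply: le_trans S0; rewrite -{1}[n]add0n big_addn.
rewrite le_eqVlt; apply/orP; left; apply/eqP.
have -> : (n.*2.+1 - n = n.+1)%N by lia.
by apply: eq_big_nat => j jn; congr (_%:R `^ _); lia.
Qed.

Lemma sum_prod_weight b n : 0 < b < 1 ->
  \sum_(x : box d n) prod_weight b (embv 0 x) <= (2 * ((1 - b)^-1 * n.+1%:R `^ (1 - b))) ^+ d.
Proof.
move=> b01; rewrite -[X in _ <= _ ^+ X](card_ord d) -prodr_const.
apply: (@le_trans _ _ (\prod_(i < d) \sum_(j < n.*2.+1) (absz (j%:Z - n%:Z)).+1%:R `^ (- b))).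
  rewrite bigA_distr_bigA le_eqVlt; apply/orP; left; apply/eqP; apply: eq_bigr => x _.
  by apply: eq_bigr => i _; rewrite !ffunE add0r.
apply: ler_prod => i _; rewrite sum_reflect // andbT.
by apply: sumr_ge0 => j _; exact: powR_ge0.
Qed.

(** Each edge is charged to its lower end, at the price 2^(bd) for the upper one; a vertex is the
    lower end of at most d edges. *)
Lemma sum_box_edges b n : 0 < b < 1 ->
  \sum_(e <- box_edges 0 n) (prod_weight b (ends e).1 + prod_weight b (ends e).2) <=
  (1 + (2 `^ b) ^+ d) * (d%:R * (2 * ((1 - b)^-1 * n.+1%:R `^ (1 - b))) ^+ d).
Proof.
move=> b01; have b0 : 0 < b by case/andP: b01.
have c0 : 0 <= 1 + (2 `^ b) ^+ d :> R by rewrite addr_ge0 // exprn_ge0 ?powR_ge0.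
apply: (@le_trans _ _ (\sum_(e <- box_edges 0 n) (1 + (2 `^ b) ^+ d) * prod_weight b (ends e).1)).
  apply: ler_sum => e _; rewrite mulrDl mul1r lerD2l; exact: prod_weight_step.
rewrite -mulr_sumr; apply: ler_wpM2l => //.
rewrite big_map big_enum /=.
apply: (@le_trans _ _ (\sum_(q : box d n * 'I_d) prod_weight b (embv 0 q.1))).
  rewrite [leRHS](bigID (mem (codom (val : bedge d n -> _)))) /= -[leLHS]addr0 lerD //.
    rewrite le_eqVlt; apply/orP; left; apply/eqP.
    rewrite -big_uniq /=; last by rewrite /codom map_inj_uniq ?enum_uniq //; exact: val_inj.
    by rewrite big_map big_enum.
  by apply: sumr_ge0 => q _; exact: prod_weight_ge0.
rewrite -(pair_bigA _ (fun x (i : 'I_d) => prod_weight b (embv 0 x))) /=.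
under eq_bigr do rewrite sumr_const card_ord -mulr_natl.
by rewrite -mulr_sumr; apply: ler_wpM2l; [rewrite ler0n|exact: sum_prod_weight].
Qed.

(** For [k] the sup norm of [x], the largest admissible radius is m = (k-1)/2 rounded down, and k +
    1 <= 4(m + 1) gives the factor 4^a. The exponent 2a/d makes a product of d factors (1+k)^(-2a/d)
    equal to (1+k)^(-2a). *)
Lemma two_point_weight (p a K : R) n (x : vtx d) : 0 <= p <= 1 -> (0 < d)%N -> 0 < a -> 1 <= K ->
  (forall m, theta_ d p m <= K * m.+1%:R `^ (- a)) ->
  Pr p (fun w => conn ends w (Box 0 n) 0 x) <=
    (K * 4 `^ a) ^+ 2 * prod_weight (2 * a / d%:R) x.
Proof.
move=> p01 d0 a0 K1 HK; set b := 2 * a / d%:R.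
have dR : 0 < d%:R :> R by rewrite ltr0n.
have b0 : 0 < b by rewrite divr_gt0 ?mulr_gt0.
pose k := \max_(i < d) absz (x i).
have kx i : (absz (x i) <= k)%N by exact: (leq_bigmax (F := fun i => absz (x i))).
have weight : (k.+1%:R `^ (- a)) ^+ 2 <= prod_weight b x.
  have -> : (k.+1%:R `^ (- a)) ^+ 2 = \prod_(i < d) k.+1%:R `^ (- b) :> R.
    rewrite prodr_const card_ord -(powR_mulrn 2 (powR_ge0 _ _)) -(powR_mulrn d (powR_ge0 _ _)).
    by rewrite -!powRrM; congr (_ `^ _); rewrite /b; field; rewrite gt_eqF.
  apply: ler_prod => i _; rewrite powR_ge0 /=; apply: powR_antitone => //.
  by rewrite ler_nat ltnS.
have A1 : 1 <= (4 : R) `^ a by rewrite -[leLHS](powRr0 4); apply: ler_powR; [lra|exact: ltW].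
have [k0|k0] := posnP k.
  have -> : prod_weight b x = 1.
    by apply: big1 => i _; have := kx i; rewrite k0 leqn0 => /eqP ->; rewrite powR1.
  rewrite mulr1; apply: le_trans (Pr_le1 _ p01) _; apply: exprn_ege1.
  by apply: (le_trans K1); rewrite ler_peMr //; lra.
have [i ki] : exists i, k = absz (x i).
  by have [|i kE] := @bigop.eq_bigmax _ (fun i : 'I_d => absz (x i)); [rewrite card_ord|exists i].
apply: (@le_trans _ _ (theta_ d p k.-1./2 ^+ 2)).
  by apply: two_point => //; exists i; move: k0; rewrite ki; coord_lia.
have t0 : 0 <= theta_ d p k.-1./2 by exact: theta_ge0.
apply: (@le_trans _ _ ((K * 4 `^ a * k.+1%:R `^ (- a)) ^+ 2)); last first.
  by rewrite exprMn; apply: ler_wpM2l => //; rewrite sqr_ge0.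
rewrite ler_sqr ?nnegrE ?mulr_ge0 ?powR_ge0 //; last by lra.
apply: le_trans (HK _) _; rewrite -mulrA; apply: ler_wpM2l; first by lra.
have -> : (4 : R) `^ a = 4^-1 `^ (- a) by rewrite powRN -(@powR_inv1 _ 4) // -powRrM mulN1r powRN invrK.
rewrite -powRM ?invr_ge0 ?ler0n //; apply: powR_antitone => //.
rewrite ler_pdivrMl // -natrM ler_nat; clear; lia.
Qed.

(** The bounds on [a] have separate purposes: a < d/2 gives b < 1, so that the weights sum to order
    n^(d-2a), and a > d/3 makes n^(d-3a) tend to 0. *)
Lemma no_fast_decay (a K : R) : (0 < d)%N -> 0 < p_c d R < 1 -> d%:R / 3 < a -> a < d%:R / 2 -> 1 <= K ->
  (forall n, theta_ d (p_c d R) n <= K * n.+1%:R `^ (- a)) -> False.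
Proof.
move=> d0 pc01 a1 a2 K1 HK; set p := p_c d R in pc01 HK.
have dR : 0 < d%:R :> R by rewrite ltr0n.
have a0 : 0 < a by lra.
set b := 2 * a / d%:R.
have b01 : 0 < b < 1.
  by rewrite divr_gt0 ?mulr_gt0 //= ltr_pdivrMr // mul1r; lra.
pose M := (K * 4 `^ a) ^+ 2.
pose C1 := M * ((1 + (2 `^ b) ^+ d) * (d%:R * (2 * (1 - b)^-1) ^+ d)).
have sumD n : \sum_(e <- box_edges 0 n) (Pr p (fun w => conn ends w (Box 0 n) 0 (ends e).1) +
    Pr p (fun w => conn ends w (Box 0 n) 0 (ends e).2)) <= C1 * n.+1%:R `^ (d%:R - 2 * a).
  have p01 : 0 <= p <= 1 by lra.
  apply: (@le_trans _ _ (\sum_(e <- box_edges 0 n) M * (prod_weight b (ends e).1 + prod_weight b (ends e).2))).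
    by apply: ler_sum => e _; rewrite mulrDr; apply: lerD; exact: two_point_weight.
  rewrite -mulr_sumr /C1 -mulrA; apply: ler_wpM2l; first exact: sqr_ge0.
  apply: le_trans (sum_box_edges _ b01) _; rewrite -mulrA; apply: ler_wpM2l.
    by rewrite addr_ge0 // exprn_ge0 ?powR_ge0.
  rewrite -mulrA; apply: ler_wpM2l => //.
  rewrite mulrA exprMn; apply: ler_wpM2l.
    by rewrite exprn_ge0 // mulr_ge0 // invr_ge0; lra.
  rewrite -powR_mulrn ?powR_ge0 // -powRrM le_eqVlt; apply/orP; left; apply/eqP.
  by congr (_ `^ _); rewrite /b; field; rewrite gt_eqF.
have C10 : 0 <= C1.
  rewrite /C1 mulr_ge0 ?sqr_ge0 // mulr_ge0 ?addr_ge0 ?exprn_ge0 ?powR_ge0 //.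
  by rewrite mulr_ge0 // exprn_ge0 // mulr_ge0 // invr_ge0; lra.
(* Keeping p + eps below the midpoint [q] of p and 1 bounds (p + eps)(1 - p - eps) below by p(1 -
   q). *)
pose q := (1 + p) / 2.
pose C := 64 * K * (p * (1 - q))^-1 * C1 + 1.
have C0 : 0 < C.
  rewrite /C ltr_wpDl // mulr_ge0 // mulr_ge0 //; first by rewrite mulr_ge0 //; lra.
  by rewrite invr_ge0 mulr_ge0 // /q; lra.
have [N1 HN1] := @powR_small R a ((1 - p) / (16 * K)) a0 ltac:(by rewrite divr_gt0; lra).
have c0 : 0 < 3 * a - d%:R by lra.
have [N2 HN2] := @powR_small R (3 * a - d%:R) C^-1 c0 ltac:(by rewrite invr_gt0).
pose n := maxn N1 N2; have n1 := HN1 n (leq_maxl _ _); have n2 := HN2 n (leq_maxr _ _).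
(* With eps = 8Kt the mean-field bound is 4Kt, while the entropy bound is 2Kt plus a term quadratic
   in eps. That term must therefore pay 2Kt, and dividing by 2Kt leaves the constant 64 of [C]. *)
pose t : R := n.+1%:R `^ (- a); pose eps := 8 * K * t.
have t0 : 0 < t by rewrite powR_gt0 // ltr0n.
have eps0 : 0 < eps by rewrite /eps; nra.
have epsq : p + eps <= q.
  have : t < (1 - p) / (16 * K) by exact: n1.
  rewrite ltr_pdivlMr; last by lra.
  by rewrite /q /eps; lra.
have q1 : q < 1 by rewrite /q; lra.
have low := @theta_mean_field R d (p + eps) n ltac:(rewrite -/p; lra) ltac:(lra).
have up := @theta_entropy R d p (p + eps) n pc01 ltac:(lra).
have chi : (p + eps - p) ^+ 2 / ((p + eps) * (1 - (p + eps))) <= eps ^+ 2 * (p * (1 - q))^-1.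
  rewrite [p + eps]addrC addrK; apply: ler_wpM2l; first exact: sqr_ge0.
  rewrite lef_pV2 ?posrE; nra.
have := HK n; rewrite -/t => tn; have D := sumD n.
have pq0 : 0 <= (p * (1 - q))^-1 by rewrite invr_ge0; nra.
have up2 : (p + eps - p) / 2 <= 2 * (K * t + eps ^+ 2 * (p * (1 - q))^-1 * (C1 * n.+1%:R `^ (d%:R - 2 * a))).
  apply: le_trans low _; apply: le_trans up _; rewrite ler_pM2l //; apply: lerD => //.
  apply: ler_pM => //; first by rewrite divr_ge0 ?sqr_ge0 // mulr_ge0; lra.
  by apply: sumr_ge0 => e _; rewrite addr_ge0 // Pr_ge0 //; lra.
have key : t * n.+1%:R `^ (d%:R - 2 * a) < C^-1.
  rewrite -powRD; last by apply/implyP.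
  by apply: le_lt_trans n2; rewrite le_eqVlt; apply/orP; left; apply/eqP; congr (_ `^ _); ring.
have tp : 0 <= n.+1%:R `^ (d%:R - 2 * a) :> R by exact: powR_ge0.
move: key up2 tp; rewrite /eps -/n; move: (n.+1%:R `^ (d%:R - 2 * a)) => T key up2 T0.
have : 1 <= 64 * K * (p * (1 - q))^-1 * C1 * (t * T).
  have Kt : 0 < 2 * (K * t) by nra.
  rewrite -(ler_pM2l Kt) mulr1; move: up2; set U := (p * (1 - q))^-1; lra.
have : C * (t * T) < 1 by rewrite -ltr_pdivlMl // mulr1.
have : 0 <= t * T by rewrite mulr_ge0 // ltW.
rewrite /C; lra.
Qed.

End BoxSums.

(** * Planar crossings and duality *)

Lemma big_addb_telescope (f : nat -> bool) n :
  \big[addb/false]_(j < n) (f j (+) f j.+1) = f 0%N (+) f n.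
Proof.
elim: n => [|n IH]; first by rewrite big_ord0 addbb.
by rewrite big_ord_recr /= IH addbA addbK.
Qed.

Section Planar.

Definition pv := (int * int)%type.
Definition pe := (pv * bool)%type.

(* [(x, y, false)] is the edge from (x, y) to (x+1, y), [(x, y, true)] the edge from (x, y) to
   (x, y+1); a face is named by its lower left corner, and [dends e] are the two faces
   separated by [e]. *)
Definition pends (e : pe) : pv * pv :=
  (e.1, if e.2 then (e.1.1, e.1.2 + 1) else (e.1.1 + 1, e.1.2)).
Definition dends (e : pe) : pv * pv :=
  (if e.2 then (e.1.1 - 1, e.1.2) else (e.1.1, e.1.2 - 1), e.1).

Definition Rect (x0 x1 y0 y1 : int) : set pv :=
  [set u : pv | x0 <= (u.1 : int) <= x1 /\ y0 <= (u.2 : int) <= y1]%classic.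

Implicit Types (w : pe -> bool) (B : set pv).

Definition Hcross (x0 x1 y0 y1 : int) w :=
  exists u v, [/\ u.1 = x0, v.1 = x1 & conn pends w (Rect x0 x1 y0 y1) u v].
Definition Vcross (x0 x1 y0 y1 : int) w :=
  exists u v, [/\ u.2 = y0, v.2 = y1 & conn pends w (Rect x0 x1 y0 y1) u v].

Lemma pjoins_h (x y : int) u v : joins pends ((x, y), false) u v ->
  (u = (x, y) /\ v = (x + 1, y)) \/ (v = (x, y) /\ u = (x + 1, y)).
Proof. by case=> -[<- <-]; [left|right]. Qed.

Lemma pjoins_v (x y : int) u v : joins pends ((x, y), true) u v ->
  (u = (x, y) /\ v = (x, y + 1)) \/ (v = (x, y) /\ u = (x, y + 1)).
Proof. by case=> -[<- <-]; [left|right]. Qed.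

(* The cut of a face colouring restricted to the columns [x0, x1). *)
Definition cut (x0 x1 : int) (c : pv -> bool) : pe -> bool := fun e =>
  [&& x0 <= ((dends e).1.1 : int) < x1, x0 <= ((dends e).2.1 : int) < x1 & c (dends e).1 != c (dends e).2].

(* Parity argument: the number of cut edges from column i to column i+1 that are reachable
   from the left is odd for i = x0 and does not depend on i. *)
Lemma cut_crossing (x0 x1 y0 y1 : int) (c : pv -> bool) : x0 < x1 -> y0 <= y1 ->
  (forall x, x0 <= x < x1 -> c (x, y0 - 1)) -> (forall x, x0 <= x < x1 -> ~~ c (x, y1)) ->
  Hcross x0 x1 y0 y1 (cut x0 x1 c).
Proof.
move=> x01 y01 cbot ctop; apply: contrapT => nH.
pose X u := `[< exists2 s, s.1 = x0 & conn pends (cut x0 x1 c) (Rect x0 x1 y0 y1) s u >].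
have Xstep e u v : joins pends e u v -> cut x0 x1 c e -> Rect x0 x1 y0 y1 u -> Rect x0 x1 y0 y1 v -> X u = X v.
  move=> uv ce Ru Rv; apply/asboolP/asboolP => -[s sx cs]; exists s => //.
    exact: conn_step cs ce uv Rv.
  exact: conn_step cs ce (joins_sym uv) Ru.
have [a aE] : exists a : nat, x1 = x0 + a.+1%:Z by exists (absz (x1 - x0)).-1; lia.
have [b bE] : exists b : nat, y1 = y0 + b%:Z by exists (absz (y1 - y0)); lia.
pose hc (i j : int) := c (x0 + i, y0 + j - 1) != c (x0 + i, y0 + j).
pose N (i : nat) := \big[addb/false]_(j < b.+1) (X (x0 + i%:Z, y0 + j%:Z) && hc i%:Z j%:Z).
have hcut (i j : nat) : (i <= a)%N -> hc i%:Z j%:Z -> cut x0 x1 c ((x0 + i%:Z, y0 + j%:Z), false).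
  by move=> ia h; rewrite /cut /=; apply/and3P; split=> //; lia.
have XR (i j : nat) : (i <= a)%N -> (j <= b)%N -> hc i%:Z j%:Z ->
    X (x0 + i%:Z, y0 + j%:Z) = X (x0 + i.+1%:Z, y0 + j%:Z).
  move=> ia jb h; apply: (Xstep ((x0 + i%:Z, y0 + j%:Z), false)); last 2 first.
  - by split => /=; lia.
  - by split => /=; lia.
  - by left; rewrite /pends /=; congr ((_, _), (_, _)); lia.
  - exact: hcut.
(* Every vertex of column [x0] counts as reachable, so [N 0] is the parity of the colour changes
   from the bottom face to the top one. *)
have N0 : N 0%N = true.
  pose f (j : nat) := c (x0 + 0%:Z, y0 + j%:Z - 1).
  have -> : N 0%N = \big[addb/false]_(j < b.+1) (f j (+) f j.+1).
    apply: eq_bigr => j _; have -> : X (x0 + 0%:Z, y0 + j%:Z).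
      apply/asboolP; exists (x0 + 0%:Z, y0 + j%:Z) => /=; first lia.
      by apply: conn_refl; split => /=; have := ltn_ord j; lia.
    rewrite /hc /f (_ : y0 + j.+1%:Z - 1 = y0 + j%:Z); last by lia.
    by do 2 case: (c _).
  rewrite big_addb_telescope /f.
  rewrite (_ : y0 + 0%N%:Z - 1 = y0 - 1) ?cbot; try lia.
  by rewrite (_ : y0 + b.+1%:Z - 1 = y1) ?(negbTE (ctop _ _)) //; lia.
have Na : N a = false.
  apply: big1 => j _; apply/negbTE/negP => /andP[Xj hj].
  have ja : (j <= b)%N by have := ltn_ord j; lia.
  move: Xj; rewrite (XR _ _ (leqnn a) ja hj) => /asboolP[s sx cs]; apply: nH.
  by exists s, (x0 + a.+1%:Z, y0 + j%:Z); split => //=; lia.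
have NS i : (i < a)%N -> N i = N i.+1.
  (* Around a vertex the four faces show an even number of colour changes. Reachability is constant
     along vertical cut edges, so their contributions telescope over the column. *)
  move=> ia; pose vc (j : nat) := c (x0 + i%:Z, y0 + j%:Z - 1) != c (x0 + i.+1%:Z, y0 + j%:Z - 1).
  pose g (j : nat) := X (x0 + i.+1%:Z, y0 + j%:Z) && vc j.
  have ltx k : (k <= a)%N -> x0 <= x0 + k%:Z < x1 by lia.
  have vc0 : vc 0%N = false.
    by rewrite /vc (_ : y0 + 0%N%:Z - 1 = y0 - 1) ?cbot ?ltx //; lia.
  have vcb : vc b.+1 = false.
    rewrite /vc (_ : y0 + b.+1%:Z - 1 = y1); last by lia.
    by rewrite !(negbTE (ctop _ _)) ?ltx //; lia.
  have gS (j : nat) : (j <= b)%N -> g j.+1 = X (x0 + i.+1%:Z, y0 + j%:Z) && vc j.+1.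
    move=> jb; rewrite /g; case vj : (vc j.+1); rewrite ?andbF // !andbT.
    have jb' : (j < b)%N.
      by move: jb vj; rewrite leq_eqVlt => /orP[/eqP ->|//]; rewrite vcb.
    symmetry; apply: (Xstep ((x0 + i.+1%:Z, y0 + j%:Z), true)); last 2 first.
    - by split => /=; lia.
    - by split => /=; lia.
    - by left; rewrite /pends /=; congr ((_, _), (_, _)); lia.
    rewrite /cut /=; apply/and3P; split; try lia.
    move: vj; rewrite /vc (_ : y0 + j.+1%:Z - 1 = y0 + j%:Z); last lia.
    by rewrite (_ : x0 + i.+1%:Z - 1 = x0 + i%:Z) //; lia.
  have : N i (+) N i.+1 = false.
    rewrite -big_split /= (eq_bigr (fun j : 'I_b.+1 => g j (+) g j.+1)) => [|j _].
      by rewrite big_addb_telescope /g vc0 vcb !andbF.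
    have jb : (j <= b)%N by have := ltn_ord j; lia.
    rewrite gS // {1}/g.
    have -> : X (x0 + i%:Z, y0 + j%:Z) && hc i%:Z j%:Z = X (x0 + i.+1%:Z, y0 + j%:Z) && hc i%:Z j%:Z.
      case hj : (hc i%:Z j%:Z); rewrite ?andbF // !andbT; apply: XR => //; exact: ltnW.
    case: (X _) => //=; rewrite /hc /vc (_ : y0 + j.+1%:Z - 1 = y0 + j%:Z); last lia.
    by do 4 case: (c _).
  by case: (N i); case: (N i.+1).
suff : forall i, (i <= a)%N -> N i = true by move=> /(_ a (leqnn a)); rewrite Na.
elim=> [_|i IH ia]; first exact: N0.
by rewrite -NS // IH // ltnW.
Qed.

End Planar.

(** Loop erasure at one edge: if a path comes back to [e0], the detour is cut out, so [e0] is used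
    at most once. *)
Lemma conn_use (V : Type) (L : choiceType) (ends : L -> V * V) (w : L -> bool) (B : set V) e0 x y :
  conn ends w B x y -> let w0 := fun e => w e && (e != e0) in
  conn ends w0 B x y \/
  exists u v, [/\ joins ends e0 u v, conn ends w0 B x u & conn ends w0 B v y].
Proof.
move=> + w0; elim => [Bx|y' z e cy IH we yz Bz]; first by left; exact: conn_refl.
have [ee|ne] := eqVneq e e0; last first.
  have w0e : w0 e by rewrite /w0 we.
  case: IH => [c|[u [v [uv xu vy]]]]; first by left; exact: conn_step c w0e yz Bz.
  by right; exists u, v; split => //; exact: conn_step vy w0e yz Bz.
case: IH => [c|[u [v [uv xu vy]]]].
  by right; exists y', z; split => //; [rewrite -ee|exact: conn_refl].
have [zu|zv] : z = u \/ z = v.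
  by move: yz uv; rewrite ee => -[] E []; rewrite E => -[zu zv]; by [right|left].
  by left; rewrite zu.
by right; exists u, v; split => //; rewrite zv; apply: conn_refl; rewrite -zv.
Qed.

Section PlanarCrossing.
Implicit Types (w : pe -> bool) (B : set pv).

(* [k] is the set of edges used an odd number of times by a walk. *)
Lemma conn_chain w B s t : conn pends w B s t -> exists k : pe -> bool,
  [/\ forall e, k e -> w e, forall e, k e -> inside pends B e &
      forall x y, k ((x, y), false) (+) k ((x - 1, y), false) (+)
        (k ((x, y), true) (+) k ((x, y - 1), true)) = ((x, y) == s) (+) ((x, y) == t)].
Proof.
elim => [Bs|y z e sy [k [kw kB kd]] we yz Bz].
  by exists (fun=> false); split => // x y; rewrite /= addbb.
have By := conn_tgt sy.
exists (fun f => k f (+) (f == e)); split => [f|f|a b].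
- by case: eqVneq => [->|_] //=; rewrite addbF; exact: kw.
- case: eqVneq => [-> _|_]; last by rewrite addbF; exact: kB.
  exact: joins_inside yz By Bz.
have D : (((a, b), false) == e) (+) (((a - 1, b), false) == e) (+)
    ((((a, b), true) == e) (+) (((a, b - 1), true) == e)) = ((a, b) == y) (+) ((a, b) == z).
  have {sy kw kB kd we Bz By yz} : (y, z) = pends e \/ (z, y) = pends e by case: yz => ->; [left|right].
  case: e => [[x1 x2] []] /=; rewrite /pends /=; case=> -[-> ->]; rewrite !xpair_eqE /= ?andbT ?andbF /= ?addbF ?addFb.
  - rewrite (_ : (b - 1 == x2) = (b == x2 + 1)) //; lia.
  - rewrite (_ : (b - 1 == x2) = (b == x2 + 1)); [exact: addbC|lia].
  - rewrite (_ : (a - 1 == x1) = (a == x1 + 1)) //; lia.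
  - rewrite (_ : (a - 1 == x1) = (a == x1 + 1)); [exact: addbC|lia].
by rewrite [X in X (+) _]addbACA [X in _ (+) X]addbACA addbACA kd D addbA addbK.
Qed.

(* A left-right path and a dual bottom-top path must use a common edge: the flux through the
   segment below a face, mod 2, of the chain of the first is constant along the second. *)
Lemma crossing_exclusive (x0 x1 y0 y1 : int) w w' u v B f g :
  conn pends w (Rect x0 x1 y0 y1) u v -> u.1 = x0 -> v.1 = x1 -> x0 < x1 ->
  conn dends w' B f g -> (forall h, B h -> x0 <= (h.1 : int) < x1) -> (f.2 : int) < y0 -> y1 <= (g.2 : int) ->
  (forall e, w e -> w' e -> False) -> False.
Proof.
move=> uv ux vx x01 fg BS f2 g2 ww'.
have [k [kw kB kd]] := conn_chain uv.
have Ru := conn_src uv; have Rv := conn_tgt uv.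
pose F (x : int) n := \big[addb/false]_(j < n) k ((x, y0 + j%:Z), false).
(* [ht y] counts the horizontal edges of a column from row [y0] to the lower side of the face of row
   [y], so [F x (ht y)] is the flux below that face. *)
pose ht (y : int) : nat := if y < y0 then 0%N else (absz (y - y0)).+1.
have kout x y b : ~~ (y0 <= y <= y1) -> k ((x, y), b) = false.
  move=> ny; apply/negbTE/negP => /kB[[_ /= h] _]; move: ny h; lia.
have Fcol x n : x0 < x < x1 -> F (x - 1) n (+) F x n = k ((x, y0 + n%:Z - 1), true).
  move=> xx; pose q (j : nat) := k ((x, y0 + j%:Z - 1), true).
  rewrite -big_split /= (eq_bigr (fun j : 'I_n => q j (+) q j.+1)) => [|j _].
    rewrite big_addb_telescope /q (_ : y0 + 0%N%:Z - 1 = y0 - 1); last lia.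
    by rewrite kout //; lia.
  have := kd x (y0 + j%:Z).
  have -> : ((x, y0 + j%:Z) == u) = false by apply/negbTE/eqP => E; move: ux; rewrite -E /=; lia.
  have -> : ((x, y0 + j%:Z) == v) = false by apply/negbTE/eqP => E; move: vx; rewrite -E /=; lia.
  rewrite /q (_ : y0 + j.+1%:Z - 1 = y0 + j%:Z); last lia.
  by do 4 case: (k _).
have Fsame e h h' : B h -> B h' -> w' e -> joins dends e h h' -> F h.1 (ht h.2) = F h'.1 (ht h'.2).
  move=> Bh Bh' we hh'.
  have ke : k e = false by apply/negbTE/negP => /kw we'; exact: ww' we' we.
  have H : F (dends e).1.1 (ht (dends e).1.2) = F (dends e).2.1 (ht (dends e).2.2).
    have [S1 S2] : x0 <= ((dends e).1.1 : int) < x1 /\ x0 <= ((dends e).2.1 : int) < x1.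
      by case: hh' => ->; split; exact: BS.
    case: e ke S1 S2 {we hh'} => [[x y] []] /= ke S1 S2.
      have [yy|yy] := ltP y y0; first by rewrite /ht yy /F !big_ord0.
      have := Fcol x (ht y) ltac:(lia).
      rewrite (_ : y0 + (ht y)%:Z - 1 = y); last by rewrite /ht ltNge yy /=; lia.
      by rewrite ke; case: (F _ _); case: (F _ _).
    have [yy|yy] := ltP y y0; first by rewrite /ht yy (_ : y - 1 < y0) ?/F ?big_ord0 //; lia.
    have -> : ht y = (ht (y - 1)).+1 by rewrite /ht; case: ltP; case: ltP; lia.
    rewrite /F big_ord_recr /= (_ : y0 + (ht (y - 1))%:Z = y) ?ke ?addbF //.
    by rewrite /ht; case: ltP; lia.
  by move: H; case: hh' => ->.
have Ffg : F f.1 (ht f.2) = F g.1 (ht g.2).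
  elim: fg {g2} => // a b e ca IH we ab Bb.
  by rewrite IH; apply: (Fsame e) => //; exact: conn_tgt ca.
have F0 : F f.1 (ht f.2) = false by rewrite /ht f2 /F big_ord0.
have [b bE] : exists b : nat, y1 = y0 + b%:Z by exists (absz (y1 - y0)); have := Ru.2; lia.
have Ftop x n : (b.+1 <= n)%N -> F x n = F x b.+1.
  elim: n => // n IH; rewrite leq_eqVlt => /orP[/eqP <- //|bn].
  rewrite /F big_ord_recr /= kout ?addbF; last lia.
  exact: IH.
have Fx (i : nat) : x0 + i%:Z < x1 -> F (x0 + i%:Z) b.+1 = F x0 b.+1.
  elim: i => [|i IH] xi; first by rewrite addr0.
  rewrite -IH; last lia.
  have := Fcol (x0 + i.+1%:Z) b.+1 ltac:(lia).
  rewrite (_ : x0 + i.+1%:Z - 1 = x0 + i%:Z); last lia.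
  have -> : k ((x0 + i.+1%:Z, y0 + b.+1%:Z - 1), true) = false.
    by apply/negbTE/negP => /kB[_ [_ /= h]]; move: h; lia.
  by case: (F _ _); case: (F _ _).
(* Sum the boundary relation along column [x0]: the vertical terms telescope away and only the
   source [u] contributes, so the flux is odd. *)
have F1 : F x0 b.+1 = true.
  pose q (j : nat) := k ((x0, y0 + j%:Z - 1), true).
  pose su (j : nat) := (x0, y0 + j%:Z) == u.
  have -> : F x0 b.+1 = \big[addb/false]_(j < b.+1) ((q j (+) q j.+1) (+) su j).
    apply: eq_bigr => j _; have := kd x0 (y0 + j%:Z).
    have -> : k ((x0 - 1, y0 + j%:Z), false) = false.
      by apply/negbTE/negP => /kB[[/= h _] _]; move: h; lia.
    have -> : ((x0, y0 + j%:Z) == v) = false by apply/negbTE/eqP => E; move: vx; rewrite -E /=; lia.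
    rewrite /q /su (_ : y0 + j.+1%:Z - 1 = y0 + j%:Z); last lia.
    by do 3 case: (k _); case: (_ == u).
  rewrite big_split /= big_addb_telescope /q.
  have -> : k ((x0, y0 + 0%N%:Z - 1), true) = false by rewrite kout //; lia.
  have -> : k ((x0, y0 + b.+1%:Z - 1), true) = false.
    by apply/negbTE/negP => /kB[_ [_ /= h]]; move: h; lia.
  have ju : (absz (u.2 - y0) < b.+1)%N by have := Ru.2; lia.
  rewrite (bigD1 (Ordinal ju)) //= big1 => [|j nj].
    by rewrite /su (_ : (_, _) = u) ?eqxx //; case: (u) ux (Ru.2) => a c /= -> h; congr (_, _); lia.
  apply/negbTE/eqP => E; move: nj => /eqP; apply; apply/val_inj => /=.
  by rewrite -E /=; lia.
have gS := BS _ (conn_tgt fg).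
move: Ffg; rewrite F0 /ht ltNge (_ : y0 <= (g.2 : int)) /=; last by have := Ru.2; lia.
rewrite Ftop; last lia.
have -> : g.1 = x0 + (absz (g.1 - x0))%:Z by lia.
by rewrite Fx ?F1 //; lia.
Qed.

(** Colour the faces reached from the bottom through closed edges. If the top is not reached,
    [cut_crossing] applies, and the cut edges are open because a closed one would propagate the
    colour. *)
Lemma Hcross_dual (x0 x1 y0 y1 : int) w : x0 < x1 -> y0 <= y1 -> ~ Hcross x0 x1 y0 y1 w ->
  exists f g, [/\ f.2 = y0 - 1, g.2 = y1 &
    conn dends (fun e => ~~ w e) (Rect x0 (x1 - 1) (y0 - 1) y1) f g].
Proof.
move=> x01 y01 nH; apply: contrapT => nD; apply: nH.
set FR := Rect x0 (x1 - 1) (y0 - 1) y1 in nD.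
pose c (g : pv) := `[< exists f, f.2 = y0 - 1 /\ conn dends (fun e => ~~ w e) FR f g >].
have cbot x : x0 <= x < x1 -> c (x, y0 - 1).
  move=> xx; apply/asboolP; exists (x, y0 - 1); split => //; apply: conn_refl.
  by split => /=; lia.
have ctop x : x0 <= x < x1 -> ~~ c (x, y1).
  by move=> xx; apply/negP => /asboolP[f [f2 cf]]; apply: nD; exists f, (x, y1).
have [u [v [ux vx uv]]] := cut_crossing x01 y01 cbot ctop.
exists u, v; split => //; apply: conn_mono uv => // e [[a1 a2] [b1 b2]] /and3P[s1 s2 cc].
apply: contraT => nwe; move: cc.
have F1 : FR (dends e).1.
  by move: a1 a2 b1 b2 s1 s2; case: e {nwe} => [[x y] []] /= *; split => /=; lia.
have F2 : FR (dends e).2.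
  by move: a1 a2 b1 b2 s1 s2; case: e {nwe F1} => [[x y] []] /= *; split => /=; lia.
suff -> : c (dends e).1 = c (dends e).2 by rewrite eqxx.
apply/asboolP/asboolP => -[f [f2 cf]]; exists f; split => //.
  exact: conn_step cf nwe (joins_ends _ _) F2.
exact: conn_step cf nwe (joins_sym (joins_ends _ _)) F1.
Qed.

(* A bottom-top path, shifted by (1/2, 1/2), is a dual path crossing only edges incident to it. *)
Lemma crossings_meet (x0 x1 y0 y1 : int) w l r b t : let S := Rect x0 x1 y0 y1 in
  conn pends w S l r -> l.1 = x0 -> r.1 = x1 ->
  conn pends w S b t -> b.2 = y0 -> t.2 = y1 -> conn pends w S l b.
Proof.
move=> S lr lx rx bt by0 ty; apply: contrapT => nlb.
pose T : set pv := [set u | conn pends w S b u]%classic.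
have Sl := conn_src lr; have Sr := conn_tgt lr; have Sb := conn_src bt.
have nT u : conn pends w S l u -> ~ T u.
  by move=> lu bu; apply: nlb; exact: conn_trans lu (conn_sym bu).
pose w1 (e : pe) := `[< ~ T (pends e).1 /\ ~ T (pends e).2 >].
pose w2 (e : pe) := `[< T (pends e).1 \/ T (pends e).2 >].
(* One column is added on the right because the shifted vertical path may use the faces of column
   [x1]. *)
have lr1 : conn pends w1 (Rect x0 (x1 + 1) y0 y1) l (x1 + 1, r.2).
  have lr' : conn pends w1 (Rect x0 (x1 + 1) y0 y1) l r.
    elim: lr => [_|u v e lu IH we uv Sv].
      by apply: conn_refl; move: Sl; rewrite /S /Rect /=; lia.
    have lv := conn_step lu we uv Sv.
    apply: (conn_step IH _ uv); last by move: Sv; rewrite /S /Rect /=; lia.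
    apply/asboolP; have := nT _ lu; have := nT _ lv.
    by case: uv => ->.
  apply: (conn_step lr' (e := (r, false))); last by move: Sr; rewrite /S /Rect /=; lia.
    apply/asboolP; split; first exact: nT.
    by move=> bt'; have := conn_tgt bt'; rewrite /S /Rect /= rx; lia.
  by left; rewrite /pends /= rx.
have [x bE] : exists x, b = (x, y0) by exists b.1; rewrite -by0; case: (b).
pose B : set pv := [set h : pv | x0 <= (h.1 : int) < x1 + 1]%classic.
have bt2 : conn dends w2 B (x, y0 - 1) t.
  have b0 : conn dends w2 B (x, y0 - 1) b.
    apply: (conn_edge (e := (b, false))).
    - by apply/asboolP; left; exact: conn_refl.
    - by left; rewrite /dends /= bE.
    - by move: Sb; rewrite bE /S /Rect /B /=; lia.
    - by move: Sb; rewrite /S /Rect /B /=; lia.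
  elim: bt => [//|u v e bu IH we uv Sv].
  have bv := conn_step bu we uv Sv.
  have Su := conn_tgt bu.
  have BB h : S h -> B h by rewrite /S /Rect /B /=; lia.
  case: e we uv => [[p q] []] we.
    move=> /pjoins_v [[uE vE]|[vE uE]]; apply: (conn_step IH (e := ((p, q + 1), false))); try exact: BB.
    - by apply/asboolP; left; rewrite /pends /= -vE.
    - by left; rewrite /dends /= uE vE addrK.
    - by apply/asboolP; left; rewrite /pends /= -uE.
    - by right; rewrite /dends /= uE vE addrK.
  move=> /pjoins_h [[uE vE]|[vE uE]]; apply: (conn_step IH (e := ((p + 1, q), true))); try exact: BB.
  - by apply/asboolP; left; rewrite /pends /= -vE.
  - by left; rewrite /dends /= uE vE addrK.
  - by apply/asboolP; left; rewrite /pends /= -uE.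
  - by right; rewrite /dends /= uE vE addrK.
apply: (crossing_exclusive lr1 lx _ _ bt2) => //=; try lia.
- by move: Sl; rewrite /S /Rect /=; lia.
- by move=> e /asboolP[n1 n2] /asboolP[].
Qed.

End PlanarCrossing.

Lemma conn_iso (V1 V2 L1 L2 : Type) (ends1 : L1 -> V1 * V1) (ends2 : L2 -> V2 * V2)
    (sigma : V1 -> V2) (sigma' : V2 -> V1) (tau : L1 -> L2) (tau' : L2 -> L1) :
  cancel sigma sigma' -> cancel tau' tau ->
  (forall e u v, joins ends1 e u v -> joins ends2 (tau e) (sigma u) (sigma v)) ->
  (forall e u v, joins ends2 e u v -> joins ends1 (tau' e) (sigma' u) (sigma' v)) ->
  forall w (B : set V1) u v,
  conn ends1 (w \o tau) B u v <-> conn ends2 w [set q | B (sigma' q)]%classic (sigma u) (sigma v).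
Proof.
move=> sK tK H H' w B u v; split => uv.
  apply: (conn_sim uv); first by rewrite /= sK; exact: conn_src uv.
  by move=> e a b Ba Bb we ab _; apply: (conn_edge (e := tau e)); rewrite /= ?sK //; exact: H.
rewrite -[u]sK -[v]sK; apply: (conn_sim uv); first exact: conn_src uv.
by move=> e a b Ba Bb we ab _; apply: (conn_edge (e := tau' e)) => //; [rewrite /= tK|exact: H'].
Qed.

(** * Lattice symmetries and self-duality of rectangle crossings *)

Section PlanarSymmetries.
Implicit Types (w : pe -> bool) (x y : int).

Definition shiftv (a b : int) (u : pv) : pv := (u.1 + a, u.2 + b).
Definition shifte (a b : int) (e : pe) : pe := (shiftv a b e.1, e.2).
Definition swapv (u : pv) : pv := (u.2, u.1).
Definition swape (e : pe) : pe := (swapv e.1, ~~ e.2).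
Definition reflv (c : int) (u : pv) : pv := (c - u.1, u.2).
Definition refle (c : int) (e : pe) : pe :=
  (if e.2 then (c - e.1.1, e.1.2) else (c - e.1.1 - 1, e.1.2), e.2).
(** With faces named by points of the square lattice, [dualv e] is the primal edge crossed by the
    step [e] between two faces. *)
Definition dualv (e : pe) : pe := (if e.2 then (e.1.1, e.1.2 + 1) else (e.1.1 + 1, e.1.2), ~~ e.2).
Definition duale (e : pe) : pe := (if e.2 then (e.1.1 - 1, e.1.2) else (e.1.1, e.1.2 - 1), ~~ e.2).

Lemma shifteK a b : cancel (shifte a b) (shifte (- a) (- b)).
Proof. by case=> -[x y] t; rewrite /shifte /shiftv /= !addrK. Qed.
Lemma shifteNK a b : cancel (shifte (- a) (- b)) (shifte a b).
Proof. by case=> -[x y] t; rewrite /shifte /shiftv /= !subrK. Qed.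
Lemma swapeK : involutive swape.
Proof. by case=> -[x y] t; rewrite /swape /swapv /= negbK. Qed.
Lemma refleK c : involutive (refle c).
Proof. by case=> -[x y] []; rewrite /refle /=; congr ((_, _), _); lia. Qed.
Lemma dualvK : cancel dualv duale.
Proof. by case=> -[x y] []; rewrite /duale /dualv /= addrK. Qed.
Lemma dualeK : cancel duale dualv.
Proof. by case=> -[x y] []; rewrite /duale /dualv /= subrK. Qed.

Lemma conn_shiftp a b w B u v : conn pends (w \o shifte a b) B u v <->
  conn pends w [set q | B (shiftv (- a) (- b) q)]%classic (shiftv a b u) (shiftv a b v).
Proof.
apply: conn_iso (@shifteNK a b) _ _ _ _ _ _ => [[x y]|e s t|e s t].
- by rewrite /shiftv /= !addrK.
- by case: e => -[x y] [] [] [<- <-]; [left|right|left|right]; rewrite /pends /shiftv /=; congr ((_, _), (_, _)); lia.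
- by case: e => -[x y] [] [] [<- <-]; [left|right|left|right]; rewrite /pends /shiftv /=; congr ((_, _), (_, _)); lia.
Qed.

Lemma swap_joins e s t : joins pends e s t -> joins pends (swape e) (swapv s) (swapv t).
Proof. by case: e => -[x y] [] [] [<- <-]; [left|right|left|right]. Qed.

Lemma conn_swap w B u v : conn pends (w \o swape) B u v <->
  conn pends w [set q | B (swapv q)]%classic (swapv u) (swapv v).
Proof.
by apply: conn_iso swapeK _ _ _ _ _ _ => [[x y]|e s t|e s t] //; exact: swap_joins.
Qed.

Lemma refl_joins c e s t : joins pends e s t -> joins pends (refle c e) (reflv c s) (reflv c t).
Proof.
by case: e => -[x y] [] [] [<- <-]; [left|right|right|left]; rewrite /pends /reflv /=;
  congr ((_, _), (_, _)); lia.
Qed.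

Lemma conn_refl_x c w B u v : conn pends (w \o refle c) B u v <->
  conn pends w [set q | B (reflv c q)]%classic (reflv c u) (reflv c v).
Proof.
apply: conn_iso (@refleK c) _ _ _ _ _ _ => [[x y]|e s t|e s t]; try exact: refl_joins.
by rewrite /reflv /=; congr (_, _); lia.
Qed.

Lemma conn_dual w B u v : conn pends (w \o dualv) B u v <-> conn dends w B u v.
Proof.
apply: (@conn_iso _ _ _ _ pends dends id id dualv duale) => // [|e s t|e s t]; first exact: dualeK.
  by case: e => -[x y] [] [] [<- <-]; [left|right|left|right]; rewrite /dends /dualv /= ?addrK.
by case: e => -[x y] [] [] [<- <-]; [left|right|left|right]; rewrite /pends /duale /= ?subrK.
Qed.

Lemma increasing_Hcross (x0 x1 y0 y1 : int) : increasing_event (Hcross x0 x1 y0 y1).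
Proof.
by move=> w w' ww' [u [v [ux vx uv]]]; exists u, v; split => //; exact: increasing_conn uv.
Qed.

Lemma increasing_Vcross (x0 x1 y0 y1 : int) : increasing_event (Vcross x0 x1 y0 y1).
Proof.
by move=> w w' ww' [u [v [ux vx uv]]]; exists u, v; split => //; exact: increasing_conn uv.
Qed.

Lemma Rect_edges (x0 x1 y0 y1 : int) :
  exists s : seq pe, (inside pends (Rect x0 x1 y0 y1) `<=` [set` s])%classic.
Proof.
pose qs := [seq (x0 + i%:Z, y0 + j%:Z) | i <- iota 0 (absz (x1 - x0)).+1,
                                         j <- iota 0 (absz (y1 - y0)).+1].
exists ([seq (q, true) | q <- qs] ++ [seq (q, false) | q <- qs]).
move=> [[x y] b] [[/= hx hy] _].
have q : (x, y) \in qs.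
  apply/allpairsP; exists (absz (x - x0), absz (y - y0)); rewrite !mem_iota /=.
  by split; [lia|lia|congr (_, _); lia].
suff : ((x, y), b) \in [seq (q, true) | q <- qs] ++ [seq (q, false) | q <- qs] by [].
by rewrite mem_cat; case: b; apply/orP; [left|right]; exact: map_f.
Qed.

Lemma dep_Rect (T : Type) (x0 x1 y0 y1 : int) (f : (pe -> bool) -> T) :
  dep (inside pends (Rect x0 x1 y0 y1)) f -> exists s : seq pe, dep [set` s]%classic f.
Proof. by move=> df; have [s sR] := Rect_edges x0 x1 y0 y1; exists s; exact: dep_sub df. Qed.

Lemma dep_Hcross (x0 x1 y0 y1 : int) :
  dep (inside pends (Rect x0 x1 y0 y1)) (Hcross x0 x1 y0 y1).
Proof.
move=> w w' ww'; apply/propext; split => -[u [v [ux vx uv]]]; exists u, v; split => //.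
  by rewrite -(conn_dep _ _ ww').
by rewrite (conn_dep _ _ ww').
Qed.

Lemma local_Hcross (x0 x1 y0 y1 : int) : local (Hcross x0 x1 y0 y1).
Proof. exact: dep_Rect (@dep_Hcross _ _ _ _). Qed.

Lemma swap_cross (x0 x1 y0 y1 : int) w : Hcross y0 y1 x0 x1 (w \o swape) <-> Vcross x0 x1 y0 y1 w.
Proof.
have RE : [set q | Rect y0 y1 x0 x1 (swapv q)]%classic = Rect x0 x1 y0 y1.
  by apply/funext => q; apply/propext; rewrite /Rect /=; tauto.
split => -[u [v [ux vx uv]]]; exists (swapv u), (swapv v); split => //.
  by rewrite -RE; apply/conn_swap.
by apply/conn_swap; rewrite RE; case: u v uv {ux vx} => [? ?] [? ?].
Qed.

Lemma local_Vcross (x0 x1 y0 y1 : int) : local (Vcross x0 x1 y0 y1).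
Proof.
have -> : Vcross x0 x1 y0 y1 = (fun w => Hcross y0 y1 x0 x1 (w \o swape)).
  by apply/funext => w; apply/propext; rewrite swap_cross.
exact: local_transfer (local_Hcross _ _ _ _).
Qed.

Section Prob.
Variables (R : realType) (p : R).

Lemma Pr_Vcross (x0 x1 y0 y1 : int) : Pr p (Vcross x0 x1 y0 y1) = Pr p (Hcross y0 y1 x0 x1).
Proof.
rewrite -(Pr_transfer p (inv_inj swapeK) (local_Hcross y0 y1 x0 x1)); congr Pr.
by apply/funext => w; apply/propext; rewrite swap_cross.
Qed.

Lemma Pr_Hcross_shift (a b x0 x1 y0 y1 : int) :
  Pr p (Hcross (x0 + a) (x1 + a) (y0 + b) (y1 + b)) = Pr p (Hcross x0 x1 y0 y1).
Proof.
rewrite -(Pr_transfer p (can_inj (@shifteK a b)) (local_Hcross x0 x1 y0 y1)); congr Pr.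
apply/funext => w; apply/propext.
have RE : [set q | Rect x0 x1 y0 y1 (shiftv (- a) (- b) q)]%classic =
    Rect (x0 + a) (x1 + a) (y0 + b) (y1 + b).
  by apply/funext => q; apply/propext; rewrite /Rect /shiftv /=; split; lia.
split => -[u [v [ux vx uv]]].
  exists (shiftv (- a) (- b) u), (shiftv (- a) (- b) v); split.
  - by rewrite /shiftv /= ux addrK.
  - by rewrite /shiftv /= vx addrK.
  - by apply/conn_shiftp; rewrite RE /shiftv /= !subrK; case: u v uv {ux vx} => [? ?] [? ?].
exists (shiftv a b u), (shiftv a b v); split; rewrite ?[LHS]/= ?ux ?vx //.
by rewrite -RE; apply/conn_shiftp.
Qed.

Lemma Pr_Vcross_shift (a b x0 x1 y0 y1 : int) :
  Pr p (Vcross (x0 + a) (x1 + a) (y0 + b) (y1 + b)) = Pr p (Vcross x0 x1 y0 y1).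
Proof. by rewrite !Pr_Vcross Pr_Hcross_shift. Qed.

(** By [Hcross_dual] and [crossing_exclusive], exactly one of an open left-right crossing and a
    closed bottom-top crossing of faces occurs; closed edges at [p] have the law of open edges at
    [1 - p]. *)
Lemma Pr_dual_cross (x0 x1 y0 y1 : int) : 0 <= p <= 1 -> x0 < x1 -> y0 <= y1 ->
  1 - Pr p (Hcross x0 x1 y0 y1) = Pr (1 - p) (Vcross x0 (x1 - 1) (y0 - 1) y1).
Proof.
move=> p01 x01 y01; have lV := local_Vcross x0 (x1 - 1) (y0 - 1) y1.
have lV' := local_transfer dualv lV.
rewrite -(Pr_transfer (1 - p) (can_inj dualvK) lV) (Pr_flip p lV').
rewrite -(Pr_not p (local_Hcross x0 x1 y0 y1)); congr Pr; apply/funext => w; apply/propext.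
split=> [/(Hcross_dual x01 y01) [f [g [f2 g2 fg]]]|[f [g [f2 g2 /conn_dual fg]]] [u [v [ux vx uv]]]].
  by exists f, g; split => //; apply/conn_dual.
apply: (crossing_exclusive uv ux vx x01 fg); try lia.
by move=> h; rewrite /Rect /=; lia.
Qed.

End Prob.

(** The dual of an (n+1) by n rectangle is a rotated translate of itself, so at p = 1/2 the two
    probabilities in [Pr_dual_cross] coincide and add up to 1. *)
Lemma Hcross_half (R : realType) (n : nat) : 1 / 2 <= Pr (1 / 2 : R) (Hcross 0 n.+1%:Z 0 n%:Z).
Proof.
have := @Pr_dual_cross R (1 / 2) 0 n.+1%:Z 0 n%:Z ltac:(lra) ltac:(lia) ltac:(lia).
rewrite Pr_Vcross -(@Pr_Hcross_shift R _ 1 0 (0 - 1) n%:Z).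
rewrite subrK addr0 (_ : n%:Z + 1 = n.+1%:Z); last lia.
rewrite (_ : n.+1%:Z - 1 + 0 = n%:Z); last lia.
rewrite (_ : 1 - 1 / 2 = 1 / 2 :> R); lra.
Qed.

Lemma Hcross_narrow (x0 x1 x1' y0 y1 : int) w : x0 <= x1' -> x1' <= x1 ->
  Hcross x0 x1 y0 y1 w -> Hcross x0 x1' y0 y1 w.
Proof.
move=> h0; rewrite le_eqVlt => /orP[/eqP -> //|h1] [u [v [ux vx uv]]].
have Ru := conn_src uv.
have [E|ne] := eqVneq x0 x1'.
  exists u, u; split => //; first by rewrite -E.
  by apply: conn_refl; move: Ru; rewrite /Rect /=; lia.
have [||a [b [e [ua we ab Rb nb]]]] := conn_exit (D := [set q : pv | (q.1 : int) < x1']%classic) uv.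
- by rewrite /= ux; lia.
- by rewrite /= vx; lia.
have [Ra Da] := conn_tgt ua.
have bx : b.1 = x1'.
  by move: Da nb; case: e we ab => -[x y] [] we => [/pjoins_v|/pjoins_h] [] [-> ->] /=; lia.
exists u, b; split => //; apply: conn_step (we) (ab) _.
  apply: conn_subset ua => q [Rq Dq]; move: Rq Dq; rewrite /Rect /=; lia.
by move: Rb; rewrite /Rect /= bx; lia.
Qed.

End PlanarSymmetries.

(* The lowest open horizontal crossing of [0, a] x [0, b] is the interface between the dual
   closed cluster [low] of the bottom and the component [high] of the top in its complement. *)
Section LowestCrossing.
Variables (a b : nat).
Hypothesis a0 : (0 < a)%N.
Implicit Types (w : pe -> bool).

Let S : set pv := Rect 0 a%:Z 0 b%:Z.
Let FS : set pv := Rect 0 (a%:Z - 1) (- 1) b%:Z.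

Definition low w : set pv := cluster dends FS [set f : pv | f.2 = - 1 :> int]%classic (fun e => ~~ w e).
Definition high w : set pv :=
  cluster dends (FS `\` low w)%classic [set f : pv | f.2 = b%:Z :> int]%classic (fun=> true).
(** Colouring by [high] and not by [low] fills the pockets that [low] encloses, which leaves a
    single separating curve. *)
Definition interface w : pe -> bool := cut 0 a%:Z (fun f => `[< ~ high w f >]).

Lemma low_high w f : low w f -> high w f -> False.
Proof. by move=> lf hf; have [_ nl] := cluster_sub hf; exact: nl. Qed.

Lemma face_FS e : inside pends S e -> 0 <= ((dends e).1.1 : int) < a%:Z ->
  0 <= ((dends e).2.1 : int) < a%:Z -> FS (dends e).1 /\ FS (dends e).2.
Proof.
case: e => -[x y] [] [] /=; rewrite /S /FS /Rect /=; lia.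
Qed.

Lemma low_bottom w f : FS f -> f.2 = - 1 :> int -> low w f.
Proof. by move=> Ff f2; exists f; split => //; exact: conn_refl. Qed.

(** A face beside a high one is high itself unless it is low, and a closed edge would extend [low]
    across it. *)
Lemma interface_faces w e : inside pends S e -> interface w e ->
  w e /\ exists f g, [/\ joins dends e f g, low w f & high w g].
Proof.
move=> Se /and3P[c1 c2 cc]; have [F1 F2] := face_FS Se c1 c2.
have aux f g : joins dends e f g -> FS f -> FS g -> ~ high w f -> high w g ->
    w e /\ exists f g, [/\ joins dends e f g, low w f & high w g].
  move=> fg Ff Fg nf hg.
  have lf : low w f.
    apply: contrapT => nlf; apply: nf; case: hg => t [t2 tg]; exists t; split => //.
    exact: conn_step tg isT (joins_sym fg) _.
  split; last by exists f, g.
  apply: contraT => nwe; exfalso; apply: (@low_high w g) => //.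
  by case: lf => s [s2 sf]; exists s; split => //; exact: conn_step sf nwe fg Fg.
move: cc; case: asboolP => n1; case: asboolP => n2 //= _.
  by apply: (aux _ _ (joins_ends _ _)) => //; exact: contrapT.
by apply: (aux _ _ (joins_sym (joins_ends _ _))) => //; exact: contrapT.
Qed.

Section Crossed.
Variable w : pe -> bool.
Hypothesis Hw : Hcross 0 a%:Z 0 b%:Z w.

Lemma low_not_top f : low w f -> f.2 = b%:Z :> int -> False.
Proof.
move=> [s [s2 sf]] f2; have [u [v [ux vx uv]]] := Hw.
apply: (crossing_exclusive uv ux vx _ sf).
- by rewrite ltz_nat.
- by move=> h; rewrite /FS /Rect /=; lia.
- by move: s2 => /= ->.
- by rewrite f2.
- by move=> e ->.
Qed.

Lemma high_top f : FS f -> f.2 = b%:Z :> int -> high w f.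
Proof.
move=> Ff f2; exists f; split => //; apply: conn_refl; split => // lf; exact: low_not_top lf f2.
Qed.

Lemma interface_Hcross : Hcross 0 a%:Z 0 b%:Z (interface w).
Proof.
apply: cut_crossing => [||x xa|x xa]; try lia.
  apply/asboolP => h; apply: low_high h; apply: low_bottom => //=.
  by rewrite /FS /Rect /=; lia.
apply/asboolP; apply; apply: high_top => //=; rewrite /FS /Rect /=; lia.
Qed.

(** Every edge of the lowest crossing is pivotal for it: a dual path through [low], then across
    [e0], then through [high] joins bottom to top without meeting another interface edge. *)
Lemma interface_pivotal e0 : inside pends S e0 -> interface w e0 ->
  ~ Hcross 0 a%:Z 0 b%:Z (fun e => interface w e && (e != e0)).
Proof.
move=> Se0 ie0 [u [v [ux vx uv]]].
have [_ [f [g [fg lf hg]]]] := interface_faces Se0 ie0.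
have [s [s2 sf]] := lf; have [t [t2 tg]] := hg.
pose w' e := ~~ (interface w e && (e != e0)).
have Ff := cluster_sub lf; have [Fg _] := cluster_sub hg.
have same h h' e : joins dends e h h' -> (high w h <-> high w h') -> w' e.
  move=> hh' E; rewrite /w' /interface /cut.
  have -> : `[< ~ high w (dends e).1 >] = `[< ~ high w (dends e).2 >].
    by apply/asboolP/asboolP; case: hh' => -> /=; tauto.
  by rewrite eqxx !andbF.
have low_conn : conn dends w' FS s f.
  elim: sf {fg lf} => [Fs|h h' e sh IH we hh' Fh']; first exact: conn_refl.
  apply: (conn_step IH _ hh' Fh'); apply: (same _ _ _ hh').
  have lh : low w h by exists s.
  have lh' : low w h' by exists s; split => //; exact: conn_step sh we hh' Fh'.
  by split=> [/(low_high lh)|/(low_high lh')].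
have high_conn : conn dends w' FS t g.
  elim: tg {fg hg Fg} => [[Ft _]|h h' e th IH we hh' Fh']; first exact: conn_refl.
  apply: (conn_step IH _ hh' Fh'.1); apply: (same _ _ _ hh').
  have hh : high w h by exists t.
  have hh2 : high w h' by exists t; split => //; exact: conn_step th we hh' Fh'.
  by [].
have st : conn dends w' FS s t.
  apply: conn_trans (conn_sym high_conn); apply: conn_step low_conn _ fg Fg.
  by rewrite /w' eqxx andbF.
apply: (crossing_exclusive uv ux vx _ st).
- by rewrite ltz_nat.
- by move=> h; rewrite /FS /Rect /=; lia.
- by move: s2 => /= ->.
- by move: t2 => /= ->.
- by move=> e ie; rewrite /w' ie.
Qed.

Lemma interface_split e0 : inside pends S e0 -> interface w e0 ->
  let w0 e := interface w e && (e != e0) in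
  exists l r u v, [/\ l.1 = 0, r.1 = a%:Z, joins pends e0 u v, conn pends w0 S l u & conn pends w0 S v r].
Proof.
move=> Se0 ie0 w0; have [l [r [lx rx lr]]] := interface_Hcross.
case: (conn_use e0 lr) => [lr0|[u [v [uv lu vr]]]]; last by exists l, r, u, v.
by exfalso; apply: (interface_pivotal Se0 ie0); exists l, r.
Qed.

Definition interface_vertex q := exists e u, [/\ interface w e, inside pends S e & joins pends e q u].

Lemma interface_vertex_cross q : interface_vertex q ->
  exists l r, [/\ l.1 = 0, r.1 = a%:Z, conn pends (interface w) S q l & conn pends (interface w) S q r].
Proof.
move=> [e [q' [ie Se qq']]].
have [l [r [u [v [lx rx uv lu vr]]]]] := interface_split Se ie.
have qE : q = u \/ q = v.
  by move: uv qq'; rewrite /joins => -[] -> [] [-> ->]; [left|right|right|left].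
exists l, r; split => //.
  have {}lu : conn pends (interface w) S l u by apply: conn_mono lu => // f _ /andP[].
  have {}vr : conn pends (interface w) S v r by apply: conn_mono vr => // f _ /andP[].
  have vl := conn_trans (conn_edge ie (joins_sym uv) (conn_src vr) (conn_tgt lu)) (conn_sym lu).
  by case: qE => ->; [exact: conn_sym|].
have {}lu : conn pends (interface w) S l u by apply: conn_mono lu => // f _ /andP[].
have {}vr : conn pends (interface w) S v r by apply: conn_mono vr => // f _ /andP[].
have ur := conn_trans (conn_edge ie uv (conn_tgt lu) (conn_src vr)) vr.
by case: qE => ->.
Qed.

End Crossed.

Lemma interface_touched w e : inside pends S e -> interface w e ->
  touched dends FS [set f : pv | f.2 = - 1 :> int]%classic (fun e => ~~ w e) e.
Proof.
move=> Se ie; have [c1 c2] : 0 <= ((dends e).1.1 : int) < a%:Z /\ 0 <= ((dends e).2.1 : int) < a%:Z.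
  by case/and3P: ie.
have [F1 F2] := face_FS Se c1 c2.
have [_ [f [g [fg lf hg]]]] := interface_faces Se ie.
by apply/asboolP; split => //; case: fg => -> /=; [left|right].
Qed.

End LowestCrossing.

(** * Russo--Seymour--Welsh estimate *)

(* Extension of a horizontal crossing of S = [0, n]^2 to the top of [0, 2n] x [0, m]: given the
   lowest crossing of S, reflect it in x = n; a vertical crossing of the long rectangle must
   hit the lowest crossing or its reflection from above, with equal probabilities. *)
Section Extension.
Variables (n m : nat).
Hypotheses (n0 : (0 < n)%N) (nm : (n <= m)%N).
Implicit Types (w : pe -> bool) (f g q v : pv).

Let S : set pv := Rect 0 n%:Z 0 n%:Z.
Let FS : set pv := Rect 0 (n%:Z - 1) (- 1) n%:Z.
Let RR : set pv := Rect 0 n.*2%:Z 0 m%:Z.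

Definition extended w : Prop := exists q l r t, [/\ l.1 = 0, r.1 = n%:Z, t.2 = m%:Z &
  [/\ conn pends w S q l, conn pends w S q r & conn pends w RR q t]].

Definition explored w : pe -> bool :=
  touched dends FS [set f : pv | f.2 = - 1 :> int]%classic (fun e => ~~ w e).

(** Only edges unexplored in [w] count, so that the connection survives in
    [mix (explored w) w w']. *)
Definition upper w w' : Prop := exists q, interface_vertex n n w q /\
  exists t, t.2 = m%:Z /\ conn pends (fun e => w' e && ~~ explored w e) RR q t.

Lemma explored_stopping w w' : (forall e, explored w e -> w e = w' e) -> explored w' = explored w.
Proof. by move=> ww'; apply: touched_stopping => e We; rewrite ww'. Qed.

Section Given.
Variable w : pe -> bool.
Hypothesis Hw : Hcross 0 n%:Z 0 n%:Z w.

Let N2 : int := n.*2%:Z.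
Let fold f : pv := if (f.1 : int) < n%:Z then f else (N2 - 1 - f.1, f.2).
(** The faces above the curve formed by the lowest crossing and its mirror image. The condition on
    the row covers the faces above the square, which are outside the domain of [high]. *)
Let above f : Prop := n%:Z <= (f.2 : int) \/ high n n w (fold f).
Let col f : Prop := 0 <= (f.1 : int) < N2.
Let nice q : Prop := interface_vertex n n w q \/ interface_vertex n n w (reflv N2 q).

Lemma high_row f : high n n w f -> 0 <= (f.2 : int).
Proof.
move=> hf; rewrite leNgt; apply/negP => f2.
have [Ff nl] := cluster_sub hf; apply: nl; apply: low_bottom => //.
by move: Ff f2; rewrite /Rect /=; lia.
Qed.

Lemma above_high f : above f -> col f -> (f.2 : int) <= n%:Z -> high n n w (fold f).
Proof.
case=> // f2 cf f2'; apply: (high_top n0 Hw); last by rewrite /fold; case: ifP => _ /=; lia.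
by move: cf; rewrite /fold /Rect /col /N2; case: ifP => /=; lia.
Qed.

(** [above] is defined through [fold], so its changes are changes of [high] in the left half or in
    its reflection, that is, interface edges or their mirror images. *)
Lemma adjacent_faces e f g : joins dends e f g -> col f -> col g -> above f -> ~ above g ->
  (inside pends S e /\ interface n n w e) \/
  (inside pends S (refle N2 e) /\ interface n n w (refle N2 e)).
Proof.
move=> fg cf cg af ag.
have g2 : (g.2 : int) < n%:Z by rewrite ltNge; apply/negP => h; apply: ag; left.
have ng : ~ high n n w (fold g) by move=> h; apply: ag; right.
have f2 : (f.2 : int) <= n%:Z.
  by move: fg g2; case: e => -[x y] [] [] [] <- <- /=; lia.
have hf := above_high af cf f2.
have hrow := high_row hf; have {}hrow : 0 <= (f.2 : int) by move: hrow; rewrite /fold; case: ifP.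
have key e' f' g' : joins dends e' f' g' -> f' = fold f -> g' = fold g ->
    0 <= (f'.1 : int) < n%:Z -> 0 <= (g'.1 : int) < n%:Z -> interface n n w e'.
  move=> fg' fE gE c1 c2; rewrite -fE in hf; rewrite -gE in ng; rewrite /interface /cut.
  have hF : `[< ~ high n n w f' >] = false by apply/asboolPn; apply.
  by case: fg' => -> /=; rewrite c1 c2 hF asboolT.
have colE h : col h -> 0 <= ((fold h).1 : int) < n%:Z.
  by rewrite /col /fold /N2; case: ifP => /=; lia.
have [lt|ge] := ltP (e.1.1 : int) n%:Z.
  have [fE gE] : fold f = f /\ fold g = g.
    rewrite /fold; have [h1 h2] : (f.1 : int) < n%:Z /\ (g.1 : int) < n%:Z.
      by move: fg lt; case: e => -[x y] [] [] [] <- <- /=; lia.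
    by rewrite h1 h2.
  have cf' := colE _ cf; have cg' := colE _ cg; rewrite fE in cf'; rewrite gE in cg'.
  left; split; last by apply: (key _ f g).
  move: fg cf cg g2 hrow lt; case: e => -[x y] [] [] [] <- <-;
    rewrite /inside /S /Rect /col /N2 /=; lia.
case: e fg ge => -[x y] [] fg ge; last first.
  right; split.
    move: fg cf cg g2 hrow ge; case=> -[<- <-];
      rewrite /inside /S /Rect /refle /col /N2 /=; lia.
  have [h1 h2] : ((f.1 : int) < n%:Z) = false /\ ((g.1 : int) < n%:Z) = false.
    by move: fg ge; case=> -[<- <-] /=; lia.
  apply: (key _ (fold f) (fold g)) => //; try exact: colE.
  rewrite /fold h1 h2; case: fg => -[<- <-]; [left|right];
    rewrite /dends /refle /N2 /=; congr ((_, _), (_, _)); lia.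
(* An edge on the axis x = n separates two mirror faces, which [fold] identifies. *)
have [xn|xn] := eqVneq x n%:Z.
  exfalso; apply: ng; suff -> : fold g = fold f by [].
  by case: fg => -[<- <-]; rewrite /fold /N2 xn ltxx (_ : n%:Z - 1 < n%:Z) /=; try lia; congr (_, _); lia.
have [h1 h2] : ((f.1 : int) < n%:Z) = false /\ ((g.1 : int) < n%:Z) = false.
  by move: fg ge xn; case=> -[<- <-] /=; lia.
right; split.
  move: fg cf cg g2 hrow ge; case=> -[<- <-];
    rewrite /inside /S /Rect /refle /col /N2 /=; lia.
apply: (key _ (fold f) (fold g)) => //; try exact: colE.
rewrite /fold h1 h2; case: fg => -[<- <-]; [right|left];
  rewrite /dends /refle /N2 /=; congr ((_, _), (_, _)); lia.
Qed.

Let around v f : Prop := [/\ f.1 = v.1 :> int \/ f.1 = v.1 - 1 :> int & f.2 = v.2 :> int \/ f.2 = v.2 - 1 :> int].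

(** Two faces around [v] are joined by crossing at most one horizontal and one vertical edge at [v];
    by [adjacent_faces] a change of [above] would make [v] a vertex of one of the two curves. *)
Lemma above_uniform v f g : ~ nice v -> around v f -> around v g -> col f -> col g ->
  above f -> above g.
Proof.
move=> nv; have adj e h h' v' : joins pends e v v' -> joins dends e h h' -> col h -> col h' ->
    above h -> above h'.
  move=> vv' hh' ch ch' ah; apply: contrapT => ah'; apply: nv.
  have [[Se ie]|[Se ie]] := adjacent_faces hh' ch ch' ah ah'.
    by left; exists e, v'.
  by right; exists (refle N2 e), (reflv N2 v'); split => //; exact: refl_joins.
case: v f g adj {nv} => x y [fx fy] [gx gy] adj [/= f1 f2] [/= g1 g2] cf cg af.
have a1 : above (fx, gy).
  have [E|ne] := eqVneq fy gy; first by rewrite -E.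
  have cE : col (fx, gy) by [].
  have jh : joins dends ((fx, y), false) (fx, fy) (fx, gy).
    rewrite /joins /dends /=.
    by case: f2 g2 ne => -> [] -> ne; rewrite ?eqxx in ne *; auto.
  case: f1 => E1; [apply: (adj _ _ _ (x + 1, y)) jh cf cE af|apply: (adj _ _ _ (x - 1, y)) jh cf cE af].
    by left; rewrite /pends /= E1.
  by right; rewrite /pends /= E1 subrK.
have [E|ne] := eqVneq fx gx; first by rewrite -E.
have jv : joins dends ((x, gy), true) (fx, gy) (gx, gy).
  rewrite /joins /dends /=.
  by case: f1 g1 ne => -> [] -> ne; rewrite ?eqxx in ne *; auto.
case: g2 => E2; [apply: (adj _ _ _ (x, y + 1)) jv cf cg a1|apply: (adj _ _ _ (x, y - 1)) jv cf cg a1].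
  by left; rewrite /pends /= E2.
by right; rewrite /pends /= E2 subrK.
Qed.

(** An explored edge borders a low face, this face is one of those around [v], and a low face is
    never above. *)
Lemma above_not_explored v v' e : joins pends e v v' -> RR v -> RR v' ->
  (forall f, around v f -> col f -> above f) -> explored w e = false.
Proof.
move=> vv' Rv Rv' Kv; apply/negbTE/negP => /asboolP[[F1 F2] L].
have [f [Ff [lf ef]]] : exists f, FS f /\ low n n w f /\ (f = (dends e).1 \/ f = (dends e).2).
  by case: L => lf; [exists (dends e).1|exists (dends e).2]; split => //; split => //; [left|right].
have cf : col f by move: Ff; rewrite /FS /Rect /col /N2 /=; lia.
have af : around v f.
  rewrite /around; move: vv'.
  by case: e ef {F1 F2 L} => -[x y] [] [] -> /= [] [E E']; rewrite -?E -?E' /=; split; lia.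
have f2 : (f.2 : int) <= n%:Z by move: Ff; rewrite /FS /Rect /=; lia.
have := above_high (Kv f af cf) cf f2; rewrite /fold (_ : (f.1 : int) < n%:Z).
  exact: low_high lf.
by move: Ff; rewrite /FS /Rect /=; lia.
Qed.

Lemma above_not_explored_refl v v' e : joins pends e v v' -> RR v -> RR v' ->
  (forall f, around v f -> col f -> above f) -> explored w (refle N2 e) = false.
Proof.
move=> vv' Rv Rv' Kv; apply/negbTE/negP => /asboolP[[F1 F2] L].
pose mir f : pv := (N2 - 1 - f.1, f.2).
have [f [Ff [lf ef]]] : exists f, FS f /\ low n n w f /\
    (f = (dends (refle N2 e)).1 \/ f = (dends (refle N2 e)).2).
  by case: L => lf; [exists (dends (refle N2 e)).1|exists (dends (refle N2 e)).2];
    split => //; split => //; [left|right].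
have cf : col (mir f) by move: Ff; rewrite /mir /FS /Rect /col /N2 /=; lia.
have af : around v (mir f).
  rewrite /around /mir; move: vv'.
  by case: e ef {F1 F2 L} => -[x y] [] [] -> /= [] [E E']; rewrite -?E -?E' /=; split; lia.
have f2 : ((mir f).2 : int) <= n%:Z by move: Ff; rewrite /FS /Rect /=; lia.
have := above_high (Kv _ af cf) cf f2.
have -> : fold (mir f) = f.
  rewrite /fold /mir /= ifF; last by move: Ff; rewrite /FS /Rect /N2 /=; lia.
  by case: (f) => p q /=; congr (_, _); lia.
exact: low_high lf.
Qed.

(** Follow the crossing downwards. As long as it meets neither curve, the faces around the current
    vertex are all above, so the edges used are unexplored. The faces of row -1 are not above, so a
    curve is met before the bottom is passed. *)
Lemma vertical_crossing_hits w' : Vcross 0 n.*2%:Z 0 m%:Z w' ->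
  upper w w' \/ upper w (w' \o refle N2).
Proof.
move=> [b [t [b2 t2 bt]]]; have tb := conn_sym bt.
(* An edge and its mirror image must both be unexplored, since the vertex met may belong to either
   curve. *)
pose w0 e := [&& w' e, ~~ explored w e & ~~ explored w (refle N2 e)].
pose K v := forall f, around v f -> col f -> above f.
have claim v : conn pends w' RR t v ->
    (exists q, nice q /\ conn pends w0 RR t q) \/ (K v /\ conn pends w0 RR t v).
  elim=> [Rt|v1 v2 e _ IH we vv Rv2].
    have [nt|nt] := pselect (nice t); first by left; exists t; split => //; exact: conn_refl.
    right; split; last exact: conn_refl.
    have [f [af cf f2]] : exists f, [/\ around t f, col f & f.2 = m%:Z :> int].
      have [lt|ge] := ltP (t.1 : int) N2.
        exists t; split => //; first by split; left.
        by move: Rt; rewrite /RR /Rect /col /N2 /=; lia.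
      exists (t.1 - 1, t.2); split => //; first by split; [right|left].
      by move: Rt ge; rewrite /RR /Rect /col /N2 /=; lia.
    move=> g ag cg; apply: (above_uniform nt af ag cf cg); left; rewrite f2; lia.
  case: IH => [|[Kv tv]]; first by left.
  have Rv1 := conn_tgt tv.
  have w0e : w0 e.
    by rewrite /w0 we (above_not_explored vv Rv1 Rv2 Kv) (above_not_explored_refl vv Rv1 Rv2 Kv).
  have tv2 := conn_step tv w0e vv Rv2.
  have [nv2|nv2] := pselect (nice v2); first by left; exists v2.
  right; split => // g ag cg.
  have [f [a1 a2 cf]] : exists f, [/\ around v1 f, around v2 f & col f].
    move: Rv1 Rv2; case: e vv {w0e we} => -[x y] [] vv Rv1 Rv2; last first.
      exists (x, y); rewrite /around /col; case: vv Rv1 Rv2 => -[<- <-];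
        rewrite /RR /Rect /N2 /= => R1 R2; split; try split; lia.
    have [lt|ge] := ltP x N2.
      exists (x, y); rewrite /around /col; case: vv Rv1 Rv2 => -[<- <-];
        rewrite /RR /Rect /N2 /= => R1 R2; split; try split; lia.
    exists (x - 1, y); rewrite /around /col; move: ge; case: vv Rv1 Rv2 => -[<- <-];
      rewrite /RR /Rect /N2 /= => R1 R2 ge; split; try split; lia.
  exact: (above_uniform nv2 a2 ag cf cg (Kv _ a1 cf)).
case: (claim _ tb) => [[q [nq tq]]|[Kb _]]; last first.
  have Rb := conn_tgt tb.
  have [f [af cf f2]] : exists f, [/\ around b f, col f & f.2 = - 1 :> int].
    have [lt|ge] := ltP (b.1 : int) N2.
      exists (b.1, b.2 - 1); split; [by split; [left|right]| |by rewrite /= b2].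
      by move: Rb lt; rewrite /RR /Rect /col /N2 /=; lia.
    exists (b.1 - 1, b.2 - 1); split; [by split; right| |by rewrite /= b2].
    by move: Rb ge; rewrite /RR /Rect /col /N2 /=; lia.
  exfalso; have := high_row (above_high (Kb f af cf) cf ltac:(rewrite f2; lia)).
  by rewrite /fold; case: ifP => _ /=; rewrite f2.
case: nq => nq; [left; exists q|right; exists (reflv N2 q)]; split => //.
  exists t; split => //; apply: conn_mono (conn_sym tq) => // e _.
  by case/and3P => -> ->.
exists (reflv N2 t); split => //.
have -> : RR = [set h | RR (reflv N2 h)]%classic.
  by apply/funext => h; apply/propext; rewrite /RR /Rect /reflv /N2 /=; split; lia.
have -> : (fun e => (w' \o refle N2) e && ~~ explored w e) =
    (fun e => w' e && ~~ explored w (refle N2 e)) \o refle N2.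
  by apply/funext => e; rewrite /= refleK.
apply/conn_refl_x.
have K2 h : reflv N2 (reflv N2 h) = h by case: (h) => x y; rewrite /reflv /=; congr (_, _); lia.
rewrite !K2; apply: conn_mono (conn_sym tq) => [h|e _ /and3P[-> _ ->] //].
by rewrite /= K2.
Qed.

Lemma upper_extended w' : upper w w' -> extended (mix (explored w) w w').
Proof.
move=> [q [iq [t [t2 qt]]]].
have [l [r [lx rx ql qr]]] := interface_vertex_cross n0 Hw iq.
have sub z : conn pends (interface n n w) S q z -> conn pends (mix (explored w) w w') S q z.
  apply: conn_mono => // e Se ie; rewrite /mix /explored (interface_touched n0 Se ie).
  by have [] := interface_faces n0 Se ie.
exists q, l, r, t; split => //; split; [exact: sub|exact: sub|].
by apply: conn_mono qt => // e _ /andP[we nW]; rewrite /mix (negbTE nW).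
Qed.

Lemma dep_upper : dep (inside pends RR) (upper w).
Proof.
apply: dep_exists => q; apply: dep_exists => t.
move=> w1 w2 w12; apply/propext; split; apply: conn_mono => // e Re /andP[we ->].
  by rewrite andbT -w12.
by rewrite andbT w12.
Qed.

Lemma local_upper : local (upper w).
Proof. exact: dep_Rect dep_upper. Qed.

Lemma Pr_upper (R : realType) (p : R) : 0 <= p <= 1 ->
  Pr p (Vcross 0 n.*2%:Z 0 m%:Z) / 2 <= Pr p (upper w).
Proof.
move=> p01; have lU := local_upper.
have lU' := local_transfer (refle N2) lU.
have := Pr_le p01 (local_Vcross _ _ _ _) (local_or lU lU') vertical_crossing_hits.
have := Pr_or p01 lU lU'; rewrite (Pr_transfer p (inv_inj (@refleK N2)) lU); lra.
Qed.

End Given.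

Lemma dep_extended : dep (inside pends (Rect 0 n.*2%:Z 0 m%:Z)) extended.
Proof.
have SR : (S `<=` RR)%classic by move=> u; rewrite /S /RR /Rect /=; lia.
move=> w1 w2 w12; apply/propext; split => -[q [l [r [t [lx rx ty [ql qr qt]]]]]];
  exists q, l, r, t; split => //; split.
- by apply: conn_mono ql => // e [S1 S2]; rewrite w12 //; split; exact: SR.
- by apply: conn_mono qr => // e [S1 S2]; rewrite w12 //; split; exact: SR.
- by apply: conn_mono qt => // e Re; rewrite w12.
- by apply: conn_mono ql => // e [S1 S2]; rewrite -w12 //; split; exact: SR.
- by apply: conn_mono qr => // e [S1 S2]; rewrite -w12 //; split; exact: SR.
- by apply: conn_mono qt => // e Re; rewrite -w12.
Qed.

Lemma local_extended : local extended.
Proof. exact: dep_Rect dep_extended. Qed.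

Lemma increasing_extended : increasing_event extended.
Proof.
move=> w w' ww' [q [l [r [t [lx rx ty [ql qr qt]]]]]].
by exists q, l, r, t; split => //; split; [exact: increasing_conn ql|exact: increasing_conn qr|
  exact: increasing_conn qt].
Qed.

(** The exploration from below determines the lowest crossing and leaves the edges above it fresh;
    given a crossing, [Pr_upper] bounds the conditional probability of an extension. *)
Lemma Pr_extended (R : realType) (p : R) : 0 <= p <= 1 ->
  Pr p (Hcross 0 n%:Z 0 n%:Z) * (Pr p (Vcross 0 n.*2%:Z 0 m%:Z) / 2) <= Pr p extended.
Proof.
have [s sR] := Rect_edges 0 n.*2%:Z 0 m%:Z.
have SR : (inside pends S `<=` inside pends RR)%classic.
  by move=> e; rewrite /inside /S /RR /Rect /=; lia.
have sH : dep [set` s]%classic (Hcross 0 n%:Z 0 n%:Z).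
  by apply: dep_sub (@dep_Hcross _ _ _ _) => e /SR; exact: sR.
move=> p01; rewrite (PrE p (dep_sub sR dep_extended)) (PrE p sH) mulrC -ExZ.
rewrite [leRHS](@Ex_markov _ _ _ _ explored); last exact: explored_stopping.
apply: Ex_le => // w _; rewrite {1}/ind; case: asboolP => [Hw|_]; last first.
  by rewrite mulr0; apply: Ex_ge0 => // w'; exact: ind_ge0.
rewrite mulr1; apply: le_trans (Pr_upper Hw p01) _.
rewrite (PrE p (dep_sub sR (dep_upper w))); apply: Ex_le => // w' _.
by apply: ind_le; exact: upper_extended.
Qed.

End Extension.

Section Gluing.
Implicit Types (w : pe -> bool) (n m : nat).

Definition reflyv (c : int) (u : pv) : pv := swapv (reflv c (swapv u)).
Definition reflye (c : int) (e : pe) : pe := swape (refle c (swape e)).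

Lemma reflyeK c : involutive (reflye c).
Proof. by move=> e; rewrite /reflye swapeK refleK swapeK. Qed.

Lemma conn_refl_y c w (B : set pv) u v : conn pends (w \o reflye c) B u v <->
  conn pends w [set q | B (reflyv c q)]%classic (reflyv c u) (reflyv c v).
Proof.
have -> : w \o reflye c = ((w \o swape) \o refle c) \o swape by [].
by rewrite conn_swap conn_refl_x conn_swap.
Qed.

(** A vertical crossing of the square meets both the horizontal crossing continued upwards and the
    one continued downwards, by [crossings_meet], and so links the two continuations. *)
Lemma extended_glue n m w : (0 < n)%N -> (n <= m)%N -> extended n m w ->
  extended n m (w \o reflye n%:Z) -> Vcross 0 n%:Z 0 n%:Z w ->
  Vcross 0 n.*2%:Z (n%:Z - m%:Z) m%:Z w.
Proof.
move=> n0 nm [q [l [r [t [lx rx tE [ql qr qt]]]]]] E' [b [b' [bE b'E bb']]].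
case: E' => q' [l' [r' [t' [lx' rx' tE' [ql' qr' qt']]]]].
set S := Rect 0 n%:Z 0 n%:Z in bb' ql qr ql' qr'.
have SE : [set h | S (reflyv n%:Z h)]%classic = S.
  by apply/funext => h; apply/propext; rewrite /S /Rect /reflyv /=; split; lia.
move/conn_refl_y: ql'; move/conn_refl_y: qr'; rewrite SE => qr' ql'.
move/conn_refl_y: qt' => qt'.
have qb := conn_trans ql (crossings_meet (conn_trans (conn_sym ql) qr) lx rx bb' bE b'E).
have qb' := conn_trans ql' (crossings_meet (conn_trans (conn_sym ql') qr') lx' rx' bb' bE b'E).
have qq := conn_trans qb (conn_sym qb').
set B := Rect 0 n.*2%:Z (n%:Z - m%:Z) m%:Z.
exists (reflyv n%:Z t'), t; split => //; first by rewrite /reflyv /= tE'.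
apply: conn_trans (conn_trans (conn_sym _) (conn_sym _)) _.
- by apply: conn_subset qt' => h; rewrite /B /Rect /reflyv /=; lia.
- by apply: conn_subset qq => h; rewrite /S /B /Rect /=; lia.
- by apply: conn_subset qt => h; rewrite /B /Rect /=; lia.
Qed.

Section Half.
Variable R : realType.
Let p : R := 1 / 2.

Let p01 : 0 <= p <= 1. Proof. by rewrite /p; lra. Qed.

Lemma square_half n : 1 / 2 <= Pr p (Hcross 0 n%:Z 0 n%:Z).
Proof.
apply: le_trans (Hcross_half R n) _; apply: Pr_le => //; try exact: local_Hcross.
by move=> w; apply: Hcross_narrow; lia.
Qed.

(** For v the probability on the left before squaring, an extension has probability at least v/4.
    Harris for the upward extension, the downward one and a crossing of the square gives (v/4)^2/2;
    the new height is m + m - n. *)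
Lemma Vcross_step n m : (0 < n)%N -> (n <= m)%N ->
  Pr p (Vcross 0 n.*2%:Z 0 m%:Z) ^+ 2 / 32 <= Pr p (Vcross 0 n.*2%:Z 0 (m.*2 - n)%N%:Z).
Proof.
move=> n0 nm; have lE := local_extended n0 nm.
have lE' := local_transfer (reflye n%:Z) lE.
have lV := local_Vcross 0 n%:Z 0 n%:Z.
have iE := @increasing_extended n m.
have iE' : increasing_event (fun w => extended n m (w \o reflye n%:Z)).
  by move=> w w' ww'; apply: iE => e; exact: ww'.
have iV := @increasing_Vcross 0 n%:Z 0 n%:Z.
have iEE : increasing_event (fun w => extended n m (w \o reflye n%:Z) /\ Vcross 0 n%:Z 0 n%:Z w).
  by move=> w w' ww' [h1 h2]; split; [exact: iE' ww' h1|exact: iV ww' h2].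
have h1 := Pr_harris p01 lE (local_and lE' lV) iE iEE.
have h2 := Pr_harris p01 lE' lV iE' iV.
have h3 : Pr p (fun w => extended n m w /\ (extended n m (w \o reflye n%:Z) /\ Vcross 0 n%:Z 0 n%:Z w))
    <= Pr p (Vcross 0 n.*2%:Z (n%:Z - m%:Z) m%:Z).
  apply: Pr_le => //; [exact: local_and (local_and _ _)|exact: local_Vcross|].
  by move=> w [e1 [e2 v]]; exact: extended_glue.
have h4 : Pr p (Vcross 0 n.*2%:Z (n%:Z - m%:Z) m%:Z) = Pr p (Vcross 0 n.*2%:Z 0 (m.*2 - n)%N%:Z).
  rewrite -(@Pr_Vcross_shift R p 0 (m%:Z - n%:Z)); congr (Pr p (Vcross _ _ _ _)); lia.
rewrite (Pr_transfer p (inv_inj (@reflyeK n%:Z)) lE) in h2.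
have h5 := Pr_extended n0 nm p01.
have h6 := square_half n; have h7 := square_half n.
rewrite -Pr_Vcross in h7.
have v0 := Pr_ge0 (Vcross 0 n.*2%:Z 0 m%:Z) p01.
have e4 : Pr p (Vcross 0 n.*2%:Z 0 m%:Z) / 4 <= Pr p (extended n m) by nra.
rewrite -h4; apply: le_trans h3; apply: le_trans h1.
apply: (@le_trans _ _ (Pr p (extended n m) * (Pr p (extended n m) / 2))); last first.
  by apply: ler_wpM2l; [exact: Pr_ge0|apply: le_trans h2; have := Pr_ge0 (extended n m) p01; nra].
nra.
Qed.

Lemma Vcross_narrow (x0 x1 y0 y1 y1' : int) w : y0 <= y1' -> y1' <= y1 ->
  Vcross x0 x1 y0 y1 w -> Vcross x0 x1 y0 y1' w.
Proof. by move=> h1 h2 /swap_cross H; apply/swap_cross; exact: Hcross_narrow H. Qed.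

(** Starting from a square of side 2n, three uses of [Vcross_step] give the heights 3n, 5n and 9n;
    the annulus estimate needs 6n + 3 <= 9n. *)
Lemma rsw : exists2 c : R, 0 < c & forall n, (0 < n)%N -> c <= Pr p (Vcross 0 n.*2%:Z 0 (9 * n)%N%:Z).
Proof.
pose F (x : R) := x ^+ 2 / 32; exists (F (F (F (1 / 2)))); first by rewrite /F; lra.
have Fmono x y : 0 <= x -> x <= y -> F x <= F y by rewrite /F => *; nra.
move=> n n0.
have s0 : 1 / 2 <= Pr p (Vcross 0 n.*2%:Z 0 n.*2%:Z) by rewrite Pr_Vcross; exact: square_half.
have s1 := @Vcross_step n n.*2 n0 ltac:(lia).
have s2 := @Vcross_step n (3 * n) n0 ltac:(lia).
have s3 := @Vcross_step n (5 * n) n0 ltac:(lia).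
rewrite (_ : n.*2.*2 - n = 3 * n)%N in s1; last lia.
rewrite (_ : (3 * n).*2 - n = 5 * n)%N in s2; last lia.
rewrite (_ : (5 * n).*2 - n = 9 * n)%N in s3; last lia.
apply: le_trans s3; apply: (Fmono); first by rewrite /F; lra.
apply: le_trans s2; apply: (Fmono); first by rewrite /F; lra.
by apply: le_trans s1; apply: (Fmono); first by lra.
Qed.

End Half.
End Gluing.

(** * One-arm events in planar coordinates *)

Section PlanarArms.
Implicit Types (w : pe -> bool) (z : pv).

Definition iotav (u : vtx 2) : pv := (u ord0, u ord_max).
Definition iotav' (q : pv) : vtx 2 := [ffun i => if i == ord0 then q.1 else q.2].
Definition iotae (e : ledge 2) : pe := (iotav e.1, e.2 == ord_max).
Definition iotae' (e : pe) : ledge 2 := (iotav' e.1, if e.2 then ord_max else ord0).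

Lemma iotavK : cancel iotav iotav'.
Proof.
move=> u; apply/ffunP => i; rewrite ffunE.
by case: eqVneq => [->//|]; case: i => -[|[|//]] //= h _; congr (u _); exact: val_inj.
Qed.

Lemma iotav'K : cancel iotav' iotav.
Proof. by case=> x y; rewrite /iotav !ffunE. Qed.

Lemma iotaeK : cancel iotae iotae'.
Proof.
case=> u i; rewrite /iotae /iotae' /= iotavK; congr pair.
by case: eqVneq => [->//|]; case: i => -[|[|//]] //= h _; exact: val_inj.
Qed.

Lemma iotae'K : cancel iotae' iotae.
Proof. by case=> q b; rewrite /iotae /iotae' /= iotav'K; case: b. Qed.

Lemma iota_joins e u v : joins (@lends 2) e u v -> joins pends (iotae e) (iotav u) (iotav v).
Proof.
have E f : (iotav (lends f).1, iotav (lends f).2) = pends (iotae f).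
  case: f => x i; rewrite /pends /iotae /iotav /=; congr pair.
  by case: eqVneq => [->|]; rewrite !ffunE /=; [rewrite addr0|case: i => -[|[|//]] //= h _; rewrite addr0].
by rewrite /joins -E => -[] ->; [left|right].
Qed.

Lemma iota_joins' e u v : joins pends e u v -> joins (@lends 2) (iotae' e) (iotav' u) (iotav' v).
Proof.
have E f : (iotav' (pends f).1, iotav' (pends f).2) = lends (iotae' f).
  case: f => -[x y] b; rewrite /lends /iotae' /=; congr pair.
  by apply/ffunP => -[[|[|//]] h]; rewrite !ffunE; case: b => /=; rewrite ?addr0.
by rewrite /joins -E => -[] ->; [left|right].
Qed.

Lemma conn_iota w (B : set (vtx 2)) u v : conn (@lends 2) (w \o iotae) B u v <->
  conn pends w [set q | B (iotav' q)]%classic (iotav u) (iotav v).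
Proof. exact: conn_iso iotavK iotae'K iota_joins iota_joins' _ _ _ _. Qed.

Definition parm z (m : nat) w := arm (iotav' z) m (w \o iotae).

Lemma local_parm z m : local (parm z m).
Proof. exact: local_transfer (local_arm _ _). Qed.

Lemma increasing_parm z m : increasing_event (parm z m).
Proof. by move=> w w' ww'; apply: increasing_arm => e; exact: ww'. Qed.

Lemma Pr_parm (R : realType) (p : R) z m : Pr p (parm z m) = theta_ 2 p m.
Proof.
by rewrite /theta_ -(Pr_arm_shift p (iotav' z)) -(Pr_transfer p (can_inj iotaeK) (local_arm _ _)).
Qed.

Lemma parm_exit z (m : nat) y w (B : set pv) : conn pends w B z y ->
  (m%:Z <= `|(y.1 : int) - z.1|) \/ (m%:Z <= `|(y.2 : int) - z.2|) -> parm z m w.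
Proof.
move=> zy far; have zy' : conn (@lends 2) (w \o iotae) [set u | B (iotav u)]%classic (iotav' z) (iotav' y).
  apply/conn_iota; rewrite !iotav'K; apply: conn_subset zy => q Bq /=; by rewrite iotav'K.
have [|x [Sx cx]] := conn_exit_sphere (m := m) zy'.
  by case: far => far; [exists ord0|exists ord_max]; rewrite !ffunE.
by exists x; split => //; apply: conn_subset cx => u [].
Qed.

Lemma parm_conn (m : nat) w : parm (0, 0) m w -> exists y,
  (`|y.1 : int| = m%:Z \/ `|y.2 : int| = m%:Z) /\ conn pends w (Rect (- m%:Z) m%:Z (- m%:Z) m%:Z) (0, 0) y.
Proof.
move=> [x [[Bx [i xi]] /conn_iota]]; rewrite iotav'K => cx; exists (iotav x); split.
  move: xi; rewrite /iotav !ffunE; case: i => -[|[|//]] h; rewrite /= subr0 => <-; [left|right] => /=;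
    by congr (`|x _|); exact: val_inj.
apply: conn_subset cx => q Bq; have := Bq ord0; have := Bq ord_max; rewrite !ffunE /Rect /=; lia.
Qed.

Lemma dep_parm (m : nat) :
  dep (inside pends (Rect (- m%:Z) m%:Z (- m%:Z) m%:Z)) (parm (0, 0) m).
Proof.
move=> w w' ww'; apply: (@dep_arm_inside 2) => e [B1 B2] /=; apply: ww'.
have E : joins pends (iotae e) (iotav (lends e).1) (iotav (lends e).2) by apply/iota_joins/joins_ends.
have sub u : Box (iotav' (0, 0)) m u -> Rect (- m%:Z) m%:Z (- m%:Z) m%:Z (iotav u).
  by move=> Bu; have := Bu ord0; have := Bu ord_max; rewrite !ffunE /Rect /=; coord_lia.
exact: joins_inside E (sub _ B1) (sub _ B2).
Qed.

End PlanarArms.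

(** * The planar critical point and three arms *)

Section PlanarCritical.
Variable R : realType.
Implicit Types (w : pe -> bool).
Let p : R := 1 / 2.
Let p01 : 0 <= p <= 1. Proof. by rewrite /p; lra. Qed.

Definition annulus_crossed (n M : int) w : Prop :=
  (Hcross n M (- M) M w \/ Hcross (- M) (- n) (- M) M w) \/
  (Vcross (- M) M n M w \/ Vcross (- M) M (- M) (- n) w).

(** The arm ends on one of four sides; after its last visit to the inner half-plane of that side it
    crosses the corresponding strip. *)
Lemma arm_crosses_annulus (n M : nat) w : (0 < n)%N -> (n <= M)%N -> parm (0, 0) M w ->
  annulus_crossed n%:Z M%:Z w.
Proof.
move=> n0 nM /parm_conn[y [yM cy]]; rewrite /annulus_crossed.
have far : y.1 = M%:Z \/ y.1 = - M%:Z \/ y.2 = M%:Z \/ y.2 = - M%:Z by case: yM; lia.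
case: far => [E|[E|[E|E]]].
- have [||u [v [e [Du _ uv _ vy]]]] := conn_last_exit (D := [set q : pv | (q.1 : int) < n%:Z]%classic) cy.
  + by rewrite /=; lia.
  + by rewrite /= E; lia.
  have [Rv nv] := conn_src vy; left; left; exists v, y; split => //.
    by move: Du nv; case: e uv => -[a b] [] [] [<- <-] /=; lia.
  by apply: conn_subset vy => q [Rq nq]; move: Rq nq; rewrite /Rect /=; lia.
- have [||u [v [e [Du _ uv _ vy]]]] := conn_last_exit (D := [set q : pv | - n%:Z < (q.1 : int)]%classic) cy.
  + by rewrite /=; lia.
  + by rewrite /= E; lia.
  have [Rv nv] := conn_src vy; left; right; exists y, v; split => //.
    by move: Du nv; case: e uv => -[a b] [] [] [<- <-] /=; lia.
  by apply: conn_subset (conn_sym vy) => q [Rq nq]; move: Rq nq; rewrite /Rect /=; lia.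
- have [||u [v [e [Du _ uv _ vy]]]] := conn_last_exit (D := [set q : pv | (q.2 : int) < n%:Z]%classic) cy.
  + by rewrite /=; lia.
  + by rewrite /= E; lia.
  have [Rv nv] := conn_src vy; right; left; exists v, y; split => //.
    by move: Du nv; case: e uv => -[a b] [] [] [<- <-] /=; lia.
  by apply: conn_subset vy => q [Rq nq]; move: Rq nq; rewrite /Rect /=; lia.
- have [||u [v [e [Du _ uv _ vy]]]] := conn_last_exit (D := [set q : pv | - n%:Z < (q.2 : int)]%classic) cy.
  + by rewrite /=; lia.
  + by rewrite /= E; lia.
  have [Rv nv] := conn_src vy; right; right; exists y, v; split => //.
    by move: Du nv; case: e uv => -[a b] [] [] [<- <-] /=; lia.
  by apply: conn_subset (conn_sym vy) => q [Rq nq]; move: Rq nq; rewrite /Rect /=; lia.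
Qed.

Lemma local_annulus (n M : int) : local (annulus_crossed n M).
Proof.
by apply: local_or; apply: local_or; first [exact: local_Hcross|exact: local_Vcross].
Qed.

Lemma dep_Vcross (x0 x1 y0 y1 : int) :
  dep (inside pends (Rect x0 x1 y0 y1)) (Vcross x0 x1 y0 y1).
Proof.
move=> w w' ww'; apply/propext; split => -[u [v [ux vx uv]]]; exists u, v; split => //.
  by rewrite -(conn_dep _ _ ww').
by rewrite (conn_dep _ _ ww').
Qed.

Lemma dep_annulus (m : nat) (n M : int) : m%:Z < n ->
  dep (~` inside pends (Rect (- m%:Z) m%:Z (- m%:Z) m%:Z))%classic (annulus_crossed n M).
Proof.
move=> mn w w' ww'; rewrite /annulus_crossed.
congr ((_ \/ _) \/ (_ \/ _)); first [apply: dep_Hcross|apply: dep_Vcross] => e [[R1 R2] [R3 R4]];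
  apply: ww' => -[[R5 R6] _]; move: R1 R2 R5 R6; rewrite /Rect /=; lia.
Qed.

(** The dual of each strip between distances n and 3n+1 has width 2n and length 6n+3 <= 9n, so [rsw]
    blocks the strip with probability at least c. The four blocking events are decreasing, and
    Harris gives c^4. *)
Lemma annulus_bound : exists2 rho : R, 0 <= rho < 1 & forall n : nat, (0 < n)%N ->
  Pr p (annulus_crossed n%:Z (3 * n + 1)%N%:Z) <= rho.
Proof.
have [c c0 Hc] := rsw R.
have c1 : c <= 1 by apply: le_trans (Hc 1%N isT) _; exact: Pr_le1.
exists (1 - c ^+ 4).
  by rewrite subr_ge0 exprn_ile1 //= ?ltrBlDr ?ltrDl ?exprn_gt0 // ltW.
move=> n n0; set M : int := (3 * n + 1)%N%:Z.
have e1 : Pr p (Hcross n%:Z M (- M) M) <= 1 - c.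
  rewrite lerBrDr -lerBrDl.
  have := @Pr_dual_cross R p n%:Z M (- M) M p01 ltac:(rewrite /M; lia) ltac:(rewrite /M; lia).
  rewrite (_ : 1 - p = p); last by rewrite /p; lra.
  move=> ->; apply: le_trans (Hc n n0) _.
  rewrite -(@Pr_Vcross_shift R p (- n%:Z) (M + 1) n%:Z).
  rewrite (_ : n%:Z + - n%:Z = 0); last lia.
  rewrite (_ : M - 1 + - n%:Z = n.*2%:Z); last by rewrite /M; lia.
  rewrite (_ : - M - 1 + (M + 1) = 0); last lia.
  apply: Pr_le => //; try exact: local_Vcross.
  by move=> w; apply: Vcross_narrow; rewrite /M; lia.
have e2 : Pr p (Hcross (- M) (- n%:Z) (- M) M) <= 1 - c.
  rewrite -(@Pr_Hcross_shift R p (M + n%:Z) 0); apply: le_trans e1.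
  rewrite le_eqVlt; apply/orP; left; apply/eqP; congr (Pr p (Hcross _ _ _ _)); lia.
have e3 : Pr p (Vcross (- M) M n%:Z M) <= 1 - c by rewrite Pr_Vcross.
have e4 : Pr p (Vcross (- M) M (- M) (- n%:Z)) <= 1 - c by rewrite Pr_Vcross.
have lH x0 x1 y0 y1 := local_Hcross x0 x1 y0 y1.
have lV x0 x1 y0 y1 := local_Vcross x0 x1 y0 y1.
have not_or (P Q : (pe -> bool) -> Prop) : local P -> local Q -> increasing_event P -> increasing_event Q ->
    (1 - Pr p P) * (1 - Pr p Q) <= 1 - Pr p (fun w => P w \/ Q w).
  move=> lP lQ iP iQ; rewrite -(Pr_not p lP) -(Pr_not p lQ) -(Pr_not p (local_or lP lQ)).
  apply: le_trans (Pr_harris_decreasing p01 (local_not lP) (local_not lQ) _ _) _.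
  - by move=> w w' ww' nP /(iP _ _ ww').
  - by move=> w w' ww' nQ /(iQ _ _ ww').
  apply: Pr_le => //; first exact: local_and (local_not _) (local_not _).
    exact: local_not (local_or _ _).
  by move=> w [nP nQ] [].
have iH := increasing_Hcross; have iV := increasing_Vcross.
have iHH : increasing_event (fun w => Hcross n%:Z M (- M) M w \/ Hcross (- M) (- n%:Z) (- M) M w).
  by move=> w w' ww' [h|h]; [left|right]; exact: iH ww' h.
have iVV : increasing_event (fun w => Vcross (- M) M n%:Z M w \/ Vcross (- M) M (- M) (- n%:Z) w).
  by move=> w w' ww' [h|h]; [left|right]; exact: iV ww' h.
have h1 := not_or _ _ (lH n%:Z M (- M) M) (lH (- M) (- n%:Z) (- M) M) (iH _ _ _ _) (iH _ _ _ _).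
have h2 := not_or _ _ (lV (- M) M n%:Z M) (lV (- M) M (- M) (- n%:Z)) (iV _ _ _ _) (iV _ _ _ _).
have h3 := not_or _ _ (local_or (lH n%:Z M (- M) M) (lH (- M) (- n%:Z) (- M) M))
  (local_or (lV (- M) M n%:Z M) (lV (- M) M (- M) (- n%:Z))) iHH iVV.
have q1 : c ^+ 2 <= 1 - Pr p (fun w => Hcross n%:Z M (- M) M w \/ Hcross (- M) (- n%:Z) (- M) M w).
  by apply: le_trans h1; rewrite expr2; apply: ler_pM; lra.
have q2 : c ^+ 2 <= 1 - Pr p (fun w => Vcross (- M) M n%:Z M w \/ Vcross (- M) M (- M) (- n%:Z) w).
  by apply: le_trans h2; rewrite expr2; apply: ler_pM; lra.
have q3 : c ^+ 4 <= 1 - Pr p (annulus_crossed n%:Z M).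
  apply: le_trans h3; rewrite (_ : c ^+ 4 = c ^+ 2 * c ^+ 2); last by ring.
  by apply: ler_pM => //; rewrite exprn_ge0 // ltW.
lra.
Qed.

Lemma theta_half_decay : (theta_ 2 p n @[n --> \oo] --> (0 : R))%classic.
Proof.
have [rho /andP[r0 r1] Hrho] := annulus_bound.
(* 3m + 4 is the outer radius of the annulus whose inner radius is m + 1, just outside the box of
   radius m; the two events then read disjoint sets of edges. *)
have step m M : (3 * m + 4 <= M)%N -> theta_ 2 p M <= rho * theta_ 2 p m.
  move=> mM; have N0 : (3 * m.+1 + 1 <= M)%N by lia.
  have sub w : parm (0, 0) M w -> parm (0, 0) m w /\ annulus_crossed m.+1%:Z (3 * m.+1 + 1)%N%:Z w.
    move=> a; split.
      have [y [yM cy]] := parm_conn a; apply: parm_exit cy _.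
      by rewrite /= !subr0; lia.
    apply: arm_crosses_annulus; try lia.
    have [y [yM cy]] := parm_conn a; apply: parm_exit cy _.
    by rewrite /= !subr0; lia.
  rewrite -!(Pr_parm p (0, 0)) mulrC.
  have lA := local_annulus m.+1%:Z (3 * m.+1 + 1)%N%:Z.
  apply: (@le_trans _ _ (Pr p (parm (0, 0) m) * Pr p (annulus_crossed m.+1%:Z (3 * m.+1 + 1)%N%:Z))).
    rewrite -(Pr_indep p (local_parm _ _) lA (@dep_parm m)); last by apply: dep_annulus; lia.
    by apply: Pr_le => //; [exact: local_parm|apply: local_and => //; exact: local_parm].
  by apply: ler_wpM2l; [exact: Pr_ge0|exact: Hrho].
have bound k : exists N, forall n, (N <= n)%N -> theta_ 2 p n <= rho ^+ k.
  elim: k => [|k [N IH]]; first by exists 0%N => n _; rewrite expr0; exact: theta_le1.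
  exists (3 * N + 4)%N => n Nn; apply: le_trans (step N n Nn) _.
  by rewrite exprS; apply: ler_wpM2l => //; exact: IH.
apply/cvgrPdist_lt => e e0.
have [K _ HK] : (\forall k \near \oo, `|0 - rho ^+ k| < e)%classic.
  by move: e e0; apply/cvgrPdist_lt; apply: cvg_expr; rewrite ger0_norm.
have [N HN] := bound K; exists N => // n /= Nn; rewrite sub0r normrN ger0_norm ?theta_ge0 //.
apply: le_lt_trans (HN n Nn) _.
by have := HK K (leqnn K); rewrite sub0r normrN ger0_norm // exprn_ge0.
Qed.

Lemma p_c_ge_half : 1 / 2 <= p_c 2 R.
Proof. by apply: le_p_c => //; apply: theta_lim; exact: theta_half_decay. Qed.

Definition dual_arm (z : pv) (j : nat) w : Prop := parm z j ((fun e => ~~ w e) \o dualv).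

Lemma local_dual_arm z j : local (dual_arm z j).
Proof.
have [s sP] := local_transfer dualv (local_parm z j).
by exists s => w w' ww'; apply: (sP (fun e => ~~ w e)) => e es; rewrite ww'.
Qed.

Lemma Pr_dual_arm z j : Pr p (dual_arm z j) = theta_ 2 p j.
Proof.
have := Pr_flip p (local_transfer dualv (local_parm z j)).
rewrite (Pr_transfer _ (can_inj dualvK) (local_parm z j)) Pr_parm.
by rewrite (_ : 1 - p = p) => [<-|] //; rewrite /p; lra.
Qed.

Lemma first_drop (f : nat -> bool) b : f 0%N -> ~~ f b.+1 -> exists2 j, (j <= b)%N & f j && ~~ f j.+1.
Proof.
elim: b => [|b IH] f0 fb; first by exists 0%N; rewrite ?f0.
have [fb'|fb'] := boolP (f b.+1); first by exists b.+1; rewrite // fb' fb.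
by have [j jb fj] := IH f0 fb'; exists j => //; exact: ltnW.
Qed.

(** Going up in column m, the faces turn from not high to high, which gives an interface edge at
    some height j. Its two sides of the interface run to the left and right ends, each at distance m
    since the width is 2m + 1; the low face beneath is joined to row -1, at distance j, through
    closed edges. *)
Lemma three_arms (m : nat) w : Hcross 0 (m.*2.+1)%:Z 0 m.*2%:Z w ->
  exists2 j : nat, j \in iota 0 m.*2.+1 &
    disjoint_occurrence (parm (m%:Z, j%:Z) m) (parm (m%:Z + 1, j%:Z) m) w /\
    dual_arm (m%:Z, j%:Z - 1) j w.
Proof.
move=> Hw; set a := m.*2.+1; set b := m.*2 in Hw *.
have a0 : (0 < a)%N by [].
pose c (j : nat) := `[< ~ high a b w (m%:Z, j%:Z - 1) >].
have [||j jb /andP[cj cj1]] := @first_drop c b.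
- apply/asboolP => h; apply: low_high h; apply: low_bottom => //=.
  by rewrite /Rect /a /b /=; lia.
- apply/asboolP; apply; apply: (high_top a0 Hw); last by rewrite /=; lia.
  by rewrite /Rect /a /b /=; lia.
exists j; first by rewrite mem_iota; lia.
pose e0 : pe := ((m%:Z, j%:Z), false).
have j1 : j.+1%:Z - 1 = j%:Z :> int by lia.
have Se0 : inside pends (Rect 0 a%:Z 0 b%:Z) e0.
  by move: jb; rewrite /inside /Rect /a /b /=; split; lia.
have ie0 : interface a b w e0.
  rewrite /interface /cut /=; apply/and3P; split; try (rewrite /a; lia).
  by move: cj cj1; rewrite /c j1; do 2 case: `[< _ >].
have [_ [f [g [fg lf hg]]]] := interface_faces a0 Se0 ie0.
have fE : f = (m%:Z, j%:Z - 1).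
  case: fg => -[// E1 _]; exfalso; move: cj => /asboolP; apply.
  by rewrite E1.
split; last first.
  have [s [s2 sf]] := lf; rewrite /dual_arm -fE; apply: (@parm_exit _ _ s).
    by apply/conn_dual; exact: conn_sym sf.
  by right; rewrite fE /=; move: s2 => /= ->; lia.
have [l [r [u [v [lx rx uv lu vr]]]]] := interface_split a0 Hw Se0 ie0.
set w0 := (fun e => _) in lu vr; set B := Rect _ _ _ _ in lu vr.
have npiv : ~ Hcross 0 a%:Z 0 b%:Z w0 := interface_pivotal a0 Se0 ie0.
(* [T] marks the part reachable from [l] without [e0]. The piece ending at [r] avoids it because
   [e0] is pivotal for the interface; hence the two arms use disjoint edges. *)
pose T (e : pe) := `[< conn pends w0 B l (pends e).1 >].
have w0w e : inside pends B e -> w0 e -> w e.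
  by move=> Se /andP[ie _]; have [] := interface_faces a0 Se ie.
have cu : conn pends (fun e => w e && T e) B u l.
  apply: conn_sym; elim: lu => [Bl|y z e ly IH we yz Bz]; first exact: conn_refl.
  apply: (conn_step IH _ yz Bz).
  have lz := conn_step ly we yz Bz.
  rewrite (w0w _ (joins_inside yz (conn_tgt ly) Bz) we) /=.
  by apply/asboolP; case: yz => ->.
have lB : B l := conn_src lu.
have nTv q : conn pends w0 B v q -> ~ conn pends w0 B l q.
  by move=> vq lq; apply: npiv; exists l, r; split => //; exact: conn_trans lq (conn_trans (conn_sym vq) vr).
have cv : conn pends (fun e => w e && ~~ T e) B v r.
  elim: vr => [Bv|y z e vy IH we yz Bz]; first exact: conn_refl.
  apply: (conn_step IH _ yz Bz).
  have vz := conn_step vy we yz Bz.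
  rewrite (w0w _ (joins_inside yz (conn_tgt vy) Bz) we) /=.
  by apply/asboolP => h; case: yz h => -> /= h; [exact: nTv vy h|exact: nTv vz h].
case: uv => -[uE vE]; subst u v.
  exists T; split; [apply: (parm_exit cu)|apply: (parm_exit cv)]; left; rewrite /= ?lx ?rx /a; lia.
exists (fun e => ~~ T e); split.
  by apply: (parm_exit cv); left; rewrite /= rx /a; lia.
have -> : (fun e => w e && ~~ ~~ T e) = (fun e => w e && T e).
  by apply/funext => e; rewrite negbK.
by apply: (parm_exit cu); left; rewrite /= lx; lia.
Qed.

Lemma three_arm_inequality (m : nat) :
  1 / 2 <= theta_ 2 p m ^+ 2 * \sum_(0 <= j < m.*2.+1) theta_ 2 p j.
Proof.
have lD j : local (disjoint_occurrence (parm (m%:Z, j%:Z) m) (parm (m%:Z + 1, j%:Z) m)).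
  have [s [_ s1 s2]] := local2 (local_parm (m%:Z, j%:Z) m) (local_parm (m%:Z + 1, j%:Z) m).
  by exists s; exact: dep_disjoint_occurrence.
have iP z := @increasing_parm z m.
have lT j := local_and (lD j) (local_dual_arm (m%:Z, j%:Z - 1) j).
apply: le_trans (Hcross_half R m.*2) _.
apply: (@le_trans _ _ (Pr p (fun w => exists2 j : nat, j \in iota 0 m.*2.+1 &
    disjoint_occurrence (parm (m%:Z, j%:Z) m) (parm (m%:Z + 1, j%:Z) m) w /\
    dual_arm (m%:Z, j%:Z - 1) j w))).
  apply: Pr_le => //; [exact: local_Hcross|exact: local_exists_seq|exact: three_arms].
apply: le_trans (Pr_exists_seq p01 (fun j _ => lT j)) _.
rewrite mulr_sumr /index_iota subn0; apply: ler_sum => j _.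
have dec : decreasing_event (dual_arm (m%:Z, j%:Z - 1) j).
  move=> w w' ww'; apply: increasing_parm => e /=; apply: contraNN; exact: ww'.
have iD := increasing_disjoint_occurrence (iP (m%:Z, j%:Z)) (iP (m%:Z + 1, j%:Z)).
apply: le_trans (Pr_harris_mixed p01 (lD j) (local_dual_arm _ _) iD dec) _.
rewrite Pr_dual_arm; apply: ler_wpM2r; first exact: theta_ge0.
apply: le_trans (Pr_bk p01 (local_parm _ _) (local_parm _ _) (iP _) (iP _)) _.
by rewrite !Pr_parm expr2.
Qed.

End PlanarCritical.

(** * The exponent *)

Section Endpoints.
Variables (R : realType).

Lemma Ex_p0 (L : choiceType) (s : seq L) (f : (L -> bool) -> R) : uniq s ->
  Ex 0 s f = f (fun=> false).
Proof.
elim: s f => [|e s IH] f /=.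
  move=> _; rewrite -(Ex_cst 0 ([::] : seq L) (f _)); apply: Ex_eq => w ws; congr f.
  by apply/funext => x; rewrite ws.
move=> /andP[es us]; rewrite Ex_cons // mul0r add0r subr0 mul1r IH //; congr f.
by apply/funext => x; rewrite /upd; case: eqP.
Qed.

Lemma Ex_p1 (L : choiceType) (s : seq L) (f : (L -> bool) -> R) : uniq s ->
  Ex 1 s f = f (fun e => e \in s).
Proof.
elim: s f => [|e s IH] f /=.
  move=> _; rewrite -(Ex_cst 1 ([::] : seq L) (f _)); apply: Ex_eq => w ws; congr f.
  by apply/funext => x; rewrite ws.
move=> /andP[es us]; rewrite Ex_cons // subrr mul0r addr0 mul1r IH //; congr f.
Qed.

Variable d : nat.

Lemma theta_p0 n : (0 < n)%N -> theta_ d (0 : R) n = 0.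
Proof.
move=> n0; rewrite theta_Ex Ex_p0 ?uniq_box_edges // /ind asboolF // => -[y [[_ [i yi]] cy]].
by move: yi; case: cy => [_|//]; rewrite subrr normr0; lia.
Qed.

Lemma theta_p1 n : (0 < d)%N -> theta_ d (1 : R) n = 1.
Proof.
move=> d0; rewrite theta_Ex Ex_p1 ?uniq_box_edges // /ind asboolT //.
pose i : 'I_d := Ordinal d0; pose q (k : nat) : vtx d := [ffun j => (k * (j == i))%N%:Z].
have Bq k : (k <= n)%N -> Box 0 n (q k).
  by move=> kn j; rewrite !ffunE; case: eqP => _ /=; lia.
exists (q n); split.
  by split; [exact: Bq|exists i; rewrite !ffunE eqxx; lia].
suff : forall k, (k <= n)%N -> conn (@lends d) (fun e => e \in box_edges 0 n) (Box 0 n) 0 (q k).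
  by apply.
elim=> [_|k IH kn].
  have -> : q 0%N = 0 by apply/ffunP => j; rewrite !ffunE mul0n.
  by apply: conn_refl => j; rewrite subrr normr0.
have J : joins (@lends d) (q k, i) (q k) (q k.+1).
  left; rewrite /lends /=; congr pair; apply/ffunP => j; rewrite !ffunE.
  by case: eqP => _ /=; lia.
have Bk := Bq k (ltnW kn); have Bk1 := Bq k.+1 kn.
by apply: (conn_step (IH (ltnW kn)) _ J Bk1); apply: inside_box_edges; exact: joins_inside J Bk Bk1.
Qed.

End Endpoints.

Section Exponent.
Variable R : realType.

(** Some tail has an infimum above [c]. The cap keeps the exponent in the range where the power sums
    have the wanted order, also when that infimum is infinite. *)
Lemma limn_einf_lower_bound (u : (\bar R)^nat) (c cap : R) : c < cap -> (c%:E < limn_einf u)%E ->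
  exists a n0, [/\ c < a, a < cap & forall n, (n0 <= n)%N -> (a%:E <= u n)%E].
Proof.
move=> ccap; rewrite limn_einf_lim (cvg_lim _ (@cvg_einfs_sup _ u)) //.
move=> /ereal_sup_gt[_ [n0 _ <-]] cn.
have [a [ca acap an]] : exists a, [/\ c < a, a < cap & (a%:E <= einfs u n0)%E].
  move: cn; case: (einfs u n0) => [r|_|//].
    rewrite lte_fin => cr; exists ((c + Num.min r cap) / 2).
    have [rc|cr'] := leP r cap; split; rewrite ?lee_fin; lra.
  by exists ((c + cap) / 2); rewrite leey; split => //; lra.
exists a, n0; split => // n nn; apply: le_trans an _.
by apply: ereal_inf_lbound; exists n.
Qed.

Lemma decay_of_exponent (d : nat) (c cap : R) : 0 < c -> c < cap -> (c%:E < eta1 d R)%E ->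
  exists a n0, [/\ c < a, a < cap & forall n, (n0 <= n)%N ->
    [/\ 0 < theta_ d (p_c d R) n, theta_ d (p_c d R) n < 1 &
        theta_ d (p_c d R) n <= n%:R `^ (- a)]].
Proof.
move=> c0 ccap /(limn_einf_lower_bound ccap)[a [n0 [ca acap H]]].
exists a, (maxn n0 2); split => // n; rewrite geq_max => /andP[nn n2].
have n1 : 1 < n%:R :> R by rewrite ltr1n.
have ln0' : 0 < ln (n%:R : R) by rewrite ln_gt0.
have := H n nn; rewrite lee_fin one_arm_prob_Pr -/(theta_ d (p_c d R) n) ler_pdivlMr //.
set t := theta_ _ _ _ => ht.
have an : 0 < a * ln n%:R by rewrite mulr_gt0 //; lra.
(* [ln] is 0 on nonpositive reals by convention, so t <= 0 would make the quotient 0, against a >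
   0. *)
have t0 : 0 < t by rewrite ltNge; apply/negP => /ln0 E; move: ht; rewrite E; lra.
have tle : t <= n%:R `^ (- a).
  by rewrite /powR gt_eqF; [rewrite -[leLHS]lnK ?posrE // ler_expR; lra|lra].
split => //; rewrite -(lnK (x := t)) ?posrE // -expR0 ltr_expR; lra.
Qed.

(** Since 1/2 <= p_c, the decay passes to p = 1/2 by monotonicity. There a < 1 makes the sum in
    [three_arm_inequality] of order m^(1-a), and the right side becomes m^(1-3a), which tends to
    0. *)
Lemma no_fast_decay_2d (a K : R) : 1 / 3 < a -> a < 1 -> 1 <= K ->
  (forall n, theta_ 2 (p_c 2 R) n <= K * n.+1%:R `^ (- a)) -> False.
Proof.
move=> a3 a1 K1 HK; have a0 : 0 < a by lra.
have half01 : 0 <= (1 / 2 : R) <= 1 by lra.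
have HK' n : theta_ 2 (1 / 2 : R) n <= K * n.+1%:R `^ (- a).
  apply: le_trans (HK n); apply: Pr_increasing_p.
  - exact: local_arm.
  - exact: increasing_arm.
  - by lra.
  - exact: p_c_ge_half.
  - by case/andP: (p_c_01 R 2).
have a01 : 0 < a < 1 by rewrite a0.
pose C := K ^+ 3 * ((1 - a)^-1 * 2 `^ (1 - a)).
have C0 : 0 < C.
  by rewrite /C mulr_gt0 ?exprn_gt0 ?mulr_gt0 ?powR_gt0 ?invr_gt0 //; lra.
have c0 : 0 < 3 * a - 1 by lra.
have [m /(_ m (leqnn m)) Hm] := @powR_small R (3 * a - 1) (1 / 2 / C) c0 ltac:(by rewrite divr_gt0 //; lra).
have H3 := three_arm_inequality R m.
have tm0 : 0 <= theta_ 2 (1 / 2 : R) m by exact: theta_ge0.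
have sum : \sum_(0 <= j < m.*2.+1) theta_ 2 (1 / 2 : R) j <=
    K * ((1 - a)^-1 * (2 `^ (1 - a) * m.+1%:R `^ (1 - a))).
  apply: (@le_trans _ _ (K * \sum_(0 <= j < m.*2.+1) j.+1%:R `^ (- a))).
    by rewrite mulr_sumr; apply: ler_sum => j _.
  apply: ler_wpM2l; first lra.
  apply: le_trans (sum_powR_le _ a01) _; apply: ler_wpM2l; first by rewrite invr_ge0; lra.
  rewrite -powRM ?ler0n //; apply: ge0_ler_powR; rewrite ?nnegrE ?mulr_ge0 ?ler0n //; first lra.
  by rewrite -natrM ler_nat mul2n doubleS ltnW.
have bound : theta_ 2 (1 / 2 : R) m ^+ 2 <= K ^+ 2 * (m.+1%:R `^ (- a)) ^+ 2.
  rewrite -exprMn ler_sqr ?nnegrE ?HK' // mulr_ge0 ?powR_ge0 //; lra.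
have : 1 / 2 <= C * m.+1%:R `^ (- (3 * a - 1)).
  apply: le_trans H3 _; apply: le_trans (ler_pM _ _ bound sum) _.
  - exact: sqr_ge0.
  - by apply: sumr_ge0 => j _; exact: theta_ge0.
  have -> : m.+1%:R `^ (- (3 * a - 1)) = m.+1%:R `^ (- a) ^+ 2 * m.+1%:R `^ (1 - a) :> R.
    rewrite -powR_mulrn ?powR_ge0 // -powRrM -powRD; last by rewrite pnatr_eq0 implybT.
    by congr (_ `^ _); ring.
  by rewrite /C le_eqVlt; apply/orP; left; apply/eqP; ring.
by rewrite leNgt mulrC -ltr_pdivlMr // Hm.
Qed.

End Exponent.

Theorem theorem1p1 (R : realType) (d : nat) : (2 <= d)%N ->
  (eta1 d R <= (if d == 2%N then (1 / 3 : R)%:E else (d%:R / 3 : R)%:E))%E.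
Proof.
move=> d2; have d0 : (0 < d)%N by lia.
have dR : 0 < d%:R :> R by rewrite ltr0n.
have c2 : 0 < 1 / 3 :> R by lra.
have c2' : 1 / 3 < 1 :> R by lra.
have cd : 0 < d%:R / 3 :> R by lra.
have cd' : d%:R / 3 < d%:R / 2 :> R by lra.
rewrite leNgt; apply/negP; have [E|ne] := eqVneq d 2%N.
  subst d => /(decay_of_exponent c2 c2')[a [n0 [a3 a1 H]]].
  have a0 : 0 < a by lra.
  have le1 n : theta_ 2 (p_c 2 R) n <= 1 by apply: theta_le1; exact: p_c_01.
  have decay n : (n0 <= n)%N -> theta_ 2 (p_c 2 R) n <= n%:R `^ (- a) by case/H.
  have [K K1 HK] := powR_eventual_bound a0 le1 decay.
  exact: no_fast_decay_2d a3 a1 K1 HK.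
move=> /(decay_of_exponent cd cd')[a [n0 [a3 a1 H]]].
have a0 : 0 < a by lra.
have le1 n : theta_ d (p_c d R) n <= 1 by apply: theta_le1; exact: p_c_01.
have decay n : (n0 <= n)%N -> theta_ d (p_c d R) n <= n%:R `^ (- a) by case/H.
have [K K1 HK] := powR_eventual_bound a0 le1 decay.
apply: (no_fast_decay d0 _ a3 a1 K1 HK).
(* theta_n is 0 at p = 0 for n > 0 and 1 at p = 1, whereas the assumed exponent puts it strictly in
   between; so p_c is not an endpoint. *)
have [h1 h2 _] := H n0.+1 (leqnSn n0).
have /andP[p0 p1] := p_c_01 R d; rewrite !lt_neqAle p0 p1 !andbT.
apply/andP; split; apply/eqP => E.
  by move: h1; rewrite -E theta_p0 ?ltxx.
by move: h2; rewrite E theta_p1 ?ltxx.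
Qed.
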